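(* Let $r<n$ and let $\underline d=(d_1,\dots,d_n)$ be an $n$-tuple of positive integers. For $k\geq -1$ and fixed values of the parameters $N_{r+1},\dots,N_n$, there exist a finite number of $n$-tuples of partitions $\lambda=(\lambda^1,\dots,\lambda^n)$ and multiplicities $m_{\lambda}>0$ such that the decomposition (as representations of $\mathfrak{S}_{N_1}\times\cdots\times\mathfrak{S}_{N_n}$) $$\tilde{H}_k\left(\mathcal{C}_{(N_1,\dots,N_n)}^{(d_1,\dots,d_n)}\right)=\bigoplus_{\lambda} \left([\lambda^1[N_1]]\otimes\cdots\otimes[\lambda^r[N_r]]\otimes[\lambda^{r+1}]\otimes\cdots\otimes[\lambda^n]\right)^{\oplus m_{\lambda}}$$ holds for all $N_1,\dots,N_r$ with $N_i\geq 2m\cdot d_i$, $i=1,\dots,r$, where $m=\min\{\lfloor N_j/d_j\rfloor:j=r+1,\dots,n\}$.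
   Context: $\mathbb{K}$ is a field of characteristic zero; $\tilde{H}_k$ denotes reduced simplicial homology with coefficients in $\mathbb{K}$ (with $\tilde{H}_{-1}(\emptyset)=\mathbb{K}$). Packing complexes: given $n$-tuples $\underline{d}=(d_1,\dots,d_n)$ and $\underline{N}=(N_1,\dots,N_n)$, put $A_i=\{1,\dots,N_i\}$ and let $V$ be the set of $n$-tuples $\alpha=(\alpha_1,\dots,\alpha_n)$ with $\alpha_i\subset A_i$ of size $d_i$. The packing complex $\mathcal{C}_{\underline{N}}^{\underline{d}}$ is the simplicial complex whose $(s-1)$-simplices are the subsets $\{\alpha^1,\dots,\alpha^s\}\subset V$ such that $\alpha^i_k\cap\alpha^j_k=\emptyset$ for all $i\neq j$ and all $1\le k\le n$. The group $\mathfrak{S}_{N_1}\times\cdots\times\mathfrak{S}_{N_n}$ acts on it and on its homology. For a partition $\delta$ of $s$, $[\delta]$ is the corresponding irreducible representation of $\mathfrak{S}_s$ over $\mathbb K$ ($[(s)]$ being trivial), and $\delta[N]=(N-s,\delta_1,\delta_2,\dots)$, which is defined when $N\geq s+\delta_1$. *)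

(* Defs.v *)
From HB Require Import structures.
From mathcomp Require Import all_boot all_order all_algebra all_fingroup.
From mathcomp Require Import all_solvable all_field all_character.
From mathcomp Require Import zify.

Set Implicit Arguments.
Unset Strict Implicit.
Unset Printing Implicit Defensive.

Import Order.TTheory GRing.Theory Num.Theory.
Local Open Scope ring_scope.

Section ReducedHomology.

Variables (K : fieldType) (T : finType).
Implicit Types (C : {set {set T}}) (s t : {set T}) (u v w : T).

Definition is_complex C := forall s t, s \in C -> t \subset s -> t \in C.

Definition before u v := (enum_rank u < enum_rank v)%N.

(* The faces of dimension k; the degree is an integer so that the empty face
   is the face of dimension -1, as required by reduced homology. *)
Definition faces C (k : int) : {set {set T}} := [set s in C | #|s|%:Z == k + 1].

Definition position s v := #|[set u in s | before u v]|.

(* The coefficient of t in the boundary of s = {v_0 < ... < v_k}, that is, in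
   \sum_i (-1)^i [v_0, ..., v_(i-1), v_(i+1), ..., v_k]; here i is
   [position s v] for v = v_i. *)
Definition incidence s t : K :=
  \sum_(v in s | s :\ v == t) (-1) ^+ position s v.

(* The matrix, acting on row vectors of oriented chains, of the boundary map
   C_k -> C_l, where l is meant to be k - 1. Keeping l as a separate parameter
   avoids a cast along k + 1 - 1 = k when two of them are composed. *)
Definition boundary C (k l : int) : 'M[K]_(#|faces C k|, #|faces C l|) :=
  \matrix_(i, j) incidence (enum_val i) (enum_val j).

Variables (gT : finGroupType) (to : {action gT &-> T}).
Implicit Types g h : gT.

(* The number of pairs of vertices of s whose order is reversed by g; its parity
   is the sign of the permutation sorting (g v_0, ..., g v_k). *)
Definition inversions g s :=
  #|[set p in setX s s | before p.1 p.2 && before (to p.2 g) (to p.1 g)]|.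

(* The chain map [v_0, ..., v_k] |-> [g v_0, ..., g v_k] in the basis of the
   increasingly oriented faces. *)
Definition chain_mx C k g : 'M[K]_#|faces C k| :=
  \matrix_(i, j) ((-1) ^+ inversions g (enum_val i)
                    *+ (enum_val j == (to^*)%act (enum_val i) g)).

Lemma beforeN u v : u != v -> before v u = ~~ before u v.
Proof.
move=> uv; rewrite /before -leqNgt [RHS]leq_eqVlt val_eqE.
by rewrite (inj_eq enum_rank_inj) eq_sym (negPf uv).
Qed.

Lemma before_irr u : before u u = false.
Proof. by rewrite /before ltnn. Qed.

Lemma inversionsE g s : inversions g s =
  (\sum_(p in setX s s) (before p.1 p.2 && before (to p.2 g) (to p.1 g)))%N.
Proof.
rewrite /inversions -sum1_card big_mkcond [RHS]big_mkcond /=.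
by apply: eq_bigr => p _; rewrite inE; case: (p \in _).
Qed.

Lemma positionE s v : position s v = (\sum_(u in s) before u v)%N.
Proof.
rewrite /position -sum1_card big_mkcond [RHS]big_mkcond /=.
by apply: eq_bigr => p _; rewrite inE; case: (p \in _) => //=; case: before.
Qed.

Lemma inversions1 s : inversions 1%g s = 0%N.
Proof.
rewrite inversionsE big1 // => p _; rewrite !act1 /before.
by case: ltngtP.
Qed.

Lemma inversionsM g h s :
  (-1) ^+ inversions (g * h)%g s
    = (-1) ^+ inversions g s * (-1) ^+ inversions h ((to^*)%act s g) :> K.
Proof.
rewrite -exprD.
pose sw (p : T * T) := (p.2, p.1).
pose b (p : T * T) := before p.1 p.2.
pose ag g (p : T * T) := (to p.1 g, to p.2 g).
pose X := (\sum_(p in setX s s) [&& b p, ~~ b (ag g p), b (ag (g * h)%g p) & p.1 != p.2])%N.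
suff -> : (inversions g s + inversions h ((to^*)%act s g)
          = inversions (g * h)%g s + X.*2)%N.
  by rewrite exprD -[X in _ * X]signr_odd odd_double mulr1.
have -> : inversions h ((to^*)%act s g) =
  (\sum_(p in setX s s) [&& b (ag g p), b (sw (ag (g * h)%g p)) & p.1 != p.2])%N.
  rewrite inversionsE.
  have -> : setX ((to^*)%act s g) ((to^*)%act s g) = [set ag g p | p in setX s s].
    apply/setP => -[u v]; rewrite !inE /=; apply/andP/imsetP.
      case=> /imsetP[x xs ->] /imsetP[y ys ->]; exists (x, y) => //.
      by rewrite inE xs ys.
    by case=> -[x y]; rewrite inE /= => /andP[xs ys] [-> ->]; split; apply: imset_f.
  rewrite big_imset /=; last first.
    by move=> [x y] [x' y'] _ _ [] /act_inj -> /act_inj ->.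
  apply: eq_bigr => -[u v] _; rewrite /b /ag /= !actM.
  by case: (eqVneq u v) => [->|]; rewrite ?before_irr ?andbT.
have -> : (\sum_(p in setX s s) [&& b (ag g p), b (sw (ag (g * h)%g p)) & p.1 != p.2])%N
   = (\sum_(p in setX s s) [&& b p, b (ag g p), b (sw (ag (g * h)%g p)) & p.1 != p.2] + X)%N.
  have -> : X = (\sum_(p in setX s s) [&& ~~ b p, b (ag g p), b (sw (ag (g * h)%g p)) & p.1 != p.2])%N.
    rewrite /X (reindex_inj (h := sw)) /=; last by move=> [x y] [x' y'] [-> ->].
    apply: eq_big => -[u v]; first by rewrite !inE andbC.
    move=> _; rewrite /b /= eq_sym; case: (eqVneq u v) => [->|uv]; first by rewrite !andbF.
    rewrite beforeN // [before (to v g) _]beforeN ?negbK //.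
    by apply: contra uv => /eqP/act_inj->.
  rewrite -big_split; apply: eq_bigr => p _ /=.
  by case: (b p); rewrite /= ?addn0.
rewrite addnA -addnn addnA; congr (_ + X)%N; rewrite /X !inversionsE.
rewrite -!big_split; apply: eq_bigr => -[u v] _.
rewrite /b /ag /=; case: (eqVneq u v) => [->|uv]; first by rewrite !before_irr !andbF.
have uvg x : to u x != to v x by apply: contra uv => /eqP/act_inj->.
rewrite [before (to v g) _]beforeN // [before (to v (g * h)%g) _]beforeN //.
by case: (before u v); case: (before (to u g) _); case: (before (to u (g * h)%g) _).
Qed.

Lemma inversions_position g s v : v \in s ->
  (-1) ^+ inversions g s * (-1) ^+ position ((to^*)%act s g) (to v g)
    = (-1) ^+ position s v * (-1) ^+ inversions g (s :\ v) :> K.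
Proof.
move=> vs; rewrite -!exprD.
pose b1 := (\sum_(u in s) (before u v && before (to v g) (to u g)))%N.
pose c1 := (\sum_(u in s) (before v u && before (to u g) (to v g)))%N.
have -> : position ((to^*)%act s g) (to v g) =
  (\sum_(u in s) before (to u g) (to v g))%N.
  by rewrite positionE big_imset //= => x y _ _; apply: act_inj.
have -> : inversions g s = (inversions g (s :\ v) + (b1 + c1))%N.
  rewrite !inversionsE.
  pose F u w : nat := before u w && before (to w g) (to u g).
  have E (r : {set T}) : (\sum_(p in setX r r) (before p.1 p.2 && before (to p.2 g) (to p.1 g))
      = \sum_(u in r) \sum_(w in r) F u w)%N.
    by rewrite pair_big; apply: eq_bigl => -[x y]; rewrite !inE.
  rewrite !E (big_setD1 v) //=.
  under [X in (_ + X)%N]eq_bigr => u _ do rewrite (big_setD1 v) //=.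
  rewrite big_split /= addnC.
  have -> : (\sum_(i in s :\ v) F i v = b1)%N.
    by rewrite /b1 [RHS](big_setD1 v) //= before_irr.
  have -> : (\sum_(w in s) F v w = c1)%N by [].
  by rewrite addnAC addnC addnA addnAC addnC addnA [(b1 + _)%N]addnC -addnA.
have e : (\sum_(u in s) before (to u g) (to v g) + b1 = position s v + c1)%N.
  rewrite positionE /b1 /c1 -!big_split; apply: eq_bigr => u _ /=.
  case: (eqVneq u v) => [->|uv]; first by rewrite !before_irr.
  rewrite [before v u]beforeN // [before (to v g) _]beforeN; last first.
    by apply: contra uv => /eqP/act_inj->.
  by case: (before u v); case: (before (to u g) _).
rewrite -signr_odd -[RHS]signr_odd; congr (_ ^+ nat_of_bool _).
move: e; set P := (\sum_(u in s) _)%N; set i := inversions _ _.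
set p := position _ _ => e; have -> : (i + (b1 + c1) + P = p + i + c1.*2)%N by lia.
by rewrite oddD odd_double addbF.
Qed.

Lemma boundary_boundary C (k : int) : is_complex C ->
  boundary C (k + 1) k *m boundary C k (k - 1) = 0.
Proof.
move=> cC; apply/matrixP => i j; rewrite !mxE.
under eq_bigr do rewrite !mxE.
set s := enum_val i; set t := enum_val j.
have : s \in faces C (k + 1) by apply: enum_valP.
rewrite inE => /andP[sC /eqP sk].
rewrite -(big_enum_val (fun u : {set T} => incidence s u * incidence u t)) /=.
pose D v w := [&& v \in s, w \in s, v != w & s :\ v :\ w == t].
pose F v w : K := (-1) ^+ position s v * (-1) ^+ position (s :\ v) w.
transitivity (\sum_v \sum_(w | D v w) F v w).
  under eq_bigr do rewrite /incidence mulr_suml.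
  rewrite (exchange_big_dep (mem s)) /=; last by move=> u v _ /andP[].
  rewrite [LHS]big_mkcond /=; apply: eq_bigr => v _.
  case: ifP => vs; last by rewrite big1 // => w; rewrite /D vs.
  rewrite (big_pred1 (s :\ v)) /=; last first.
    move=> u /=; rewrite eq_sym.
    case: eqVneq => [->|_]; last by rewrite !andbF.
    rewrite vs inE (cC s) ?subsetDl //=.
    by move: sk; rewrite (cardsD1 v) vs; lia.
  rewrite /incidence mulr_sumr; apply: eq_bigl => w.
  rewrite /D !inE vs eq_sym.
  by case: (v != w) => //=; rewrite andbF.
rewrite pair_big_dep /= (bigID (fun p : T * T => before p.1 p.2)) /=.
rewrite [X in _ + X](reindex_inj (h := fun p : T * T => (p.2, p.1))) /=; last first.
  by move=> [x y] [x' y'] [-> ->].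
have eD v w : D w v = D v w.
  rewrite /D eq_sym; do 2 case: (_ \in s) => //=.
  by rewrite !setDDl setUC.
have eB v w : D v w && ~~ before w v = D v w && before v w.
  by rewrite /D; case: (eqVneq v w) => [->|/beforeN->]; rewrite ?andbF ?negbK.
under [X in _ + X]eq_bigl do rewrite eD eB.
rewrite -big_split big1 //= => -[v w] /= /andP[/and4P[vs ws vw _] bvw].
have pv : position (s :\ w) v = position s v.
  by rewrite !positionE [RHS](big_setD1 w) //= beforeN // bvw.
have pw : position s w = (position (s :\ v) w).+1.
  by rewrite !positionE (big_setD1 v) //= bvw.
by rewrite /F pv pw exprS mulN1r mulNr mulrC subrr.
Qed.

Variables (C : {set {set T}}) (toC : [acts [set: gT], on C | to^*]).

Lemma faces_act (k : int) s g : (setact to s g \in faces C k) = (s \in faces C k).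
Proof.
by rewrite !inE card_setact (acts_act toC) ?inE.
Qed.

Lemma chain_mx_repr (k : int) : mx_repr [set: gT] (chain_mx C k).
Proof.
split=> [|g h _ _]; apply/matrixP => i j.
  rewrite !mxE inversions1 act1 expr0.
  by rewrite (inj_eq enum_val_inj) eq_sym.
rewrite !mxE; under eq_bigr do rewrite !mxE.
pose F (u : {set T}) : K := (-1) ^+ inversions g (enum_val i)
  *+ (u == setact to (enum_val i) g) *
   ((-1) ^+ inversions h u *+ (enum_val j == setact to u h)).
rewrite -(big_enum_val F) /F /=.
rewrite (bigD1 (setact to (enum_val i) g)) /=; last by rewrite faces_act enum_valP.
rewrite big1 ?addr0 => [|u /andP[_ /negPf->]]; last by rewrite mul0r.
by rewrite eqxx mulr1n inversionsM -mulrnAr (actM (to^*)%act).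
Qed.

Definition chain_repr k := MxRepresentation (chain_mx_repr (k : int)).

Lemma incidence_act g s t :
  (-1) ^+ inversions g s * incidence (setact to s g) (setact to t g)
    = incidence s t * (-1) ^+ inversions g t.
Proof.
rewrite /incidence mulr_sumr mulr_suml.
have inj : {in s &, injective (to^~ g)} by move=> x y _ _; apply: act_inj.
rewrite big_mkcondr big_imset //= -big_mkcondr /=.
have E v : (setact to s g :\ to v g == setact to t g) = (s :\ v == t).
  have -> : setact to s g :\ to v g = setact to (s :\ v) g.
    apply/setP => x; rewrite -[x](actKV to g) /setact in_setD1.
    by rewrite !(mem_imset _ _ (act_inj to g)) in_setD1 (inj_eq (act_inj to g)).
  by rewrite (inj_eq (act_inj (to^*)%act g)).
apply: eq_big => [v|v]; rewrite E // => /andP[vs /eqP <-].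
exact: inversions_position.
Qed.

Lemma boundary_equivariant k l g :
  chain_repr k g *m boundary C k l = boundary C k l *m chain_repr l g.
Proof.
apply/matrixP => i j; rewrite !mxE.
under eq_bigr do rewrite !mxE; under [RHS]eq_bigr do rewrite !mxE.
pose F (u : {set T}) : K := ((-1) ^+ inversions g (enum_val i)
  *+ (u == setact to (enum_val i) g)) * incidence u (enum_val j).
pose H (u : {set T}) : K := incidence (enum_val i) u * ((-1) ^+ inversions g u
  *+ (enum_val j == setact to u g)).
rewrite -(big_enum_val F) -(big_enum_val H) /F /H /=.
rewrite (bigD1 (setact to (enum_val i) g)) /=; last by rewrite faces_act enum_valP.
rewrite big1 ?addr0 => [|u /andP[_ /negPf->]]; last by rewrite mul0r.
have ej : setact to (setact to (enum_val j) g^-1) g = enum_val j.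
  exact: (actKV (to^*)%act).
rewrite (bigD1 (setact to (enum_val j) g^-1)) /=; last by rewrite faces_act enum_valP.
rewrite big1 ?addr0 => [|u /andP[_ ne]]; last first.
  rewrite [_ == _]negbTE ?mulr0 //; apply: contra ne => /eqP->.
  by rewrite (actK (to^*)%act).
by rewrite eqxx ej eqxx !mulr1n -{1}ej incidence_act.
Qed.

Lemma boundaries_module (k : int) : mxmodule (chain_repr k) <<boundary C (k + 1) k>>%MS.
Proof.
rewrite (eqmx_module _ (genmxE _)); apply/mxmoduleP => g _.
by rewrite -boundary_equivariant submxMl.
Qed.

Lemma cycles_module (k : int) : mxmodule (chain_repr k) (kermx (boundary C k (k - 1))).
Proof.
apply/mxmoduleP => g _; apply/sub_kermxP.
by rewrite -mulmxA boundary_equivariant mulmxA mulmx_ker mul0mx.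
Qed.

(* [section_repr modU modV] is V / U : cycles modulo boundaries. *)
Definition reduced_homology (k : int) : representation K [set: gT] :=
  Representation (section_repr (boundaries_module k) (cycles_module k)).

End ReducedHomology.

Section ExternalTensor.

Variables (K : fieldType) (I : finType) (gT : I -> finGroupType).
Variable rG : forall i, representation K [set: gT i].

Local Notation m i := (rdegree (rG i)).
Local Notation index := {dffun forall i, 'I_(m i)}.

(* The Kronecker product of the matrices rG i (g i); the basis of the tensor
   product is indexed by the families of basis indices of the factors. *)
Definition tensor_mx (g : {dffun forall i, gT i}) : 'M[K]_#|{: index}| :=
  \matrix_(a, b) \prod_i rG i (g i) ((enum_val a : index) i) ((enum_val b : index) i).

Lemma prod_sum_dffun (F : forall i, 'I_(m i) -> K) :
  \prod_i \sum_(c < m i) F i c = \sum_(c : index) \prod_i F i (c i).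
Proof.
pose T_ i : finType := 'I_(m i).
pose P_ i : {ffun T_ i -> K} := [ffun c => F i c].
transitivity (\prod_i \sum_(c : T_ i) P_ i c).
  by apply: eq_bigr => i _; apply: eq_bigr => c _; rewrite ffunE.
under eq_bigr do rewrite (big_tag (fun i c => P_ i c)).
rewrite bigA_distr_big_dep; transitivity (\sum_(t : fprod T_) \prod_(i in I) P_ i (t i)).
  by rewrite (big_fprod _ _ P_).
rewrite (reindex (@fprod_of_dffun I T_)) /=; last first.
  by apply: onW_bij; exists (@dffun_of_fprod I T_);
     [exact: fprod_of_dffunK | exact: dffun_of_fprodK].
apply: eq_bigr => c _; apply: eq_bigr => i _.
by rewrite ffunE fprodE.
Qed.

Lemma tensor_mx_repr : mx_repr [set: {dffun forall i, gT i}] tensor_mx.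
Proof.
split=> [|g h _ _]; apply/matrixP => a b; rewrite !mxE.
  under eq_bigr do rewrite ffunE repr_mx1 mxE.
  have [->|ab] := eqVneq a b.
    by rewrite big1 // => i _; rewrite eqxx.
  apply/eqP/prodf_eq0; have [/forallP e|] := boolP [forall i, (enum_val a : index) i == (enum_val b : index) i].
    case/eqP: ab; apply: enum_val_inj.
    by apply/(@ffunP I (fun i => 'I_(m i))) => i; apply/eqP.
  by rewrite negb_forall => /existsP[i /negPf ne]; exists i; rewrite // ne.
under eq_bigr do rewrite ffunE repr_mxM ?inE // mxE.
rewrite prod_sum_dffun; under [RHS]eq_bigr do rewrite !mxE.
rewrite -(big_enum_val (fun c : index =>
  (\prod_i rG i (g i) ((enum_val a : index) i) (c i)) *
  (\prod_i rG i (h i) (c i) ((enum_val b : index) i)))) /=.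
by apply: eq_bigr => c _; rewrite big_split.
Qed.

Definition tensor_repr : representation K [set: {dffun forall i, gT i}] :=
  Representation (MxRepresentation tensor_mx_repr).

End ExternalTensor.

Section Specht.

(* sh is a sequence of row lengths with sum s. The tableau of shape sh is filled
   row by row with 0, ..., s - 1, so that x lies in the row [reshape_index sh x]
   and in the column [reshape_offset sh x]. Null rows are harmless. *)
Variables (K : fieldType) (s : nat) (sh : seq nat).

Definition row_stabilizer : {set 'S_s} :=
  [set p : 'S_s | [forall x, reshape_index sh (p x) == reshape_index sh x]].

Definition col_stabilizer : {set 'S_s} :=
  [set q : 'S_s | [forall x, reshape_offset sh (q x) == reshape_offset sh x]].

(* The Young symmetrizer, as an element of the group algebra. In 'S_s the
   product q * p is "q, then p", and representations act on the right of row
   vectors: this is the element a_sh b_sh of the group algebra for the usual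
   composition, and the module it generates is the left ideal K[S_s] a_sh b_sh,
   that is, the irreducible representation [sh] in characteristic zero. *)
Definition young_symmetrizer : 'rV[K]_#|[set: 'S_s]| :=
  \sum_(q in col_stabilizer) \sum_(p in row_stabilizer)
    (-1) ^+ q *: delta_mx 0 (gring_index [set: 'S_s] (q * p)%g).

Definition specht : representation K [set: 'S_s] :=
  Representation (submod_repr
    (cyclic_mx_module (regular_repr K [set: 'S_s]) young_symmetrizer)).

End Specht.

Definition is_partition (sh : seq nat) := sorted geq sh && (0%N \notin sh).

(* The shape sh[N] = (N - |sh|, sh_1, sh_2, ...); when sh is empty and N = 0 it
   is the sequence (0), with the trivial representation of 'S_0. *)
Definition padded (sh : seq nat) (N : nat) : seq nat := (N - sumn sh)%N :: sh.

Definition padded_defined (sh : seq nat) (N : nat) := (sumn sh + head 0 sh <= N)%N.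

Section Packing.

Variables (n : nat) (N d : 'I_n -> nat).

Local Notation group := {dffun forall i : 'I_n, 'S_(N i)}.
Local Notation vertex := {dffun forall i : 'I_n, {set 'I_(N i)}}.

(* The vertices used by the faces are the families a with #|a i| = d i; the
   other elements of the type [vertex] are vertices of no face. *)
Definition packing_complex : {set {set vertex}} :=
  [set s : {set vertex} | [forall a in s, forall i, #|(a : vertex) i| == d i]
        && [forall a in s, forall b in s,
              (a != b) ==> [forall i, [disjoint (a : vertex) i & (b : vertex) i]]]].

Lemma packing_complexP : is_complex packing_complex.
Proof.
move=> s t; rewrite !inE => /andP[/forall_inP sd /forall_inP ss] ts.
apply/andP; split; apply/forall_inP => a /(subsetP ts) a_s; first exact: sd.
by apply/forall_inP => b /(subsetP ts); apply: (forall_inP (ss a a_s)).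
Qed.

Definition packing_act_fun (a : vertex) (g : group) : vertex :=
  [ffun i => g i @: a i].

Lemma packing_act1 a : packing_act_fun a 1%g = a.
Proof.
apply/ffunP => i; rewrite !ffunE.
by rewrite (eq_imset _ (perm1 (T := _))) imset_id.
Qed.

Lemma packing_actM a : act_morph packing_act_fun a.
Proof.
move=> g h; apply/ffunP => i; rewrite !ffunE -imset_comp.
by apply: eq_imset => x; rewrite permM.
Qed.

Canonical packing_act := TotalAction packing_act1 packing_actM.

Lemma packing_complex_act (g : group) (s : {set vertex}) :
  s \in packing_complex -> setact packing_act s g \in packing_complex.
Proof.
rewrite !inE => /andP[/forall_inP sd /forall_inP ss].
apply/andP; split; apply/forall_inP => _ /imsetP[a a_s ->].
  apply/forallP => i; rewrite ffunE card_imset; last exact: perm_inj.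
  exact: (forallP (sd a a_s)).
apply/forall_inP => _ /imsetP[b b_s ->]; rewrite (inj_eq (act_inj packing_act g)).
apply/implyP => ab; apply/forallP => i; rewrite !ffunE.
rewrite imset_disjoint; last exact: perm_inj.
exact: (forallP (implyP (forall_inP (ss a a_s) b b_s) ab)).
Qed.

Lemma packing_acts : [acts [set: group], on packing_complex | packing_act^*].
Proof.
apply/actsP => g _ s; apply/idP/idP => [sg|]; last exact: packing_complex_act.
by rewrite -(actK (packing_act^*)%act g s); apply: packing_complex_act.
Qed.

Variable K : fieldType.

Definition packing_homology (k : int) : representation K [set: group] :=
  reduced_homology K packing_acts k.

(* Indices are shifted by one: the indices 1, ..., r of the stable factors are here the i < r. *)
Definition stable_shape (r : nat) (lam : {ffun 'I_n -> seq nat}) (i : 'I_n) :=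
  if (i < r)%N then padded (lam i) (N i) else lam i.

Definition stable_irr (r : nat) (lam : {ffun 'I_n -> seq nat}) :
    representation K [set: group] :=
  tensor_repr (fun i => specht K (N i) (stable_shape r lam i)).

(* The minimum of the N_j / d_j over the indices j >= r; the default value of
   the iterated minimum is one of its terms, that of index r. *)
Definition packing_bound (r : nat) (hr : (r < n)%N) : nat :=
  \big[minn/(N (Ordinal hr) %/ d (Ordinal hr))%N]_(j < n | (r <= j)%N)
     (N j %/ d j)%N.

End Packing.

(* Main.v *)
(* In characteristic zero a representation is determined by its trace, and the
   homology of the packing complex decomposes over the products of Specht
   modules, with multiplicities computed by the Young symmetrizers; so it is
   enough to see that these multiplicities do not depend on N_1, ..., N_r. A
   face has at most m vertices, hence uses at most m d_i points of the i-th
   factor; if |lambda^i| > m d_i the column antisymmetrizer of lambda^i[N_i]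
   kills every chain. For the other lambda one tests the homology against the
   Young subgroups of shapes mu^i[N_i] with |mu^i| <= m d_i: the dimension of
   the invariants is the product of the vector of multiplicities by a matrix of
   Kostka numbers, which is unitriangular for the dominance order.
   These dimensions are stable, because after taking invariants the inclusion of
   a packing complex into a larger one becomes an isomorphism of complexes as
   soon as the first row of mu^i[N_i] has room for m d_i points, that is, when
   N_i >= 2 m d_i. The Kostka numbers are stable too: their Gram matrix counts
   double cosets of Young subgroups, whose number is stable, and a unitriangular
   matrix is determined by its Gram matrix. *)

Require Import Defs.
From mathcomp Require Import all_boot all_order all_algebra all_fingroup.
From mathcomp Require Import all_solvable all_character.
From mathcomp Require Import zify ring.

Set Implicit Arguments.
Unset Strict Implicit.
Unset Printing Implicit Defensive.

Import Order.TTheory GRing.Theory Num.Theory.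
Local Open Scope ring_scope.

(** * Characters of representations in characteristic zero *)

(** Symmetrizers involve all columns, and those of the long first row change with N, so
    multiplicities for different N cannot be compared directly. Row stabilizers can: tableaux are
    filled row by row, and a larger N puts its new cells in front of the first row, which shifts the
    old ones without changing their rows. Hence the detour through invariants and Kostka numbers.
    The factor 2 in 2 m d_i serves three times, for |mu|, |nu| <= m d_i: |mu| + mu_1 <= N makes
    mu[N] defined, |mu| + |nu| <= N stabilizes the double cosets, and N - |mu| >= m d_i leaves room
    in the first row. The multiplicity of lambda is defined as the rank of the symmetrizer y on the
    representation, a natural number over any K; the relation y y = kappa y, with kappa nonzero,
    turns traces into ranks. That the Specht characters span the class functions is a matter of
    counting: shapes and conjugacy classes are indexed by one and the same list, and a square matrix
    with a one-sided inverse is invertible. *)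

Section CharZero.

Variables (K : fieldType) (charK : [pchar K] =i pred0).

Lemma natr_char0_eq0 n : (n%:R == 0 :> K) = (n == 0)%N.
Proof. by rewrite (proj1 (pcharf0P K) charK). Qed.

Lemma natr_char0_inj : injective (fun n => n%:R : K).
Proof.
suff H m n : (m <= n)%N -> m%:R = n%:R :> K -> m = n.
  move=> m n e; case/orP: (leq_total m n) => h; first exact: H e.
  by symmetry; apply: H h _; rewrite e.
move=> mn e; apply/eqP; rewrite eqn_leq mn -subn_eq0 -natr_char0_eq0 natrB //=.
by rewrite e subrr eqxx.
Qed.

(** Cancelling C on the left and R on the right of C R C R = a C R leaves R C = a, a scalar matrix
    of size r; the trace is cyclic. *)
Lemma mxtrace_mul_quasi_idem n r (C : 'M[K]_(n, r)) (R : 'M_(r, n)) (a : K) :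
    row_full C -> row_free R -> C *m R *m (C *m R) = a *: (C *m R) ->
  \tr (C *m R) = a * r%:R.
Proof.
move=> /row_fullP[L LC] /row_freeP[S RS] e.
suff RC : R *m C = a%:M by rewrite mxtrace_mulC RC mxtrace_scalar mulr_natr.
transitivity (L *m (C *m R *m (C *m R)) *m S).
  by rewrite !mulmxA LC mul1mx -[RHS]mulmxA RS mulmx1.
by rewrite e -scalemxAr -scalemxAl !mulmxA LC mul1mx RS scalemx1.
Qed.

(** Full-rank factorization of X. The case a = 0 is included: it will show that [kappa] cannot
    vanish. *)
Lemma mxtrace_quasi_idem n (X : 'M[K]_n) (a : K) :
  X *m X = a *: X -> \tr X = a * (\rank X)%:R.
Proof.
rewrite -{1 2 3 4}(mulmx_base X); apply: mxtrace_mul_quasi_idem.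
  exact: col_base_full.
exact: row_base_free.
Qed.

Lemma mul_delta_mxE m n p q (A : 'M[K]_(m, n)) (B : 'M[K]_(p, q)) i j i' j' :
  (A *m delta_mx i j *m B) i' j' = A i' i * B j j'.
Proof.
rewrite !mxE (bigD1 j) //= big1 ?addr0 => [|l /negPf lj].
  rewrite !mxE (bigD1 i) //= big1 ?addr0 => [|k /negPf ki].
    by rewrite mxE !eqxx mulr1.
  by rewrite mxE ki mulr0.
by rewrite !mxE big1 ?mul0r // => k _; rewrite mxE lj andbF mulr0.
Qed.

Lemma mxtrace_lin_mulmx n m (A : 'M[K]_n) (B : 'M[K]_m) :
  \tr (lin_mx (mulmx A \o mulmxr B)) = \tr A * \tr B.
Proof.
rewrite {1}/mxtrace (reindex _ (curry_mxvec_bij n m)) /=.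
transitivity (\sum_(p : 'I_n * 'I_m) A p.1 p.1 * B p.2 p.2).
  apply: eq_bigr => -[i j] _ /=.
  by rewrite /lin_mx !mxE /= vec_mx_delta mxvecE mulmxA mul_delta_mxE.
by rewrite -(pair_bigA _ (fun i j => A i i * B j j)) /= big_distrlr.
Qed.

End CharZero.

(** * The group algebra acting on a representation *)

Section Op.

Variables (K : fieldType) (gT : finGroupType).
Implicit Types (phi psi : gT -> K).

Definition op n (rG : mx_representation K [set: gT] n) phi : 'M_n :=
  \sum_g phi g *: rG g.

Definition conv phi psi (x : gT) : K := \sum_g phi g * psi (g^-1 * x)%g.

Variables (n : nat) (rG : mx_representation K [set: gT] n).

Lemma op_ext phi psi : phi =1 psi -> op rG phi = op rG psi.
Proof. by move=> e; apply: eq_bigr => g _; rewrite e. Qed.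

Lemma repr_mulg g h : rG (g * h)%g = rG g *m rG h.
Proof. by rewrite repr_mxM ?inE. Qed.

Lemma mxtrace_conj g x : \tr (rG (g ^ x)%g) = \tr (rG g).
Proof. by rewrite conjgE !repr_mulg mxtrace_mulC -mulmxA -repr_mulg mulgV repr_mx1 mulmx1. Qed.

Lemma op_conv phi psi : op rG (conv phi psi) = op rG phi *m op rG psi.
Proof.
rewrite /op mulmx_suml.
under [RHS]eq_bigr => g _.
  rewrite mulmx_sumr (reindex_inj (mulgI g^-1%g)) /=.
  under eq_bigr do rewrite -scalemxAl -scalemxAr scalerA -repr_mulg mulKVg.
  over.
rewrite exchange_big; apply: eq_bigr => x _ /=.
by rewrite /conv scaler_suml.
Qed.

Lemma mxtrace_op phi : \tr (op rG phi) = \sum_g phi g * \tr (rG g).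
Proof. by rewrite raddf_sum; apply: eq_bigr => g _ /=; rewrite mxtraceZ. Qed.

Lemma op_scale a phi : op rG (fun g => a * phi g) = a *: op rG phi.
Proof. by rewrite scaler_sumr; apply: eq_bigr => g _; rewrite scalerA. Qed.

Lemma val_submod1J U (modU : mxmodule rG U) g :
  submod_repr modU g *m val_submod 1%:M = val_submod (1%:M : 'M_(\rank U)) *m rG g.
Proof. by rewrite -val_submodE -[submod_repr modU g]mul1mx val_submodJ ?inE. Qed.

Lemma val_submod_op U (modU : mxmodule rG U) phi :
  op (submod_repr modU) phi *m val_submod 1%:M = val_submod (1%:M : 'M_(\rank U)) *m op rG phi.
Proof.
rewrite mulmx_suml mulmx_sumr; apply: eq_bigr => g _.
by rewrite -scalemxAl -scalemxAr val_submod1J.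
Qed.

(** Factor P = Q b through the inclusion b of U. Then b P = a b gives b Q = a, and P g = Q b g = Q S
    b, where S is the action of g on U, has the trace of S b Q = a S. *)
Lemma mxtrace_submod_idem U (modU : mxmodule rG U) (P : 'M_n) g a :
    a != 0 -> P *m P = a *: P -> (P :=: U)%MS ->
  a * \tr (submod_repr modU g) = \tr (P *m rG g).
Proof.
move=> a0 PP PU; pose b := val_submod (1%:M : 'M_(\rank U)).
have [Q Qb] : exists Q, Q *m b = P.
  by exists (in_submod U P); rewrite -val_submodE in_submodK ?PU.
have bfree : row_free b by rewrite /row_free val_submod1.
have bP : b *m P = a *: b.
  have /submxP[D ->] : (b <= P)%MS by rewrite PU val_submod1.
  by rewrite -mulmxA PP scalemxAr.
have bQ : b *m Q = a%:M.
  by apply: (row_free_inj bfree); rewrite -mulmxA Qb bP mul_scalar_mx.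
rewrite -Qb -mulmxA.
rewrite -val_submod1J -/b; clearbody b; move: (submod_repr modU g) => S.
by rewrite mulmxA mxtrace_mulC mulmxA bQ mul_scalar_mx mxtraceZ.
Qed.

Lemma mxtrace_submod_op_idem U (modU : mxmodule rG U) phi :
    op rG phi *m op rG phi = op rG phi ->
  \tr (op (submod_repr modU) phi) = (\rank (U *m op rG phi))%:R.
Proof.
move=> EE; set S := op _ _; pose b := val_submod (1%:M : 'M_(\rank U)).
have Sb : S *m b = b *m op rG phi by apply: val_submod_op.
have bfree : row_free b by rewrite /row_free val_submod1.
have SS : S *m S = 1 *: S.
  apply: (row_free_inj bfree); rewrite scale1r -[LHS]mulmxA Sb.
  by clearbody b S; rewrite mulmxA Sb -mulmxA EE.
rewrite (mxtrace_quasi_idem SS) mul1r; congr (_%:R).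
by rewrite -(mxrankMfree S bfree) Sb (eqmxMr _ (val_submod1 U)).
Qed.

End Op.

(** * Representations with equal traces are similar *)

Section TraceRsim.

Variables (K : fieldType) (charK : [pchar K] =i pred0) (gT : finGroupType).

Lemma pchar0_group : ([pchar K]^'.-group [set: gT])%g.
Proof. by apply/pgroupP => p _ _; rewrite inE /= charK. Qed.

(** The sum is the order of the group times the dimension of the commutant, which contains the
    identity: P is that order times the projector of the matrices onto the commutant. *)
Lemma trace_norm_neq0 n (rG : mx_representation K [set: gT] n) : (0 < n)%N ->
  \sum_g \tr (rG g^-1%g) * \tr (rG g) != 0.
Proof.
move=> n0; pose P := \sum_g lin_mx (mulmx (rG g^-1%g) \o mulmxr (rG g)).
have -> : \sum_g \tr (rG g^-1%g) * \tr (rG g) = \tr P.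
  by rewrite raddf_sum; apply: eq_bigr => g _ /=; rewrite mxtrace_lin_mulmx.
have PE X : mxvec X *m P = mxvec (\sum_g rG g^-1%g *m X *m rG g).
  rewrite mulmx_sumr raddf_sum; apply: eq_bigr => g _.
  by rewrite mul_vec_lin /= mulmxA.
have PP : P *m P = #|gT|%:R *: P.
  apply/row_matrixP => i; rewrite !rowE mulmxA -[delta_mx 0 i]vec_mxK.
  set X := vec_mx _; rewrite PE PE -scalemxAr PE -linearZ; congr mxvec.
  rewrite -sum1_card natr_sum scaler_suml; apply: eq_bigr => h _ /=.
  rewrite scale1r mulmx_sumr mulmx_suml [RHS](reindex_inj (mulIg h)) /=.
  by apply: eq_bigr => g _; rewrite invMg !repr_mulg !mulmxA.
have G0 : (#|gT|%:R != 0 :> K).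
  by rewrite natr_char0_eq0 // -lt0n; apply/card_gt0P; exists 1%g.
rewrite (mxtrace_quasi_idem PP) mulf_neq0 // natr_char0_eq0 // mxrank_eq0.
apply/eqP => P0; have := PE 1%:M; rewrite P0 mulmx0.
under eq_bigr do rewrite mulmx1 -repr_mulg mulVg repr_mx1.
rewrite sumr_const => /eqP; rewrite eq_sym mxvec_eq0 -scaler_nat scaler_eq0.
rewrite cardT -cardE (negPf G0) /= => /eqP/matrixP/(_ (Ordinal n0) (Ordinal n0)) /eqP.
by rewrite !mxE eqxx oner_eq0.
Qed.

(** Average the elementary matrices. If all averages vanished, so would the sum over g of tr(rG1
    g^-1) tr(rG2 g), against [trace_norm_neq0] since the two traces agree. *)
Lemma exists_intertwiner n1 n2 (rG1 : mx_representation K [set: gT] n1)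
    (rG2 : mx_representation K [set: gT] n2) :
    (0 < n1)%N -> (forall g, \tr (rG1 g) = \tr (rG2 g)) ->
  exists2 Y : 'M[K]_(n1, n2), Y != 0 & forall g, rG1 g *m Y = Y *m rG2 g.
Proof.
move=> n10 e; pose F X := \sum_g rG1 g^-1%g *m X *m rG2 g.
have FJ X g : rG1 g *m F X = F X *m rG2 g.
  rewrite mulmx_sumr mulmx_suml (reindex_inj (mulIg g)) /=.
  by apply: eq_bigr => h _; rewrite invMg !repr_mulg !mulmxA -repr_mulg mulgV repr_mx1 mul1mx.
have [/existsP[ij F0]|] := boolP [exists ij, F (delta_mx ij.1 ij.2) != 0].
  by exists (F (delta_mx ij.1 ij.2)).
rewrite negb_exists => /forallP F0; have := trace_norm_neq0 rG1 n10.
suff -> : \sum_g \tr (rG1 g^-1%g) * \tr (rG1 g) = 0 by rewrite eqxx.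
transitivity (\sum_i \sum_j F (delta_mx i j) i j); last first.
  apply: big1 => i _; apply: big1 => j _.
  by have := F0 (i, j); rewrite negbK => /eqP ->; rewrite mxE.
under [RHS]eq_bigr => i _ do under eq_bigr do rewrite summxE.
under [RHS]eq_bigr do rewrite exchange_big.
rewrite exchange_big; apply: eq_bigr => g _ /=; rewrite [\tr (rG1 g)]e big_distrlr.
by apply: eq_bigr => i _; apply: eq_bigr => j _; rewrite mul_delta_mxE.
Qed.

Section HomImage.

Variables (n1 n2 : nat) (rG1 : mx_representation K [set: gT] n1).
Variables (rG2 : mx_representation K [set: gT] n2) (Y : 'M[K]_(n1, n2)).
Hypothesis YJ : forall g, rG1 g *m Y = Y *m rG2 g.

Lemma hom_ker_module : mxmodule rG1 (kermx Y).
Proof.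
apply/mxmoduleP => g _; apply/sub_kermxP.
by rewrite -mulmxA YJ mulmxA mulmx_ker mul0mx.
Qed.

Lemma hom_image_module : mxmodule rG2 <<Y>>%MS.
Proof.
rewrite (eqmx_module _ (genmxE _)); apply/mxmoduleP => g _.
by rewrite -YJ submxMl.
Qed.

Lemma hom_image_rsim (modI : mxmodule rG2 <<Y>>%MS) W (modW : mxmodule rG1 W) :
    (kermx Y + W :=: 1%:M)%MS -> mxdirect (kermx Y + W) ->
  mx_rsim (submod_repr modW) (submod_repr modI).
Proof.
move=> KW dxKW; have rW : \rank W = \rank <<Y>>%MS.
  have := mxdirectP dxKW; rewrite /= KW mxrank1 mxrank_ker genmxE.
  by have := rank_leq_row Y; lia.
pose f := in_submod <<Y>>%MS (val_submod (1%:M : 'M_(\rank W)) *m Y).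
have sY n (A : 'M_(n, n1)) : (A *m Y <= <<Y>>)%MS by rewrite genmxE submxMl.
have fE : f *m val_submod 1%:M = val_submod 1%:M *m Y by rewrite -val_submodE in_submodK.
clearbody f; exists f => // [|g _].
  rewrite -kermx_eq0; apply/rowV0P => v /sub_kermxP vf.
  apply/eqP; rewrite -(val_submod_eq0 (U := W)) -submx0 -(mxdirect_addsP dxKW).
  rewrite sub_capmx val_submodP andbT; apply/sub_kermxP.
  by rewrite val_submodE -mulmxA -fE mulmxA vf mul0mx.
apply: (row_free_inj (A := val_submod (1%:M : 'M_(\rank <<Y>>%MS)))).
  by rewrite /row_free val_submod1.
rewrite -[LHS]mulmxA fE -[RHS]mulmxA !val_submod1J mulmxA val_submod1J.
by rewrite -mulmxA YJ mulmxA -fE -mulmxA.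
Qed.

(** Rank-nullity for traces: Maschke supplies a complement of the kernel, isomorphic to the
    image. *)
Lemma mxtrace_ker_image (modK : mxmodule rG1 (kermx Y)) (modI : mxmodule rG2 <<Y>>%MS) g :
  \tr (submod_repr modK g) + \tr (submod_repr modI g) = \tr (rG1 g).
Proof.
have [W modW KW dxKW] := mx_Maschke_pchar rG1 pchar0_group modK (submx1 _).
rewrite -(mxtrace_rsim (hom_image_rsim modI modW KW dxKW)) ?inE //.
rewrite (mxtrace_dadd_mod modK modW (mxmodule1 _) KW dxKW) ?inE //.
by rewrite mxtrace_submod1 ?inE.
Qed.

End HomImage.

Lemma mxtrace_submod_eqmx n (rG : mx_representation K [set: gT] n) U V
    (modU : mxmodule rG U) (modV : mxmodule rG V) g :
  (U :=: V)%MS -> \tr (submod_repr modU g) = \tr (submod_repr modV g).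
Proof.
by move=> UV; apply: (mxtrace_rsim _ (in_setT g)); apply/mx_rsim_iso; apply: eqmx_iso.
Qed.

(** V / U is the image of V in the quotient by U, under a map with kernel U; [mxtrace_ker_image]
    applies. *)
Lemma mxtrace_section n (rG : mx_representation K [set: gT] n) U V
    (modU : mxmodule rG U) (modV : mxmodule rG V) g : (U <= V)%MS ->
  \tr (section_repr modU modV g) = \tr (submod_repr modV g) - \tr (submod_repr modU g).
Proof.
move=> UV; pose Y := val_submod (1%:M : 'M_(\rank V)) *m in_factmod U 1%:M.
have YE m (A : 'M_(m, \rank V)) : A *m Y = in_factmod U (val_submod A).
  by rewrite mulmxA -val_submodE -in_factmodE.
have YJ h : submod_repr modV h *m Y = Y *m factmod_repr modU h.
  rewrite YE -[submod_repr modV h]mul1mx val_submodJ ?inE //.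
  by rewrite (in_factmodJ modU) ?inE // -YE mul1mx.
have [modU' simU] := mx_rsim_in_submod modU modV UV.
have KU : (kermx Y :=: <<in_submod V U>>)%MS.
  apply/eqmxP/andP; split.
    apply/row_subP => i; have : row i (kermx Y) *m Y = 0.
      by rewrite -row_mul mulmx_ker row0.
    move: (row i _) => v; rewrite YE => /eqP; rewrite in_factmod_eq0 => vU.
    by rewrite genmxE -(val_submodK v) submxMr.
  rewrite genmxE; apply/sub_kermxP; rewrite YE in_submodK //.
  by apply/eqP; rewrite in_factmod_eq0.
have YI : (<<Y>> :=: <<in_factmod U V>>)%MS.
  apply: eqmx_trans (genmxE _) (eqmx_trans _ (eqmx_sym (genmxE _))).
  by rewrite /Y -in_factmodE; apply: eqmxMr; apply: val_submod1.
apply/eqP; rewrite eq_sym subr_eq; apply/eqP.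
rewrite -(mxtrace_ker_image YJ (hom_ker_module YJ) (hom_image_module YJ)) addrC; congr (_ + _).
  exact: mxtrace_submod_eqmx.
by rewrite (mxtrace_rsim simU) ?inE //; apply: mxtrace_submod_eqmx.
Qed.

(** The image of a nonzero intertwiner occurs as a summand on both sides. What is left on each side
    has equal traces and smaller degree, so induction on the degree applies. *)
Theorem mx_rsim_trace n1 n2 (rG1 : mx_representation K [set: gT] n1)
    (rG2 : mx_representation K [set: gT] n2) :
  (forall g, \tr (rG1 g) = \tr (rG2 g)) -> mx_rsim rG1 rG2.
Proof.
have [m] := ubnP n1; elim: m => // m IHm in n1 n2 rG1 rG2 *; rewrite ltnS => n1m e.
have e12 : n1 = n2.
  by have := e 1%g; rewrite !repr_mx1 !mxtrace1 => /(natr_char0_inj charK).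
have [n10|n10] := posnP n1.
  case: _ / e12 in rG2 e *; exists 1%:M => // [|g _]; first by rewrite /row_free mxrank1.
  by apply/matrixP => i; have := ltn_ord i; rewrite {2}n10.
have [Y Y0 YJ] := exists_intertwiner n10 e.
have modK := hom_ker_module YJ; have modI := hom_image_module YJ.
have [W modW KW dxKW] := mx_Maschke_pchar rG1 pchar0_group modK (submx1 _).
have [U modU IU dxIU] := mx_Maschke_pchar rG2 pchar0_group modI (submx1 _).
have simWI := hom_image_rsim YJ modI modW KW dxKW.
have simKU : mx_rsim (submod_repr modK) (submod_repr modU).
  apply: IHm => [|g].
    rewrite mxrank_ker; apply: leq_trans n1m.
    by move: Y0; rewrite -mxrank_eq0; lia.
  have := mxtrace_dadd_mod modK modW (mxmodule1 _) KW dxKW (in_setT g).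
  have := mxtrace_dadd_mod modI modU (mxmodule1 _) IU dxIU (in_setT g).
  rewrite (mxtrace_submod1 (mxmodule1 rG1)) ?inE // (mxtrace_submod1 (mxmodule1 rG2)) ?inE //.
  by rewrite -e (mxtrace_rsim simWI) ?inE // => <-; rewrite addrC => /addrI.
pose rU := Representation (submod_repr modU); pose rI := Representation (submod_repr modI).
have s1 : mx_rsim (submod_repr (mxmodule1 rG1)) (dadd_grepr rU rI).
  exact: (@mx_rsim_dadd _ _ _ _ _ _ _ _ rU rI modK modW (mxmodule1 rG1) KW dxKW simKU simWI).
have s2 : mx_rsim (submod_repr (mxmodule1 rG2)) (dadd_grepr rU rI).
  have UI : (U + <<Y>> :=: 1%:M)%MS by apply/eqmxP; rewrite addsmxC; apply/eqmxP.
  have dxUI : mxdirect (U + <<Y>>)%MS by apply/mxdirect_addsP; rewrite capmxC; apply/mxdirect_addsP.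
  by apply: (@mx_rsim_dadd _ _ _ _ _ _ _ _ rU rI modU modI _ UI dxUI); apply: mx_rsim_refl.
apply: mx_rsim_trans (mx_rsim_sym (rsim_submod1 (mxmodule1 rG1) (eqmx_refl _))) _.
apply: mx_rsim_trans s1 _; apply: mx_rsim_trans (mx_rsim_sym s2) _.
exact: rsim_submod1.
Qed.

End TraceRsim.

(** * Expansion of class functions *)

Section ClassExpansion.

Variables (K : fieldType) (gT : finGroupType) (T : eqType) (L : seq T).
Variables (c chi : T -> gT -> K) (kappa : T -> K) (ty : gT -> T).
Hypotheses (uniqL : uniq L) (tyL : forall g, ty g \in L).
Hypothesis kappa0 : forall l, l \in L -> kappa l != 0.
Hypothesis c_chi : forall l m, l \in L -> m \in L ->
  \sum_g c m g * chi l g = kappa l *+ (l == m).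

(* The square matrices of the values chi l t and of the sums of c l over the
   classes t are mutually inverse up to kappa; as one-sided inverses are
   two-sided, this yields the expansion of every class function. *)
Lemma class_expansion (psi : gT -> K) :
    (forall l, l \in L -> forall g h, ty g = ty h -> chi l g = chi l h) ->
    (forall g h, ty g = ty h -> psi g = psi h) ->
  forall h, psi h = \sum_(l <- L) (kappa l)^-1 * (\sum_g c l g * psi g) * chi l h.
Proof.
move=> chi_ty psi_ty h.
(* The value 0 at a type attained by no g is harmless, since the corresponding row of Z vanishes. *)
pose ev (f : gT -> K) t := if [pick g | ty g == t] is Some g then f g else 0.
have evE f g : (forall g h, ty g = ty h -> f g = f h) -> ev f (ty g) = f g.
  rewrite /ev => f_ty; case: pickP => [g' /eqP /f_ty //|/(_ g)].
  by rewrite eqxx.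
pose t (i : 'I_(size L)) := tnth (in_tuple L) i.
have tL i : t i \in L by apply: mem_tnth.
have ti g : exists i, t i = ty g by have /(tnthP (in_tuple L))[i ->] := tyL g; exists i.
have t_inj : injective t by move=> i j; rewrite /t !(tnth_nth (t i)) => /eqP; rewrite nth_uniq // => /eqP /val_inj.
have sumt (F : gT -> K) : \sum_g F g = \sum_i \sum_(g | ty g == t i) F g.
  rewrite (exchange_big_dep xpredT) //=; apply: eq_bigr => g _.
  have [i e] := ti g; rewrite (big_pred1 i) // => j /=.
  by rewrite -e (inj_eq t_inj) eq_sym.
pose X : 'M_(size L) := \matrix_(i, j) ev (chi (t i)) (t j).
pose Z : 'M_(size L) := \matrix_(i, j) ((kappa (t j))^-1 * \sum_(g | ty g == t i) c (t j) g).
have XZ : X *m Z = 1%:M.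
  apply/matrixP => i j; rewrite !mxE.
  transitivity ((kappa (t j))^-1 * \sum_g c (t j) g * chi (t i) g).
    rewrite sumt mulr_sumr; apply: eq_bigr => k _; rewrite !mxE mulrCA; congr (_ * _).
    rewrite mulr_sumr; apply: eq_bigr => g /eqP <-.
    by rewrite [RHS]mulrC evE //; apply: chi_ty.
  rewrite c_chi // (inj_eq t_inj); case: eqP => [->|_]; last by rewrite mulr0.
  by rewrite mulr1n mulVf ?kappa0.
have [i0 e0] := ti h.
have := congr1 (mulmx (\row_i ev psi (t i))) (mulmx1C XZ).
rewrite mulmx1 mulmxA => /rowP/(_ i0); rewrite !mxE e0 evE // => <-.
rewrite (big_tnth _ _ L); apply: eq_bigr => j _; rewrite !mxE e0 evE; last exact/chi_ty/tL.
congr (_ * _); rewrite sumt mulr_sumr; apply: eq_bigr => i _.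
rewrite !mxE mulrCA; congr (_ * _); rewrite mulr_sumr.
by apply: eq_bigr => g /eqP <-; rewrite evE // mulrC.
Qed.

End ClassExpansion.

(** * Cycle types of permutations *)

Section CycleType.

Variable T : finType.
Implicit Types (s t : {perm T}) (x y : T).

Let cycles s := sort (fun A B : {set T} => #|A| >= #|B|)%N (enum (porbits s)).

Definition cycle_type s : seq nat := sort geq [seq #|pred_of_set A| | A <- enum (porbits s)].

Lemma cycle_typeE s : cycle_type s = [seq #|pred_of_set A| | A <- cycles s].
Proof. by rewrite /cycle_type sort_map. Qed.

Lemma mem_cycles s A : (A \in cycles s) = (A \in porbits s).
Proof. by rewrite mem_sort mem_enum. Qed.

Lemma sumn_cycle_type s : sumn (cycle_type s) = #|T|.
Proof.
rewrite sumnE (perm_big _ (permEl (perm_sort _ _))) /= big_map big_enum /=.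
rewrite -sum1_card (partition_big (porbit s) (mem (porbits s))) /=; last first.
  by move=> x _; apply: imset_f.
apply: eq_bigr => _ /imsetP[y _ ->]; rewrite -sum1_card.
by apply: eq_bigl => x; rewrite /= eq_porbit_mem.
Qed.

Lemma cycle_type_partition s : is_partition (cycle_type s).
Proof.
rewrite /is_partition sort_sorted; last by move=> m n; rewrite /geq /= leq_total.
rewrite mem_sort; apply/negP => /mapP[A]; rewrite mem_enum => /imsetP[x _ ->] /eqP.
by rewrite eq_sym (negPf (card_porbit_neq0 s x)).
Qed.

(** The default makes the choice total; on a nonempty A the result does not depend on it, so all
    points of a cycle see the same base point. *)
Let rep (A : {set T}) x := odflt x [pick y in A].

Let rep_mem (A : {set T}) x : A != set0 -> rep A x \in A.
Proof.
rewrite /rep => /set0Pn[y yA]; case: pickP => //= /(_ y).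
by rewrite yA.
Qed.

Let rep_default (A : {set T}) x y : A != set0 -> rep A x = rep A y.
Proof.
rewrite /rep => /set0Pn[z zA]; case: pickP => //= /(_ z).
by rewrite zA.
Qed.

Let porbit_rep s x : porbit s (rep (porbit s x) x) = porbit s x.
Proof.
apply/eqP; rewrite eq_porbit_mem; apply: rep_mem.
by apply/set0Pn; exists x; apply: porbit_id.
Qed.

Let pos s x := index x (traject s (rep (porbit s x) x) #|porbit s x|).

Let pos_lt s x : (pos s x < #|porbit s x|)%N.
Proof.
rewrite -[X in (_ < X)%N](size_traject s (rep (porbit s x) x)) index_mem.
by rewrite -[in X in traject _ _ X]porbit_rep -porbit_traject porbit_rep porbit_id.
Qed.

Let iter_pos s x : iter (pos s x) s (rep (porbit s x) x) = x.
Proof.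
rewrite -(nth_traject s (pos_lt s x)) nth_index //.
by rewrite -index_mem size_traject pos_lt.
Qed.

Let iter_inj s y i j : (i < #|porbit s y|)%N -> (j < #|porbit s y|)%N ->
  iter i s y = iter j s y -> i = j.
Proof.
move=> i_s j_s; rewrite -(nth_traject s i_s) -(nth_traject s j_s) => /eqP.
by rewrite nth_uniq ?size_traject ?uniq_traject_porbit // => /eqP.
Qed.

Section Conjugator.

Variables s t : {perm T}.
Hypothesis st : cycle_type s = cycle_type t.

Let size_cycles : size (cycles s) = size (cycles t).
Proof. by have := congr1 size st; rewrite !cycle_typeE !size_map. Qed.

Let jx x := index (porbit s x) (cycles s).
Let other x := nth set0 (cycles t) (jx x).

Let jx_lt x : (jx x < size (cycles s))%N.
Proof. by rewrite index_mem mem_cycles imset_f. Qed.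

Let other_porbit x : other x \in porbits t.
Proof. by rewrite -mem_cycles mem_nth // -size_cycles jx_lt. Qed.

Let card_other x : #|other x| = #|porbit s x|.
Proof.
have := congr1 (nth 0%N ^~ (jx x)) st.
rewrite !cycle_typeE !(nth_map set0) -?size_cycles ?jx_lt // => <-.
by rewrite nth_index // mem_cycles imset_f.
Qed.

Let other_neq0 x : other x != set0.
Proof. by rewrite -card_gt0 card_other lt0n card_porbit_neq0. Qed.

Let other_rep x : porbit t (rep (other x) x) = other x.
Proof.
have /imsetP[y _ e] := other_porbit x.
by have := rep_mem x (other_neq0 x); rewrite {2}e -eq_porbit_mem -e => /eqP.
Qed.

(** Cycles of s and t are matched by their places in the lists sorted by length, so matched cycles
    have equal lengths. The conjugator sends the i-th iterate of the base point of a cycle to the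
    i-th iterate of the base point of its match. *)
Let h x := iter (pos s x) t (rep (other x) x).

Let h_porbit x : porbit t (h x) = other x.
Proof. by rewrite /h -permX porbit_perm other_rep. Qed.

Let eq_other x y : porbit s x = porbit s y -> other x = other y.
Proof. by rewrite /other /jx => ->. Qed.

Let h_inj : injective h.
Proof.
move=> x y hxy; have e : other x = other y by rewrite -!h_porbit hxy.
have o : porbit s x = porbit s y.
  have : jx x = jx y.
    apply/eqP; rewrite -(nth_uniq set0 (s := cycles t)) -?size_cycles ?jx_lt //.
      exact/eqP.
    by rewrite sort_uniq enum_uniq.
  by move/(congr1 (nth set0 (cycles s))); rewrite !nth_index // mem_cycles imset_f.
rewrite -[x](iter_pos s) -[RHS](iter_pos s) o.
rewrite (rep_default x y); last by rewrite -card_gt0 lt0n card_porbit_neq0.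
congr (iter _ s _); move: hxy; rewrite /h e (rep_default x y) //.
by apply: iter_inj; rewrite other_rep card_other ?pos_lt // -o pos_lt.
Qed.

Let h_conj x : h (s x) = t (h x).
Proof.
have o : porbit s (s x) = porbit s x by have := porbit_perm s 1 x; rewrite expg1.
have oe := eq_other o.
have r0 y : rep (porbit s x) y = rep (porbit s x) x.
  by apply: rep_default; rewrite -card_gt0 lt0n card_porbit_neq0.
rewrite {1}/h oe (rep_default _ x) //.
(* At the last exponent s x wraps around to the base point; t wraps around at the same time because
   the lengths agree. *)
have := pos_lt s x; rewrite leq_eqVlt => /orP[/eqP e | lt].
  have sx : s x = rep (porbit s x) x.
    rewrite -{1}[x](iter_pos s) -iterS e -{1}[porbit s x]porbit_rep.
    by rewrite iter_porbit.
  have -> : pos s (s x) = 0%N.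
    by rewrite /pos o r0 -sx -e /= eqxx.
  rewrite /h -iterS e -card_other -{2}other_rep.
  by rewrite iter_porbit.
rewrite -iterS; congr (iter _ t _).
have := pos_lt s (s x); rewrite o => lt'.
apply: (@iter_inj s (rep (porbit s x) x)); rewrite ?porbit_rep //=.
by rewrite iter_pos -[RHS](iter_pos s) o r0.
Qed.

Lemma cycle_type_conj : exists g, t = (s ^ g)%g.
Proof.
exists (perm h_inj); apply/permP => y; rewrite -[y](permKV (perm h_inj)).
by rewrite permJ !permE -h_conj.
Qed.

End Conjugator.

End CycleType.

(** * Young tableaux *)

Section Young.

Variable N : nat.
Implicit Types (lam mu : seq nat) (g : 'S_N) (x y : 'I_N).

(** Zero rows are allowed, unlike in [is_partition]: the padding of the empty partition at N = 0 is
    the sequence (0). *)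
Definition is_shape (lam : seq nat) := sorted geq lam && (sumn lam == N).

Definition dominates lam mu := forall j, (sumn (take j mu) <= sumn (take j lam))%N.

Lemma sumn_take_leq lam i j : (i <= j)%N -> (sumn (take i lam) <= sumn (take j lam))%N.
Proof.
by move=> ij; rewrite -[take j lam](cat_take_drop i) take_takel // sumn_cat leq_addr.
Qed.

Lemma sumn_takeS lam i : sumn (take i.+1 lam) = (sumn (take i lam) + nth 0 lam i)%N.
Proof.
have [il|il] := ltnP i (size lam).
  by rewrite (take_nth 0%N) // -cats1 sumn_cat /= addn0.
by rewrite nth_default // addn0 !take_oversize // leqW.
Qed.

(** Antisymmetry holds up to trailing zero rows, hence the use of [nth]. *)
Lemma dominates_anti lam mu : dominates lam mu -> dominates mu lam ->
  nth 0%N lam =1 nth 0%N mu.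
Proof.
move=> lm ml i; have e j : sumn (take j lam) = sumn (take j mu).
  by apply/eqP; rewrite eqn_leq lm ml.
by have := e i.+1; rewrite !sumn_takeS e => /addnI.
Qed.

Lemma nth_sorted_geq lam i j : sorted geq lam -> (i <= j)%N -> (nth 0 lam j <= nth 0 lam i)%N.
Proof.
move=> slam ij; have [jl|jl] := ltnP j (size lam); last by rewrite [nth 0 lam j]nth_default.
have geq_trans : transitive geq by move=> a b c /= ba cb; apply: leq_trans cb ba.
apply: (sorted_leq_nth geq_trans _ 0%N slam) => //; last by rewrite inE (leq_ltn_trans ij).
by move=> n; apply: leqnn.
Qed.

Section Tableau.

Variable lam : seq nat.
Hypothesis slam : is_shape lam.

Local Notation row := (reshape_index lam).
Local Notation col := (reshape_offset lam).

Let sumlam : sumn lam = N. Proof. by case/andP: slam => _ /eqP. Qed.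

Lemma tableau_cell i c : (c < nth 0 lam i)%N -> {x : 'I_N | row x = i & col x = c}.
Proof.
move=> ci; have h : (flatten_index lam i c < N)%N by rewrite -sumlam flatten_indexP.
by exists (Ordinal h); rewrite /= ?flatten_indexKl ?flatten_indexKr.
Qed.

Lemma tableau_col_lt (x : 'I_N) : (col x < nth 0 lam (row x))%N.
Proof. by apply: reshape_offsetP; rewrite sumlam. Qed.

Lemma tableau_inj x y : row x = row y -> col x = col y -> x = y.
Proof.
move=> r c; apply: val_inj; rewrite /= -(reshape_indexK lam x) -(reshape_indexK lam y).
by rewrite r c.
Qed.

Lemma tableau_col_bound x : (col x < N)%N.
Proof. by rewrite /reshape_offset (leq_ltn_trans (leq_subr _ _)). Qed.

Lemma row_lt x j : (row x < j)%N = (x < sumn (take j lam))%N.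
Proof.
have e : (x = sumn (take (row x) lam) + col x :> nat)%N by rewrite -[LHS](reshape_indexK lam).
have := tableau_col_lt x; have := sumn_takeS lam (row x) => t1 t2.
have [rj|jr] := ltnP (row x) j.
  by have := sumn_take_leq lam rj; lia.
by have := sumn_take_leq lam jr; lia.
Qed.

Lemma card_rows_lt j : #|[set x : 'I_N | (row x < j)%N]| = sumn (take j lam).
Proof.
have h : (sumn (take j lam) <= N)%N.
  by rewrite -sumlam -{2}[lam](cat_take_drop j) sumn_cat leq_addr.
rewrite -sum1_card; under eq_bigl do rewrite inE row_lt.
by rewrite -(big_ord_widen _ (fun=> 1%N) h) sum1_card card_ord.
Qed.

End Tableau.

Lemma card_by_col lam (P : pred 'I_N) :
  #|[set x | P x]| = (\sum_(c < N) #|[set x | P x && (reshape_offset lam x == c)]|)%N.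
Proof.
rewrite -sum1_card.
rewrite (partition_big (fun x => Ordinal (tableau_col_bound lam x)) xpredT) //=.
by apply: eq_bigr => c _; rewrite -sum1_card; apply: eq_bigl => x; rewrite !inE -val_eqE.
Qed.

(* When this fails, some transposition of a column of lam is conjugate by g to
   one of a row of mu, and the column antisymmetrizer of lam, g and the row
   symmetrizer of mu have product 0. *)
Definition transverse lam mu g := [forall x : 'I_N, forall y : 'I_N,
  (x != y) ==> (reshape_offset lam x == reshape_offset lam y)
    ==> (reshape_index mu (g x) != reshape_index mu (g y))].

Lemma transverseP lam mu g : reflect
  (forall x y, reshape_offset lam x = reshape_offset lam y ->
     reshape_index mu (g x) = reshape_index mu (g y) -> x = y)
  (transverse lam mu g).
Proof.
apply: (iffP forallP) => [h x y xy gxy|h x].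
  apply/eqP/negPn/negP => ne; have /forallP/(_ y) := h x.
  by rewrite ne xy gxy !eqxx.
apply/forallP => y; apply/implyP => ne; apply/implyP => /eqP xy.
by apply: contra ne => /eqP gxy; apply/eqP/h.
Qed.

Section Transverse.

Variables (lam mu : seq nat) (g : 'S_N).
Hypotheses (slam : is_shape lam) (smu : is_shape mu) (tg : transverse lam mu g).

Local Notation row := (reshape_index lam).
Local Notation col := (reshape_offset lam).

(** The points counted on the left lie in one column, so their images have distinct rows below j,
    and there are at most j of them. If column c of lam reaches row j, it has a cell in each of the
    j rows above; otherwise the right side counts the whole column. *)
Lemma transverse_card_leq j c :
  (#|[set x | (reshape_index mu (g x) < j) && (col x == c)]|
     <= #|[set x : 'I_N | (row x < j) && (col x == c)]|)%N.
Proof.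
have [/existsP[x0 /andP[jx0 /eqP c0]]|] := boolP [exists x : 'I_N, (j <= row x)%N && (col x == c)].
  have cell (i : 'I_j) : {x : 'I_N | row x = i & col x = c}.
    apply: tableau_cell => //; rewrite -c0; apply: leq_trans (tableau_col_lt slam x0) _.
    by case/andP: slam => sl _; apply: nth_sorted_geq => //; apply: leq_trans jx0; apply: ltnW.
  apply: (@leq_trans j).
    set S := finset _; rewrite cardE -(size_map (fun x => reshape_index mu (g x))).
    rewrite -[leqRHS](size_iota 0 j); apply: uniq_leq_size.
      rewrite map_inj_in_uniq ?enum_uniq // => x y; rewrite !mem_enum !inE.
      move=> /andP[_ /eqP xc] /andP[_ /eqP yc]; apply: (transverseP _ _ _ tg).
      by rewrite xc yc.
    move=> a /mapP[x]; rewrite mem_enum inE => /andP[xj _] ->.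
    by rewrite mem_iota.
  rewrite -[X in (X <= _)%N](card_ord j) -cardsT.
  rewrite -(card_imset setT (f := fun i : 'I_j => s2val (cell i))).
    apply: subset_leq_card; apply/subsetP => _ /imsetP[i _ ->]; rewrite inE.
    by case: (cell i) => x /= -> ->; rewrite ltn_ord eqxx.
  move=> i i'; case: (cell i) => x /= ri _; case: (cell i') => x' /= ri' _ e.
  by apply: val_inj; rewrite /= -ri -ri' e.
rewrite negb_exists => /forallP h; apply: subset_leq_card; apply/subsetP => x.
rewrite !inE => /andP[_ cx]; rewrite cx andbT.
by have := h x; rewrite cx andbT -ltnNge.
Qed.

(** Sum over the columns, after pulling the first j rows of mu back by g. *)
Lemma transverse_dominates : dominates lam mu.
Proof.
move=> j; rewrite -(card_rows_lt smu) -(card_rows_lt slam).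
have -> : #|[set x : 'I_N | (reshape_index mu x < j)%N]|
    = #|[set x | (reshape_index mu (g x) < j)%N]|.
  rewrite -(card_imset _ (@perm_inj _ g)); congr #|pred_of_set _|; apply/setP => y.
  rewrite inE; apply/idP/imsetP => [yj|[x]]; last by rewrite inE => ? ->.
  by exists (g^-1 y)%g; rewrite ?inE permKV.
rewrite !(card_by_col lam); apply: leq_sum => c _; exact: transverse_card_leq.
Qed.

End Transverse.

Section TransverseEq.

Variables (lam : seq nat) (g : 'S_N).
Hypotheses (slam : is_shape lam) (tg : transverse lam lam g).

Local Notation row := (reshape_index lam).
Local Notation col := (reshape_offset lam).

(** For mu = lam the inequalities of [transverse_card_leq] have equal sums over the columns, so each
    of them is an equality. *)
Lemma transverse_card_eq j c : (c < N)%N ->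
  #|[set x | (row (g x) < j)%N && (col x == c)]|
    = #|[set x : 'I_N | (row x < j)%N && (col x == c)]|.
Proof.
move=> cN; pose F j (c : 'I_N) := #|[set x | (row (g x) < j)%N && (col x == c)]|.
pose H j (c : 'I_N) := #|[set x : 'I_N | (row x < j)%N && (col x == c)]|.
have FH : (\sum_c F j c = \sum_c H j c)%N.
  rewrite -(card_by_col lam (fun x => row (g x) < j)%N).
  rewrite -(card_by_col lam (fun x => row x < j)%N).
  rewrite -[RHS](card_imset _ (@perm_inj _ g^-1%g)); congr #|pred_of_set _|.
  apply/setP => y; rewrite inE; apply/idP/imsetP => [yj|[x]].
    by exists (g y); rewrite ?inE ?permK.
  by rewrite inE => xj ->; rewrite permKV.
have := leqif_sum (fun c _ => leqif_eq (transverse_card_leq slam tg j c)) (P := xpredT) (I := 'I_N).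
case=> _; rewrite FH eqxx => /esym/forallP/(_ (Ordinal cN)) /eqP.
by [].
Qed.

(** Compare the equalities for j = row (g x) and its successor: the column of x has as many cells in
    that row as points sent to that row, and x is such a point. *)
Lemma transverse_cell x : exists y : 'I_N, row y = row (g x) /\ col y = col x.
Proof.
have := transverse_card_eq (row (g x)).+1 (tableau_col_bound lam x).
have := transverse_card_eq (row (g x)) (tableau_col_bound lam x).
have cut (r : 'I_N -> nat) : #|[set y | (r y < (row (g x)).+1)%N && (col y == col x)]|
   = (#|[set y | (r y < row (g x))%N && (col y == col x)]| + #|[set y | (r y == row (g x)) && (col y == col x)]|)%N.
  rewrite -cardsUI [X in (_ + X)%N](_ : _ = 0%N) ?addn0; last first.
    by apply: eq_card0 => y; rewrite !inE; case: ltngtP => //=; rewrite ?andbF.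
  by apply: eq_card => y; rewrite !inE ltnS leq_eqVlt orbC andb_orl.
rewrite !cut => -> /addnI e.
have : (0 < #|[set y : 'I_N | (row y == row (g x)) && (col y == col x)]|)%N.
  by rewrite -e; apply/card_gt0P; exists x; rewrite inE !eqxx.
by case/card_gt0P => y; rewrite inE => /andP[/eqP ? /eqP ?]; exists y.
Qed.

(** q moves x inside its column to the row of g x; what remains of g preserves rows. Transversality
    makes q injective. *)
Lemma transverse_factor : exists q p : 'S_N,
  [/\ q \in col_stabilizer N lam, p \in row_stabilizer N lam & g = (q * p)%g].
Proof.
have cell x : exists y : 'I_N, (row y == row (g x)) && (col y == col x).
  by have [y [ry cy]] := transverse_cell x; exists y; rewrite ry cy !eqxx.
pose q x := xchoose (cell x).
have qP x : row (q x) = row (g x) /\ col (q x) = col x.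
  by have /andP[/eqP ? /eqP ?] := xchooseP (cell x).
have q_inj : injective q.
  move=> x y e; have [rx cx] := qP x; have [ry cy] := qP y.
  apply: (transverseP _ _ _ tg); first by rewrite -cx -cy e.
  by rewrite -rx -ry e.
exists (perm q_inj), ((perm q_inj)^-1 * g)%g; rewrite mulKVg; split=> //.
  by rewrite inE; apply/forallP => x; rewrite permE; have [_ ->] := qP x.
rewrite inE; apply/forallP => x; rewrite permM -{2}[x](permKV (perm q_inj)).
by rewrite [perm q_inj _]permE; have [-> _] := qP ((perm q_inj)^-1 x)%g.
Qed.

End TransverseEq.

End Young.

(** * Young symmetrizers and Specht modules *)

Section TwistedTrace.

Variables (K : fieldType) (gT : finGroupType).
Implicit Types (phi psi : gT -> K).

(* The coefficient of z in the product phi x psi. *)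
Definition sandwich phi psi (x z : gT) : K := \sum_g phi g * psi ((g * x)^-1 * z)%g.

(* The trace of x |-> phi x psi on the group algebra. *)
Definition pairing phi psi : K := \sum_x sandwich phi psi x x.

Lemma pairingE phi psi : pairing phi psi = \sum_x \sum_g phi g * psi (x^-1 * g^-1 * x)%g.
Proof. by apply: eq_bigr => x _; apply: eq_bigr => g _; rewrite invMg. Qed.

Lemma pairingC phi psi : pairing phi psi = pairing psi phi.
Proof.
rewrite !pairingE [RHS](reindex_inj invg_inj) /=; apply: eq_bigr => x _.
rewrite [RHS](reindex_inj (conjg_inj x)) [RHS](reindex_inj invg_inj) /=.
apply: eq_bigr => g _; rewrite mulrC conjgE !invMg !invgK !mulgA; congr (_ * phi _).
by rewrite mulgV mul1g mulgK.
Qed.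

(** The coefficient at 1 is a trace form: phi x psi and psi phi x have the same one. *)
Lemma sandwich1 phi psi x : sandwich phi psi x 1%g = conv psi phi x^-1%g.
Proof.
rewrite /sandwich (reindex_inj (mulIg x^-1%g)) (reindex_inj invg_inj) /=.
by apply: eq_bigr => g _; rewrite mulgKV invgK mulg1 mulrC.
Qed.

End TwistedTrace.

Section Symmetrizers.

Variables (K : fieldType) (charK : [pchar K] =i pred0) (N : nat).
Implicit Types (lam mu : seq nat) (g q p : 'S_N) (phi psi : 'S_N -> K).

Lemma row_stabilizerP lam p :
  reflect (forall x, reshape_index lam (p x) = reshape_index lam x) (p \in row_stabilizer N lam).
Proof. by rewrite inE; apply: (iffP forallP) => h x; apply/eqP. Qed.

Lemma col_stabilizerP lam p :
  reflect (forall x, reshape_offset lam (p x) = reshape_offset lam x) (p \in col_stabilizer N lam).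
Proof. by rewrite inE; apply: (iffP forallP) => h x; apply/eqP. Qed.

Lemma row_stabilizer_group_set lam : group_set (row_stabilizer N lam).
Proof.
apply/group_setP; split=> [|p q /row_stabilizerP hp /row_stabilizerP hq].
  by apply/row_stabilizerP => x; rewrite perm1.
by apply/row_stabilizerP => x; rewrite permM hq hp.
Qed.
Canonical row_stabilizer_group lam := Group (row_stabilizer_group_set lam).

Lemma col_stabilizer_group_set lam : group_set (col_stabilizer N lam).
Proof.
apply/group_setP; split=> [|p q /col_stabilizerP hp /col_stabilizerP hq].
  by apply/col_stabilizerP => x; rewrite perm1.
by apply/col_stabilizerP => x; rewrite permM hq hp.
Qed.
Canonical col_stabilizer_group lam := Group (col_stabilizer_group_set lam).

Definition col_antisym lam phi :=
  forall q g, q \in col_stabilizer N lam -> phi (q * g)%g = (-1) ^+ q * phi g.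

Definition row_sym mu phi := forall p g, p \in row_stabilizer N mu -> phi (g * p)%g = phi g.

(** If x, y violate transversality, their transposition before g equals its conjugate after g; hence
    phi g = - phi g, and 2 is invertible. *)
Lemma antisym_sym_transverse lam mu phi g :
  col_antisym lam phi -> row_sym mu phi -> phi g != 0 -> transverse lam mu g.
Proof.
move=> phiq phip; apply: contraR => /forallPn[x /forallPn[y]].
rewrite 2!negb_imply negbK => /and3P[xy /eqP cxy /eqP rxy].
pose t := tperm x y.
have tC : t \in col_stabilizer N lam.
  by apply/col_stabilizerP => z; rewrite /t; case: tpermP => // ->.
have tR : (t ^ g)%g \in row_stabilizer N mu.
  by apply/row_stabilizerP => z; rewrite tpermJ; case: tpermP => // ->.
have := phiq _ g tC; rewrite odd_tperm xy expr1 mulN1r conjgC phip // => e.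
have : phi g *+ 2 == 0 by rewrite mulr2n {1}e addNr.
by rewrite -mulr_natr mulf_eq0 natr_char0_eq0 // orbF.
Qed.

Lemma antisym_sym_dominates lam mu phi g : is_shape N lam -> is_shape N mu ->
  col_antisym lam phi -> row_sym mu phi -> phi g != 0 -> dominates lam mu.
Proof.
move=> sl sm phiq phip /(antisym_sym_transverse phiq phip).
exact: transverse_dominates.
Qed.

Definition ysym lam g : K :=
  \sum_(q in col_stabilizer N lam) \sum_(p in row_stabilizer N lam) (-1) ^+ q *+ (q * p == g)%g.

Lemma ysym_antisym lam : col_antisym lam (ysym lam).
Proof.
move=> q g qC; rewrite /ysym (reindex_inj (mulgI q)) mulr_sumr /=.
apply: eq_big => [q'|q' _]; first by rewrite groupMl.
rewrite mulr_sumr; apply: eq_bigr => p _.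
by rewrite -mulgA (inj_eq (mulgI q)) odd_permM signr_addb mulrnAr.
Qed.

Lemma ysym_sym lam : row_sym lam (ysym lam).
Proof.
move=> p g pR; apply: eq_bigr => q _; rewrite (reindex_inj (mulIg p)) /=.
apply: eq_big => [p'|p' _]; first by rewrite groupMr.
by rewrite mulgA (inj_eq (mulIg p)).
Qed.

Section Shape.

Variable lam : seq nat.
Hypothesis slam : is_shape N lam.

Lemma row_col_stabilizer p : p \in row_stabilizer N lam -> p \in col_stabilizer N lam -> p = 1%g.
Proof.
move=> /row_stabilizerP r /col_stabilizerP c; apply/permP => x; rewrite perm1.
exact: (tableau_inj (r x) (c x)).
Qed.

Lemma ysym1 : ysym lam 1%g = 1.
Proof.
rewrite /ysym (bigD1 1%g) ?group1 //= (bigD1 1%g) ?group1 //= mulg1 eqxx odd_perm1 expr0 mulr1n.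
rewrite big1 ?addr0 => [|p /andP[_ /negPf p1]]; last by rewrite mul1g p1.
rewrite big1 ?addr0 // => q /andP[qC q1]; apply: big1 => p pR.
case: eqP => // /(canRL (mulgK p)); rewrite mul1g => e.
by case/eqP: q1; apply: row_col_stabilizer => //; rewrite e groupV.
Qed.

Lemma ysym_row p : p \in row_stabilizer N lam -> ysym lam p = 1.
Proof. by move=> pR; rewrite -[p]mul1g ysym_sym // ysym1. Qed.

(** Such functions form a line: they live on the transverse g, which factor as q p, and there phi g
    is the sign of q times phi 1. *)
Lemma antisym_sym_ysym phi : col_antisym lam phi -> row_sym lam phi ->
  phi =1 (fun g => phi 1%g * ysym lam g).
Proof.
move=> phiq phip g; have [tg|ntg] := boolP (transverse lam lam g).
  have [q [p [qC pR ->]]] := transverse_factor slam tg.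
  by rewrite phip // ysym_sym // -[q]mulg1 phiq // ysym_antisym // ysym1 mulr1 mulrC.
have h psi : col_antisym lam psi -> row_sym lam psi -> psi g = 0.
  by move=> h1 h2; apply/eqP; apply: contraR ntg; apply: antisym_sym_transverse.
by rewrite h // [ysym _ _]h ?mulr0 //; [apply: ysym_antisym | apply: ysym_sym].
Qed.

Lemma conv_antisym psi phi : col_antisym lam phi -> col_antisym lam (conv phi psi).
Proof.
move=> phiq q g qC; rewrite /conv (reindex_inj (mulgI q)) mulr_sumr /=.
by apply: eq_bigr => h _; rewrite phiq // invMg mulrA -mulgA mulKg.
Qed.

Lemma conv_sym psi phi : row_sym lam psi -> row_sym lam (conv phi psi).
Proof. by move=> psip p g pR; apply: eq_bigr => h _; rewrite mulgA psip. Qed.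

Lemma sandwich_antisym psi phi x : col_antisym lam phi -> col_antisym lam (sandwich phi psi x).
Proof.
move=> phiq q g qC; rewrite /sandwich (reindex_inj (mulgI q)) mulr_sumr /=.
by apply: eq_bigr => h _; rewrite phiq // -mulgA invMg mulrA -mulgA mulKg.
Qed.

Lemma sandwich_sym psi phi x : row_sym lam psi -> row_sym lam (sandwich phi psi x).
Proof. by move=> psip p g pR; apply: eq_bigr => h _; rewrite mulgA psip. Qed.

(** The scalar in y y = kappa y, read at 1 where y takes the value 1; classically N! divided by the
    dimension of the Specht module. *)
Definition kappa := conv (ysym lam) (ysym lam) 1%g.

Lemma conv_ysym : conv (ysym lam) (ysym lam) =1 (fun g => kappa * ysym lam g).
Proof.
by apply: antisym_sym_ysym; [apply/conv_antisym/ysym_antisym | apply/conv_sym/ysym_sym].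
Qed.

End Shape.

Lemma pairing_dominates lam mu phi psi : is_shape N lam -> is_shape N mu ->
  col_antisym lam phi -> row_sym mu psi -> pairing phi psi != 0 -> dominates lam mu.
Proof.
move=> sl sm phiq psip; case: (pickP (fun x => sandwich phi psi x x != 0)) => [x|h].
  by move/antisym_sym_dominates => h _; apply: h => //; [apply: sandwich_antisym | apply: sandwich_sym].
by rewrite /pairing big1 ?eqxx // => x _; have /negbFE/eqP := h x.
Qed.

(** By [antisym_sym_ysym], y x y is a multiple of y, with factor its coefficient at 1, namely kappa
    y(x^-1); and the sum of y(x) y(x^-1) is kappa again. *)
Lemma pairing_ysym lam : is_shape N lam -> pairing (ysym lam) (ysym lam) = kappa lam ^+ 2.
Proof.
move=> sl; rewrite /pairing.
have e x : sandwich (ysym lam) (ysym lam) x x = kappa lam * (ysym lam x * ysym lam (x^-1 * 1)%g).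
  rewrite (antisym_sym_ysym sl (sandwich_antisym _ _ (@ysym_antisym lam)) (sandwich_sym _ _ (@ysym_sym lam))).
  by rewrite sandwich1 conv_ysym // mulg1 -mulrA [in RHS](mulrC (ysym lam x)).
by under eq_bigr do rewrite e; rewrite -mulr_sumr.
Qed.

Definition rsym lam g : K := (g \in row_stabilizer N lam)%:R.

Lemma rsym_sym lam : row_sym lam (rsym lam).
Proof. by move=> p g pR; rewrite /rsym groupMr. Qed.

(** The product of y, x and the row symmetrizer is again a multiple of y; after summation over x,
    each u in the row stabilizer contributes (y y)(u^-1) = kappa. *)
Lemma pairing_ysym_rsym lam : is_shape N lam ->
  pairing (ysym lam) (rsym lam) = kappa lam * #|row_stabilizer N lam|%:R.
Proof.
move=> sl; rewrite /pairing.
have e x : sandwich (ysym lam) (rsym lam) x x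
    = \sum_(u in row_stabilizer N lam) ysym lam (u^-1 * x^-1)%g * ysym lam x.
  rewrite (antisym_sym_ysym sl (sandwich_antisym _ _ (@ysym_antisym lam)) (sandwich_sym _ _ (@rsym_sym lam))).
  rewrite sandwich1 /conv mulr_suml [RHS]big_mkcond; apply: eq_bigr => u _ /=.
  by rewrite /rsym; case: ifP => _; rewrite ?mul1r ?mul0r.
under eq_bigr do rewrite e; rewrite exchange_big /= mulr_natr -sumr_const.
apply: eq_bigr => u uR.
transitivity (conv (ysym lam) (ysym lam) u^-1%g); last first.
  by rewrite conv_ysym // ysym_row ?mulr1 // groupV.
rewrite /conv [RHS](reindex_inj (mulgI u^-1%g)) [RHS](reindex_inj invg_inj) /=.
by apply: eq_bigr => x _; rewrite invMg !invgK mulgK.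
Qed.

Definition char_specht lam g : K := \tr (specht K N lam g).

Section SpechtCharacter.

Variable lam : seq nat.
Hypothesis slam : is_shape N lam.

Let G := [set: 'S_N].
Let aG := regular_repr K G.

(** Left multiplication by y on the group algebra: row i is y times the i-th group element. It
    commutes with the right regular action, and its image is the Specht module. *)
Let L : 'M[K]_#|G| := \matrix_(i, j) ysym lam (enum_val j * (enum_val i)^-1)%g.

Let ysymE g : (young_symmetrizer K N lam) 0 (gring_index G g) = ysym lam g.
Proof.
rewrite /young_symmetrizer summxE; apply: eq_bigr => q _; rewrite summxE.
apply: eq_bigr => p _; rewrite !mxE eqxx /=.
by rewrite (can_in_eq (gring_indexK (G := G))) ?inE // eq_sym mulr_natr.
Qed.

Let mul_regular m (A : 'M[K]_(m, #|G|)) g i j :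
  (A *m aG g) i j = A i (gring_index G (enum_val j * g^-1)%g).
Proof.
rewrite mxE (bigD1 (gring_index G (enum_val j * g^-1)%g)) //= big1 ?addr0 => [|k kj].
  by rewrite !mxE gring_indexK ?inE // mulgKV gring_valK !eqxx mulr1.
rewrite !mxE eqxx /=; case: eqP => [e|_]; last by rewrite mulr0.
by case/eqP: kj; rewrite e gring_indexK ?inE // mulgK gring_valK.
Qed.

Let LE : L = enveloping_algebra_mx aG *m lin_mul_row (young_symmetrizer K N lam).
Proof.
apply/row_matrixP => i; rewrite row_mul rowK mul_vec_lin_row.
by apply/rowP => j; rewrite mul_regular ysymE !mxE.
Qed.

Let L_regular g i : (L *m aG g) i i = ysym lam (enum_val i * g^-1 * (enum_val i)^-1)%g.
Proof. by rewrite mul_regular !mxE gring_indexK ?inE. Qed.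

Let L_idem : L *m L = kappa lam *: L.
Proof.
apply/matrixP => i j; rewrite !mxE -conv_ysym //.
under eq_bigr do rewrite !mxE.
rewrite -(big_enum_val (fun w => ysym lam (w * (enum_val i)^-1)%g * ysym lam (enum_val j * w^-1)%g)).
rewrite (eq_bigl xpredT) => [|w]; last by rewrite !inE.
rewrite (reindex_inj (mulIg (enum_val j))) (reindex_inj invg_inj) /=.
by apply: eq_bigr => h _; rewrite invMg invgK mulVKg mulrC !mulgA.
Qed.

(** The diagonal of L consists of values y(1) = 1, so its trace is N!; but that trace is also kappa
    times a rank. *)
Lemma kappa_neq0 : kappa lam != 0.
Proof.
have : \tr L = #|G|%:R.
  rewrite /mxtrace -[RHS]mulr1n -[in RHS](card_ord #|G|) -sumr_const.
  by apply: eq_bigr => i _; rewrite !mxE mulgV ysym1.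
rewrite (mxtrace_quasi_idem L_idem) => e; apply/eqP => k0; move: e.
rewrite k0 mul0r => /esym/eqP; rewrite natr_char0_eq0 // => /eqP G0.
by have := cardG_gt0 G; rewrite G0.
Qed.

(** L is kappa times a projector onto the Specht module, so a trace on that module becomes a trace
    on the whole group algebra. *)
Lemma char_spechtE psi :
  kappa lam * (\sum_g psi g * char_specht lam g) = pairing psi (ysym lam).
Proof.
rewrite pairingE mulr_sumr.
rewrite [RHS](reindex_inj invg_inj) exchange_big /=; apply: eq_bigr => g _.
rewrite mulrCA -mulr_sumr; congr (_ * _).
have LU : (L :=: cyclic_mx aG (young_symmetrizer K N lam))%MS.
  by apply: eqmx_sym; rewrite LE; apply: genmxE.
rewrite /char_specht /= (mxtrace_submod_idem _ _ kappa_neq0 L_idem LU).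
transitivity (\sum_i ysym lam (enum_val (i : 'I_#|G|) * g^-1 * (enum_val i)^-1)%g).
  by apply: eq_bigr => i _; apply: L_regular.
rewrite -(big_enum_val (fun w => ysym lam (w * g^-1 * w^-1)%g)).
by apply: eq_big => [w|w _]; rewrite ?inE ?invgK.
Qed.

End SpechtCharacter.

End Symmetrizers.

(** * Partitions and Kostka numbers *)

Section Partitions.

Lemma partition_nth_inj lam mu : is_partition lam -> is_partition mu ->
  nth 0%N lam =1 nth 0%N mu -> lam = mu.
Proof.
suff H l m : (0%N \notin l) -> (0%N \notin m) -> nth 0%N l =1 nth 0%N m -> l = m.
  by move=> /andP[_ l0] /andP[_ m0]; apply: H.
elim: l m => [|a l IHl] [|b m] //=.
- by rewrite inE => _ /norP[b0 _] /(_ 0%N) /= e; rewrite -e eqxx in b0.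
- by rewrite inE => /norP[a0 _] _ /(_ 0%N) /= e; rewrite e eqxx in a0.
rewrite !inE => /norP[_ l0] /norP[_ m0] e; congr (_ :: _); first exact: (e 0%N).
by apply: IHl => // i; apply: (e i.+1).
Qed.

Definition partitions_upto M : seq (seq nat) :=
  undup [seq s <- flatten [seq [seq map val (tval t) | t : k.-tuple 'I_M.+1] | k <- iota 0 M.+1]
        | is_partition s && (sumn s <= M)%N].

Lemma size_partition lam : 0%N \notin lam -> (size lam <= sumn lam)%N.
Proof.
elim: lam => //= a l IHl; rewrite inE => /norP[a0 /IHl h].
by move: a0; rewrite eq_sym -lt0n; lia.
Qed.

Lemma mem_leq_sumn a lam : a \in lam -> (a <= sumn lam)%N.
Proof.
elim: lam => //= b l IHl; rewrite inE => /orP[/eqP->|/IHl h]; first exact: leq_addr.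
exact: leq_trans h (leq_addl _ _).
Qed.

Lemma mem_partitions_upto M lam :
  (lam \in partitions_upto M) = is_partition lam && (sumn lam <= M)%N.
Proof.
rewrite mem_undup mem_filter; case: (boolP (is_partition lam && (sumn lam <= M)%N)) => // /andP[/andP[_ l0] lM].
rewrite andTb; apply/flatten_mapP; exists (size lam).
  by rewrite mem_iota /= add0n ltnS (leq_trans (size_partition l0)).
apply/mapP; exists (map_tuple (fun a => inord a : 'I_M.+1) (in_tuple lam)); first by rewrite mem_enum.
rewrite /= -map_comp; apply/esym/map_id_in => a al /=.
by rewrite inordK // ltnS (leq_trans (mem_leq_sumn al)).
Qed.

(* The flag tells whether lam stands for itself or for lam[N]. *)
Definition index_shape (b : bool) N lam := if b then padded lam N else lam.

Definition valid_index (b : bool) N lam :=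
  is_partition lam && (if b then padded_defined lam N else sumn lam == N).

Definition indices b N := [seq lam <- partitions_upto N | valid_index b N lam].

Lemma uniq_indices b N : uniq (indices b N).
Proof. by rewrite filter_uniq ?undup_uniq. Qed.

Lemma mem_indices b N lam : (lam \in indices b N) = valid_index b N lam.
Proof.
rewrite mem_filter mem_partitions_upto andb_idr // /valid_index => /andP[-> /=].
by case: b => [|/eqP->] //; apply: leq_trans (leq_addr _ _).
Qed.

Lemma index_shape_is_shape b N lam : valid_index b N lam -> is_shape N (index_shape b N lam).
Proof.
case/andP=> /andP[sl _]; case: b => [|/eqP e]; last by rewrite /is_shape sl e eqxx.
rewrite /padded_defined => h; rewrite /is_shape /index_shape /padded /= subnK; last first.
  exact: leq_trans (leq_addr _ _) h.
rewrite eqxx andbT; case: lam sl h => //= a l -> h.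
by rewrite andbT /geq /=; lia.
Qed.

Lemma index_shape_inj b N lam mu : valid_index b N lam -> valid_index b N mu ->
  nth 0%N (index_shape b N lam) =1 nth 0%N (index_shape b N mu) -> lam = mu.
Proof.
case/andP=> pl _ /andP[pm _] e; apply: partition_nth_inj => // i.
by case: b e => e; [apply: (e i.+1) | apply: e].
Qed.

(** With the flag on, the longest cycle is dropped just as the long row is dropped from lam[N]:
    classes and shapes then share the list [indices], as [class_expansion] requires. *)
Definition cycle_index b N (g : 'S_N) :=
  if b then behead (cycle_type g) else cycle_type g.

Lemma cycle_index_valid b N (g : 'S_N) : valid_index b N (cycle_index b g).
Proof.
have := cycle_type_partition g; have := sumn_cycle_type g; rewrite card_ord.
rewrite /valid_index /cycle_index; case: b => [|-> ->]; last by rewrite eqxx.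
case: (cycle_type g) => [<- _|a [|b l]] //=.
rewrite /is_partition /padded_defined /= inE negb_or => e /andP[/andP[ab ->]] /andP[_ ->] /=.
by move: ab; rewrite /geq /=; lia.
Qed.

Lemma cycle_index_type b N (g h : 'S_N) :
  cycle_index b g = cycle_index b h -> cycle_type g = cycle_type h.
Proof.
case: b => //; rewrite /cycle_index => e.
have := sumn_cycle_type g; have := sumn_cycle_type h.
have := cycle_type_partition g; have := cycle_type_partition h.
case: (cycle_type g) (cycle_type h) e => [|a l] [|a' l'] //= e; rewrite -?e ?e.
- by case: l' e => // _; case: a' => [|a'] // _ _ /= <-; rewrite addn0.
- by case: a {e} => [|a] // _ _ /= <-; rewrite addn0.
by move=> _ _ <- /addIn ->.
Qed.

End Partitions.

(** * Specht characters and Kostka numbers *)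

Section Kostka.

Variables (K : fieldType) (charK : [pchar K] =i pred0).

Lemma char_specht_conj N lam (g h : 'S_N) :
  cycle_type g = cycle_type h -> char_specht K lam g = char_specht K lam h.
Proof.
by case/cycle_type_conj => x ->; rewrite /char_specht mxtrace_conj.
Qed.

Section Fixed.

Variables (b : bool) (N : nat).
Local Notation sh := (index_shape b N).
Local Notation valid := (valid_index b N).

Lemma dominates_index_anti lam mu : valid lam -> valid mu ->
  dominates (sh lam) (sh mu) -> dominates (sh mu) (sh lam) -> lam = mu.
Proof. by move=> vl vm lm ml; apply: (index_shape_inj vl vm); apply: dominates_anti. Qed.

(** The pairing is symmetric, so if it is nonzero each of the two shapes dominates the other. *)
Lemma char_specht_ysym lam mu : valid lam -> valid mu ->
  \sum_(g : 'S_N) ysym K (sh mu) g * char_specht K (sh lam) g = kappa K N (sh lam) *+ (lam == mu).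
Proof.
move=> vl vm; have sl := index_shape_is_shape vl; have sm := index_shape_is_shape vm.
apply: (mulfI (kappa_neq0 charK sl)); rewrite char_spechtE //.
have [<-|ne] := eqVneq; first by rewrite pairing_ysym.
rewrite mulr0; apply/eqP; apply: contraR ne => ne; apply/eqP.
apply: dominates_index_anti => //.
  apply: (pairing_dominates charK sl sm _ _ _) => //; first exact: ysym_antisym.
    exact: ysym_sym.
  by rewrite pairingC; exact: ne.
apply: (pairing_dominates charK sm sl _ _ ne); first exact: ysym_antisym.
exact: ysym_sym.
Qed.

(** The dimension, seen in K, of the invariants of the row stabilizer of mu in the Specht module of
    lam: the Kostka number. *)
Definition kostka lam mu : K :=
  #|row_stabilizer N (sh mu)|%:R^-1 * \sum_(g : 'S_N) rsym K (sh mu) g * char_specht K (sh lam) g.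

Lemma row_stabilizer_neq0 mu : #|row_stabilizer N mu|%:R != 0 :> K.
Proof. by rewrite natr_char0_eq0 // -lt0n cardG_gt0. Qed.

Lemma pairing_ysym_kostka lam mu : valid lam ->
  pairing (ysym K (sh lam)) (rsym K (N := N) (sh mu))
    = kappa K N (sh lam) * #|row_stabilizer N (sh mu)|%:R * kostka lam mu.
Proof.
move=> vl; rewrite pairingC -char_spechtE //; last exact: index_shape_is_shape.
by rewrite /kostka -[RHS]mulrA mulVKf ?row_stabilizer_neq0.
Qed.

Lemma kostka_diag lam : valid lam -> kostka lam lam = 1.
Proof.
move=> vl; have sl := index_shape_is_shape vl; have := pairing_ysym_kostka lam vl.
rewrite pairing_ysym_rsym // -[LHS]mulr1 => /mulfI <- //.
by rewrite mulf_neq0 ?(kappa_neq0 charK) ?row_stabilizer_neq0.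
Qed.

Lemma kostka_dominates lam mu : valid lam -> valid mu -> kostka lam mu != 0 ->
  dominates (sh lam) (sh mu).
Proof.
move=> vl vm ne; have sl := index_shape_is_shape vl; have sm := index_shape_is_shape vm.
apply: (pairing_dominates charK sl sm (@ysym_antisym K N _) (@rsym_sym K N _)).
rewrite pairing_ysym_kostka // mulf_neq0 // mulf_neq0 //; first exact: kappa_neq0.
exact: row_stabilizer_neq0.
Qed.

(** Here psi is #|R| times the permutation character on the cosets of the row stabilizer R of nu.
    Expand it in Specht characters, then sum it against the row symmetrizer of mu. *)
Lemma sum_kostka mu nu : 
  \sum_(lam <- indices b N) kostka lam mu * kostka lam nu
    = pairing (rsym K (N := N) (sh mu)) (rsym K (sh nu))
       / (#|row_stabilizer N (sh mu)|%:R * #|row_stabilizer N (sh nu)|%:R).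
Proof.
pose psi (h : 'S_N) : K := \sum_x rsym K (sh nu) (x^-1 * h^-1 * x)%g.
have psiE (phi : 'S_N -> K) : \sum_g phi g * psi g = pairing phi (rsym K (sh nu)).
  rewrite pairingE exchange_big; apply: eq_bigr => g _.
  by rewrite mulr_sumr.
have psi_class g h : cycle_index b g = cycle_index b h -> psi g = psi h.
  move=> /cycle_index_type /cycle_type_conj[y ->].
  rewrite /psi (reindex_inj (mulgI y)) /=; apply: eq_bigr => x _.
  by rewrite conjgE !invMg !invgK !mulgA.
have exp h : psi h = \sum_(l <- indices b N)
    #|row_stabilizer N (sh nu)|%:R * kostka l nu * char_specht K (sh l) h.
  rewrite (@class_expansion K _ _ (indices b N) (fun l => ysym K (sh l))
    (fun l => char_specht K (sh l)) (fun l => kappa K N (sh l)) (@cycle_index b N)) //.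
  - rewrite [LHS]big_seq [RHS]big_seq; apply: eq_bigr => l; rewrite mem_indices => vl.
    rewrite psiE pairing_ysym_kostka // !mulrA mulVf ?mul1r //.
    exact/kappa_neq0/index_shape_is_shape.
  - exact: uniq_indices.
  - by move=> g; rewrite mem_indices cycle_index_valid.
  - by move=> l; rewrite mem_indices => vl; apply/kappa_neq0/index_shape_is_shape.
  - by move=> l m; rewrite !mem_indices; apply: char_specht_ysym.
  - by move=> l _ g g' /cycle_index_type; apply: char_specht_conj.
rewrite -psiE; under [in RHS]eq_bigr do rewrite exp mulr_sumr.
rewrite exchange_big mulr_suml; apply: eq_bigr => l _ /=.
have -> : \sum_(g : 'S_N) rsym K (sh mu) g *
    (#|row_stabilizer N (sh nu)|%:R * kostka l nu * char_specht K (sh l) g)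
  = #|row_stabilizer N (sh nu)|%:R * kostka l nu * (#|row_stabilizer N (sh mu)|%:R * kostka l mu).
  have -> : #|row_stabilizer N (sh mu)|%:R * kostka l mu
      = \sum_(g : 'S_N) rsym K (sh mu) g * char_specht K (sh l) g.
    by rewrite /kostka mulVKf ?row_stabilizer_neq0.
  rewrite mulr_sumr.
  by apply: eq_bigr => g _; rewrite mulrCA.
by field; rewrite !row_stabilizer_neq0.
Qed.

End Fixed.

End Kostka.

(** * Stability of the Kostka numbers *)

Lemma leq_card_imset_factor (T : finType) (A B : finType) (f : T -> A) (g : T -> B) :
  (forall x y, g x = g y -> f x = f y) -> (#|f @: T| <= #|g @: T|)%N.
Proof.
move=> gf; pose k v := omap f [pick x | g x == v].
have someI : injective (@Some A) by move=> a b [].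
rewrite -(card_imset _ someI) -imset_comp.
have -> : [set (Some \o f) x | x in T] = k @: [set g x | x in T].
  rewrite -imset_comp; apply: eq_imset => x; rewrite /k /=.
  by case: pickP => [y /eqP /gf /= ->|/(_ x)] //; rewrite eqxx.
exact: leq_imset_card.
Qed.

Section DoubleCosets.

Variables (gT : finGroupType).

Definition double_act (x : gT) (u : gT * gT) := (u.1^-1 * x * u.2)%g.

Lemma double_act1 x : double_act x 1%g = x.
Proof. by rewrite /double_act invg1 mul1g mulg1. Qed.

Lemma double_actM x : act_morph double_act x.
Proof. by move=> u v; rewrite /double_act /= invMg !mulgA. Qed.

Canonical double_action := TotalAction double_act1 double_actM.

Definition double_coset (P Q : {group gT}) x := orbit double_action (setX P Q) x.

Lemma double_cosetP (P Q : {group gT}) x y :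
  (double_coset P Q x = double_coset P Q y) <->
  exists p q, [/\ p \in P, q \in Q & y = (p * x * q)%g].
Proof.
rewrite /double_coset; split=> [e | [p [q [pP qQ ->]]]].
  have /orbitP[[p q]] : y \in orbit double_action (setX P Q) x by rewrite e orbit_refl.
  by rewrite inE => /andP[pP qQ] <-; exists p^-1%g, q; rewrite groupV.
apply/esym/eqP; rewrite orbit_eq_mem; apply/orbitP; exists (p^-1, q)%g.
  by rewrite inE /= groupV pP.
by rewrite /= /double_act /= invgK.
Qed.

(** Orbit counting for P x Q acting on the group: both sides count the triples (p, q, x) with p^-1 x
    q = x. *)
Lemma sum_double_coset (K : fieldType) (P Q : {group gT}) :
  \sum_x \sum_g (g \in P)%:R * (x^-1 * g^-1 * x \in Q)%g%:R
    = (#|double_coset P Q @: [set: gT]| * (#|P| * #|Q|))%:R :> K.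
Proof.
rewrite -cardsX -[X in (X * _)%N]/(#|orbit double_action (setX P Q) @: [set: gT]|).
rewrite -Frobenius_Cauchy; last by apply/actsP => u _ x; rewrite !inE.
rewrite natr_sum.
transitivity (\sum_(u in setX P Q) \sum_x (double_act x u == x)%:R : K); last first.
  apply: eq_bigr => u _; rewrite -sum1_card natr_sum big_mkcond [RHS]big_mkcond /=.
  apply: eq_bigr => x _; rewrite !inE.
  by rewrite sub1set inE /=; case: eqP.
rewrite [RHS]exchange_big; apply: eq_bigr => x _ /=.
rewrite [RHS](eq_bigl (fun u => (u.1 \in P) && (u.2 \in Q))) => [|u]; last by rewrite inE.
rewrite -(pair_big_dep (mem P) (fun _ => mem Q) (fun p q => (double_act x (p, q) == x)%:R)) /=.
rewrite [RHS]big_mkcond (reindex_inj invg_inj) /=; apply: eq_bigr => p _.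
rewrite groupV invgK; case: ifP => _; last by rewrite mul0r.
rewrite mul1r (eq_bigr (fun q => (q == x^-1 * p * x)%g%:R)) => [|q _].
  rewrite [RHS]big_mkcond (bigD1 (x^-1 * p * x)%g) //= eqxx big1 ?addr0 => [|q /negPf->].
    by case: ifP.
  by rewrite if_same.
by rewrite /double_act /= -(inj_eq (mulgI (p^-1 * x)^-1%g)) mulKg invMg invgK.
Qed.

End DoubleCosets.

Section StableCosets.

Variables (N : nat) (mu nu : seq nat).
Hypotheses (mN : (sumn mu <= N)%N) (nN : (sumn nu <= N)%N) (mnN : (sumn mu + sumn nu <= N)%N).
Hypotheses (smu : is_shape N.+1 (padded mu N.+1)) (snu : is_shape N.+1 (padded nu N.+1)).

Local Notation up := (lift_perm ord0 ord0).

(** The added cell is 0, at the start of the first row; the other cells keep their rows, but those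
    of the first row change columns. *)
Lemma padded_row_lift l (x : 'I_N) : (sumn l <= N)%N ->
  reshape_index (padded l N.+1) (lift ord0 x) = reshape_index (padded l N) x.
Proof.
move=> lN; rewrite /reshape_index /padded /= /bump leq0n add1n.
by rewrite (subSn lN) subSS.
Qed.

Lemma padded_row0 l : (sumn l <= N)%N -> reshape_index (padded l N.+1) (ord0 : 'I_N.+1) = 0%N.
Proof. by move=> lN; rewrite /reshape_index /padded /= (subSn lN) subSS sub0n. Qed.

Lemma lift_perm_row l p : (sumn l <= N)%N ->
  (up p \in row_stabilizer N.+1 (padded l N.+1)) = (p \in row_stabilizer N (padded l N)).
Proof.
move=> lN; apply/row_stabilizerP/row_stabilizerP => h x.
  by have := h (lift ord0 x); rewrite lift_perm_lift !padded_row_lift.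
have [j|] := unliftP ord0 x; last by move=> ->; rewrite lift_perm_id.
by move=> ->; rewrite lift_perm_lift !padded_row_lift.
Qed.

Lemma lift_perm_exists (p : 'S_N.+1) : p ord0 = ord0 -> exists q, p = up q.
Proof.
move=> p0; pose f x := odflt x (unlift ord0 (p (lift ord0 x))).
have fE x : lift ord0 (f x) = p (lift ord0 x).
  rewrite /f; case: unliftP => [j //|e] /=; have := neq_lift ord0 x.
  by rewrite -(inj_eq (@perm_inj _ p)) p0 e eqxx.
have f_inj : injective f.
  by move=> x y e; apply: (@lift_inj _ ord0); apply: (@perm_inj _ p); rewrite -!fE e.
exists (perm f_inj); apply/permP => x; have [j ->|->] := unliftP ord0 x.
  by rewrite lift_perm_lift permE fE.
by rewrite lift_perm_id.
Qed.

Lemma lift_perm_inj : injective (up : 'S_N -> 'S_N.+1).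
Proof.
move=> p q e; apply/permP => x; apply: (@lift_inj _ ord0).
by rewrite -(lift_perm_lift ord0) -[RHS](lift_perm_lift ord0) e.
Qed.

Local Notation Rm n := (row_stabilizer_group n (padded mu n)).
Local Notation Rn n := (row_stabilizer_group n (padded nu n)).

Lemma tperm_row n l (x y : 'I_n) : reshape_index l x = reshape_index l y ->
  tperm x y \in row_stabilizer n l.
Proof. by move=> xy; apply/row_stabilizerP => z; case: tpermP => // ->. Qed.

(** Given a relation in the larger group, p and q are corrected by transpositions inside first rows
    so as to fix the added cell 0: q w = 0 because [up y] fixes 0, and the two corrections cancel
    across [up x]. *)
Lemma double_coset_lift (x y : 'S_N) :
  double_coset (Rm N.+1) (Rn N.+1) (up x) = double_coset (Rm N.+1) (Rn N.+1) (up y)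
  <-> double_coset (Rm N) (Rn N) x = double_coset (Rm N) (Rn N) y.
Proof.
split=> /double_cosetP [p [q [pR qR e]]]; apply/double_cosetP; last first.
  by exists (up p), (up q); rewrite !lift_perm_row // e !lift_permM.
pose w := up x (p ord0).
have q0 : q w = ord0.
  by have := congr1 (fun s : 'S__ => s ord0) e; rewrite lift_perm_id !permM.
pose p' := (p * tperm ord0 (p ord0))%g; pose q' := (tperm ord0 w * q)%g.
have p'R : p' \in Rm N.+1.
  by rewrite groupM // tperm_row //; apply/esym; apply: (row_stabilizerP _ _ pR).
have q'R : q' \in Rn N.+1.
  by rewrite groupM // tperm_row // -q0; apply: (row_stabilizerP _ _ qR).
have e' : up y = (p' * up x * q')%g.
  rewrite e /p' /q' -!mulgA; congr (_ * _)%g.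
  rewrite [RHS]mulgA [(tperm _ _ * up x)%g]conjgC tpermJ lift_perm_id -/w.
  by rewrite -mulgA; congr (_ * _)%g; rewrite mulgA tperm2 mul1g.
have [p1 p1E] : exists p1, p' = up p1.
  by apply: lift_perm_exists; rewrite permM tpermR.
have [q1 q1E] : exists q1, q' = up q1.
  by apply: lift_perm_exists; rewrite permM tpermL.
exists p1, q1; split.
- by rewrite -lift_perm_row // -p1E.
- by rewrite -lift_perm_row // -q1E.
by apply: lift_perm_inj; rewrite e' p1E q1E !lift_permM.
Qed.

Lemma card_row_gt0 l : (sumn l <= N)%N -> is_shape N.+1 (padded l N.+1) ->
  #|[set x : 'I_N.+1 | (0 < reshape_index (padded l N.+1) x)%N]| = sumn l.
Proof.
move=> lN sl; have := card_rows_lt sl 1; rewrite /= take0 addn0 => e.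
have := cardsC [set x : 'I_N.+1 | (reshape_index (padded l N.+1) x < 1)%N].
rewrite e card_ord => e2.
have -> : [set x : 'I_N.+1 | (0 < reshape_index (padded l N.+1) x)%N]
  = ~: [set x : 'I_N.+1 | (reshape_index (padded l N.+1) x < 1)%N].
  by apply/setP => x; rewrite !inE -leqNgt.
by apply/eqP; rewrite -(eqn_add2l (N.+1 - sumn l)) e2 subnK // leqW.
Qed.

(** Since |mu| + |nu| < N + 1, some z lies in the first row of mu with y z in the first row of nu;
    moving both to 0 yields a permutation fixing 0. *)
Lemma double_coset_lift_surj (y : 'S_N.+1) :
  exists x, double_coset (Rm N.+1) (Rn N.+1) y = double_coset (Rm N.+1) (Rn N.+1) (up x).
Proof.
have [z zm zn] : exists2 z : 'I_N.+1, reshape_index (padded mu N.+1) z = 0%N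
    & reshape_index (padded nu N.+1) (y z) = 0%N.
  pose A := [set x : 'I_N.+1 | (0 < reshape_index (padded mu N.+1) x)%N].
  pose B := y @^-1: [set x : 'I_N.+1 | (0 < reshape_index (padded nu N.+1) x)%N].
  have cB : #|B| = sumn nu.
    by rewrite (card_preimset _ (@perm_inj _ y)) card_row_gt0.
  have : (0 < #|~: (A :|: B)|)%N.
    rewrite cardsCs setCK card_ord subn_gt0 ltnS.
    by rewrite (leq_trans (leq_card_setU A B)) // cB card_row_gt0.
  case/card_gt0P => z; rewrite !inE negb_or -!leqNgt !leqn0 => /andP[/eqP ? /eqP ?].
  by exists z.
pose p := tperm ord0 z; pose q := tperm ord0 (y z).
have [x xE] : exists x, (p * y * q)%g = up x.
  by apply: lift_perm_exists; rewrite !permM tpermL tpermR.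
exists x; apply/double_cosetP; exists p, q.
by rewrite -xE; split => //; apply: tperm_row; rewrite padded_row0.
Qed.

Lemma card_double_coset_lift :
  #|double_coset (Rm N.+1) (Rn N.+1) @: [set: 'S_N.+1]|
    = #|double_coset (Rm N) (Rn N) @: [set: 'S_N]|.
Proof.
have -> : double_coset (Rm N.+1) (Rn N.+1) @: [set: 'S_N.+1]
   = (double_coset (Rm N.+1) (Rn N.+1) \o up) @: [set: 'S_N].
  apply/setP => O; apply/imsetP/imsetP => -[y _ ->].
    by have [x e] := double_coset_lift_surj y; exists x.
  by exists (up y).
apply/eqP; rewrite eqn_leq; apply/andP.
have imE (T : finType) (A : finType) (f : T -> A) : f @: [set: T] = f @: T.
  by apply/setP => a; apply/imsetP/imsetP => -[x _ ->]; exists x.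
rewrite !imE; split; apply: leq_card_imset_factor => x y /=.
  by move=> e; apply/double_coset_lift.
by move/double_coset_lift.
Qed.

End StableCosets.

Section TailWeight.

(** This is \sum_i i lam_i with rows numbered from 1, the usual statistic of lam[N] when its long
    row has number 0. It refines dominance by an integer that does not involve N. *)
Fixpoint tail_weight (lam : seq nat) : nat :=
  if lam is _ :: l then (sumn lam + tail_weight l)%N else 0%N.

Definition tail_dominates lam mu := forall j, (sumn (drop j lam) <= sumn (drop j mu))%N.

(** The weight adds up the tail sums, so it is monotone, and equal weights force equal tail sums,
    hence equal parts. *)
Lemma tail_weight_leq lam mu : is_partition lam -> is_partition mu -> tail_dominates lam mu ->
  (tail_weight lam <= tail_weight mu)%N /\ (tail_weight lam = tail_weight mu -> lam = mu).
Proof.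
suff H l m : (0%N \notin l) -> (0%N \notin m) -> tail_dominates l m ->
    (tail_weight l <= tail_weight m)%N /\ (tail_weight l = tail_weight m -> l = m).
  by move=> /andP[_ l0] /andP[_ m0]; apply: H.
elim: l m => [|a l IHl] [|b m] //=.
- by rewrite inE => _ /norP[b0 _] _; split=> //; move: b0; lia.
- by rewrite inE => /norP[a0 _] _ /(_ 0%N) /=; move: a0; lia.
rewrite !inE => /norP[_ l0] /norP[_ m0] d; have d0 := d 0%N; rewrite /= in d0.
have [|h1 h2] := IHl m l0 m0 _; first by move=> j; apply: (d j.+1).
split=> [|e]; first exact: leq_add.
have lm : l = m by apply: h2; lia.
by congr (_ :: _) => //; move: e; rewrite lm; lia.
Qed.

Lemma dominates_tail b N lam mu : valid_index b N lam -> valid_index b N mu ->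
  dominates (index_shape b N lam) (index_shape b N mu) -> tail_dominates lam mu.
Proof.
case/andP=> _ vl /andP[_ vm] d j.
have s l : (sumn (take j l) + sumn (drop j l) = sumn l)%N by rewrite -sumn_cat cat_take_drop.
have := s lam; have := s mu; case: b vl vm d => [vl vm d|/eqP vl /eqP vm d]; last first.
  by have /= := d j; lia.
have /= := d j.+1; rewrite /padded_defined in vl vm; lia.
Qed.

End TailWeight.

(** * Unitriangular matrices *)

Section Triangular.

Variables (K : fieldType) (T : eqType) (L : seq T) (w : T -> nat).
Hypothesis uniqL : uniq L.

Definition unitriangular (k : T -> T -> K) :=
  {in L, forall l, k l l = 1} /\
  {in L &, forall l m, k l m != 0 -> l != m -> (w l < w m)%N}.

Lemma unitriangular_sum (k : T -> T -> K) (f : T -> K) m : unitriangular k -> m \in L ->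
  {in L, forall l, (w l < w m)%N -> f l = 0} -> \sum_(l <- L) f l * k l m = f m.
Proof.
move=> [k1 kw] mL fw; rewrite (bigD1_seq m) //= k1 // mulr1 big_seq_cond.
rewrite big1 ?addr0 // => l /andP[lL lm].
have [->|k0] := eqVneq (k l m) 0; first by rewrite mulr0.
by rewrite fw ?mul0r // kw.
Qed.

Lemma unitriangular_inj (k : T -> T -> K) (f g : T -> K) : unitriangular k ->
    {in L, forall m, \sum_(l <- L) f l * k l m = \sum_(l <- L) g l * k l m} ->
  {in L, f =1 g}.
Proof.
move=> kU fg; suff H n m : (w m < n)%N -> m \in L -> f m = g m.
  by move=> m; apply: (H (w m).+1).
elim: n m => // n IHn m; rewrite ltnS => mn mL; apply/eqP; rewrite -subr_eq0; apply/eqP.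
rewrite -(unitriangular_sum (f := fun l => f l - g l) kU mL) => [|l lL lm].
  by under eq_bigr do rewrite mulrBl; rewrite sumrB fg // subrr.
by apply/eqP; rewrite subr_eq0; apply/eqP/IHn => //; apply: leq_trans mn.
Qed.

(** Induction on the weight of l. In the Gram entry at (m, l), terms l' of smaller weight agree by
    induction, the term l' = l is k l m, and the others vanish because k l' l = 0. *)
Lemma unitriangular_gram (k k' : T -> T -> K) : unitriangular k -> unitriangular k' ->
    {in L &, forall m n, \sum_(l <- L) k l m * k l n = \sum_(l <- L) k' l m * k' l n} ->
  {in L &, k =2 k'}.
Proof.
move=> kU kU' kk; suff H n l m : (w l < n)%N -> l \in L -> m \in L -> k l m = k' l m.
  by move=> l m; apply: (H (w l).+1).
elim: n l m => // n IHn l m; rewrite ltnS => ln lL mL; apply/eqP; rewrite -subr_eq0; apply/eqP.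
have IH l' m' : l' \in L -> m' \in L -> (w l' < w l)%N -> k l' m' = k' l' m'.
  by move=> l'L m'L l'l; apply: IHn => //; apply: leq_trans ln.
rewrite -(unitriangular_sum (f := fun l => k l m - k' l m) kU lL) => [|l' l'L l'l]; last first.
  by rewrite IH // subrr.
transitivity (\sum_(l' <- L) (k l' m * k l' l - k' l' m * k' l' l)).
  rewrite [LHS]big_seq [RHS]big_seq; apply: eq_bigr => l' l'L.
  have [->|ne] := eqVneq l' l; first by rewrite (proj1 kU) // (proj1 kU') // !mulr1.
  have [l'w|l'w] := ltnP (w l') (w l); first by rewrite !IH // !subrr mul0r.
  have z q : unitriangular q -> q l' l = 0.
    move=> [_ qw]; apply/eqP; apply: contraTT l'w => q0.
    by rewrite -ltnNge qw.
  by rewrite !z // !mulr0 subrr.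
by rewrite sumrB kk // subrr.
Qed.

End Triangular.

Section StableKostka.

Variables (K : fieldType) (charK : [pchar K] =i pred0).

Lemma kostka_unitriangular b N (L : seq (seq nat)) :
  {in L, forall l, valid_index b N l} -> unitriangular L tail_weight (kostka K b N).
Proof.
move=> vL; split=> [l lL|l m lL mL k0 lm]; first exact/kostka_diag/vL.
have [vl vm] := (vL l lL, vL m mL).
have td := dominates_tail vl vm (kostka_dominates charK vl vm k0).
have [h1 h2] := tail_weight_leq (proj1 (andP vl)) (proj1 (andP vm)) td.
rewrite ltn_neqAle h1 andbT; apply: contra lm => /eqP e; apply/eqP; exact: h2.
Qed.

Lemma valid_padded l M N : l \in partitions_upto M -> (2 * M <= N)%N -> valid_index true N l.
Proof.
rewrite mem_partitions_upto => /andP[pl lM] MN; rewrite /valid_index pl /padded_defined /=.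
have : (head 0%N l <= sumn l)%N by case: (l) => //= a t; apply: leq_addr.
lia.
Qed.

(** Restricting the sum to |lam| <= M loses nothing: a nonzero Kostka number at (lam, mu) forces
    |lam| <= |mu|, the case j = 0 of tail dominance. *)
Lemma sum_kostka_upto M N mu nu : (2 * M <= N)%N -> mu \in partitions_upto M -> nu \in partitions_upto M ->
  \sum_(lam <- partitions_upto M) kostka K true N lam mu * kostka K true N lam nu
    = (#|double_coset (row_stabilizer_group N (padded mu N)) (row_stabilizer_group N (padded nu N)) @: [set: 'S_N]|)%:R.
Proof.
move=> MN mM nM; transitivity (\sum_(lam <- indices true N) kostka K true N lam mu * kostka K true N lam nu).
  rewrite (bigID (fun l => l \in partitions_upto M) _ _ (r := indices true N)) /=.
  rewrite [X in _ + X]big_seq_cond [X in _ + X]big1 ?addr0 => [|l].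
    rewrite -[RHS]big_filter; apply: perm_big.
    apply: uniq_perm; [exact: undup_uniq | exact/filter_uniq/uniq_indices | move=> l].
    rewrite mem_filter mem_indices andb_idr // => lM.
    exact: valid_padded lM MN.
  rewrite mem_indices => /andP[vl nl]; apply/eqP; rewrite mulf_eq0; apply/orP; left.
  apply: contraR nl => k0; have vm := valid_padded mM MN.
  have := dominates_tail vl vm (kostka_dominates charK vl vm k0) 0%N.
  rewrite !drop0 mem_partitions_upto => h; rewrite (proj1 (andP vl)) /=.
  by move: mM; rewrite mem_partitions_upto => /andP[_]; apply: leq_trans.
rewrite sum_kostka // pairingE /rsym sum_double_coset !natrM; apply: mulfK.
by apply: mulf_neq0; apply: row_stabilizer_neq0.
Qed.

(** Cells are added one at a time from 2 M on; |p| + |q| <= 2 M is what the stability of double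
    cosets asks for. *)
Lemma kostka_stable M N l m : (2 * M <= N)%N -> l \in partitions_upto M -> m \in partitions_upto M ->
  kostka K true N l m = kostka K true (2 * M) l m.
Proof.
move=> MN lM mM; rewrite -(subnK MN); elim: (N - 2 * M)%N => // i IHi; rewrite addSn -{}IHi.
set n := (i + 2 * M)%N; have Mn : (2 * M <= n)%N by apply: leq_addl.
have vN p : p \in partitions_upto M -> valid_index true n p by move/valid_padded; apply.
have vS p : p \in partitions_upto M -> valid_index true n.+1 p.
  by move/valid_padded; apply; apply: leqW.
have := unitriangular_gram (undup_uniq _) (kostka_unitriangular vS) (kostka_unitriangular vN).
apply => // p q pM qM; rewrite !sum_kostka_upto // ?leqW //; congr (_%:R).
have le x : x \in partitions_upto M -> (sumn x <= M)%N by rewrite mem_partitions_upto => /andP[].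
have := le p pM; have := le q qM => lq lp.
by apply: card_double_coset_lift; try lia; apply: (index_shape_is_shape (vS _ _)).
Qed.

End StableKostka.

(** * Extension of oriented chains along an injection *)

Section Oriented.

Variable K : fieldType.

Section OneMap.

Variables (T T' : finType) (f : T -> T').
Hypothesis f_inj : injective f.
Implicit Types (s t : {set T}) (u v w : T).

(* Agrees with [inversions] when f is the action of a group element. *)
Definition map_inversions (f : T -> T') s :=
  #|[set p in setX s s | before p.1 p.2 && before (f p.2) (f p.1)]|.

Lemma eq_map_inversions (g : T -> T') s : {in s, f =1 g} -> map_inversions f s = map_inversions g s.
Proof.
move=> fg; apply: eq_card => -[u v]; rewrite !inE /=.
by case: (boolP (u \in s)) => // us; case: (boolP (v \in s)) => //= vs; rewrite !fg.
Qed.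

Lemma map_inversionsE s : map_inversions f s =
  (\sum_(u in s) \sum_(w in s) (before u w && before (f w) (f u)))%N.
Proof.
rewrite /map_inversions -sum1_card big_mkcond pair_big [RHS]big_mkcond /=.
apply: eq_bigr => -[u w] _ /=; rewrite !inE /=.
by case: ((u \in s) && (w \in s)) => //=; case: (before u w && before (f w) (f u)).
Qed.

(** Modulo 2, the number b1 + c1 of inverted pairs containing v is the difference between the
    positions of v in s and of f v in the image. *)
Lemma map_inversions_position s v : v \in s ->
  (-1) ^+ map_inversions f s * (-1) ^+ position (f @: s) (f v)
    = (-1) ^+ position s v * (-1) ^+ map_inversions f (s :\ v) :> K.
Proof.
move=> vs; rewrite -!exprD.
pose b1 := (\sum_(u in s) (before u v && before (f v) (f u)))%N.
pose c1 := (\sum_(u in s) (before v u && before (f u) (f v)))%N.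
have -> : position (f @: s) (f v) = (\sum_(u in s) before (f u) (f v))%N.
  by rewrite positionE big_imset //= => x y _ _; apply: f_inj.
have -> : map_inversions f s = (map_inversions f (s :\ v) + (b1 + c1))%N.
  rewrite !map_inversionsE (big_setD1 v) //=.
  under [X in (_ + X)%N]eq_bigr => u _ do rewrite (big_setD1 v) //=.
  rewrite big_split /= [b1](big_setD1 v) //= before_irr add0n /c1.
  by rewrite addnC -addnA addnCA.
have e : (\sum_(u in s) before (f u) (f v) + b1 = position s v + c1)%N.
  rewrite positionE /b1 /c1 -!big_split; apply: eq_bigr => u _ /=.
  case: (eqVneq u v) => [->|uv]; first by rewrite !before_irr.
  rewrite [before v u]beforeN // [before (f v) _]beforeN ?(inj_eq f_inj) //.
  by case: (before u v); case: (before (f u) _).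
rewrite -signr_odd -[RHS]signr_odd; congr (_ ^+ nat_of_bool _).
move: e; set P := (\sum_(u in s) _)%N; set i := map_inversions _ _.
set p := position _ _ => e; have -> : (i + (b1 + c1) + P = p + i + c1.*2)%N by lia.
by rewrite oddD odd_double addbF.
Qed.

Lemma imset_setD1 s v : f @: s :\ f v = f @: (s :\ v).
Proof.
apply/setP => y; apply/setD1P/imsetP => [[yv /imsetP[x xs e]]|[x /setD1P[xv xs] ->]].
  by exists x; rewrite // !inE xs andbT; apply: contra yv => /eqP <-; rewrite e.
by rewrite (inj_eq f_inj) imset_f.
Qed.

Lemma incidence_map s t :
  (-1) ^+ map_inversions f s * incidence K (f @: s) (f @: t)
    = incidence K s t * (-1) ^+ map_inversions f t.
Proof.
rewrite /incidence mulr_sumr mulr_suml big_mkcondr big_imset /=; last by move=> x y _ _; apply: f_inj.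
rewrite -big_mkcondr /=.
have E v : (f @: s :\ f v == f @: t) = (s :\ v == t).
  by rewrite imset_setD1 (inj_eq (imset_inj f_inj)).
apply: eq_big => [v|v]; rewrite E // => /andP[vs /eqP <-].
exact: map_inversions_position.
Qed.

End OneMap.

(** Inversions of g on f(s) are counted along the order of f(s); this regroups them along the order
    of s, where parities can be compared pair by pair. *)
Lemma sum_pairs_before (T : finType) (s : {set T}) (F : T -> T -> nat) :
    (forall u, F u u = 0%N) ->
  (\sum_(u in s) \sum_(w in s) F u w = \sum_(u in s) \sum_(w in s) before u w * (F u w + F w u))%N.
Proof.
move=> F0; under [RHS]eq_bigr do under eq_bigr do rewrite mulnDr.
under [RHS]eq_bigr do rewrite big_split.
rewrite big_split [X in _ = (_ + X)%N]exchange_big -big_split; apply: eq_bigr => u _ /=.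
rewrite -big_split; apply: eq_bigr => w _ /=.
have [->|uw] := eqVneq u w; first by rewrite F0 !muln0.
by rewrite (beforeN uw); case: before => /=; lia.
Qed.

Lemma odd_sum2 (T : finType) (s : {set T}) (F G : T -> T -> nat) :
    {in s &, forall u w, odd (F u w) = odd (G u w)} ->
  odd (\sum_(u in s) \sum_(w in s) F u w) = odd (\sum_(u in s) \sum_(w in s) G u w).
Proof.
move=> FG; pose P m n := odd m = odd n.
have PD : forall a b c d, P a b -> P c d -> P (a + c)%N (b + d)%N.
  by rewrite /P => a b c d ab cd; rewrite !oddD ab cd.
by apply: (big_ind2 P) => // u us; apply: (big_ind2 P) => // w ws; apply: FG.
Qed.

Lemma map_inversions_comp (T T' T'' : finType) (f : T -> T') (g : T' -> T'') (s : {set T}) :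
    injective f -> injective g ->
  (-1) ^+ map_inversions (g \o f) s
    = (-1) ^+ map_inversions f s * (-1) ^+ map_inversions g (f @: s) :> K.
Proof.
move=> f_inj g_inj; rewrite -exprD !map_inversionsE.
rewrite big_imset /=; last by move=> x y _ _; apply: f_inj.
have -> : (\sum_(u in s) \sum_(w in f @: s) (before (f u) w && before (g w) (g (f u)))
  = \sum_(u in s) \sum_(w in s) (before (f u) (f w) && before (g (f w)) (g (f u))))%N.
  by apply: eq_bigr => u _; rewrite big_imset //= => x y _ _; apply: f_inj.
rewrite (sum_pairs_before s (F := fun u w => (before (f u) (f w) && before (g (f w)) (g (f u)) : nat))); last first.
  by move=> u; rewrite before_irr.
rewrite -signr_odd -[RHS]signr_odd; congr (_ ^+ nat_of_bool _).
rewrite -big_split /=; under [X in _ = odd X]eq_bigr do rewrite -big_split /=.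
apply: odd_sum2 => u w us ws; have [->|uw] := eqVneq u w; first by rewrite before_irr.
rewrite [before (f w) _]beforeN ?[before (g _) (g (f u))]beforeN ?(inj_eq g_inj) ?(inj_eq f_inj) //.
by case: (before u w); case: (before (f u) _); case: (before (g _) _).
Qed.

Section Faces.

Variables (T : finType) (F : {set {set T}}) (a : {set T}) (aF : a \in F).

Definition face_index := enum_rank_in aF a.

Lemma face_indexK : enum_val face_index = a.
Proof. exact: enum_rankK_in. Qed.

Lemma eq_face_index (u : 'I_#|F|) : (u == face_index) = (enum_val u == a).
Proof. by rewrite -(inj_eq enum_val_inj) face_indexK. Qed.

Lemma mul_face_mx p q (M : 'M[K]_(p, #|F|)) (N : 'M_(#|F|, q)) i j c :
    (forall u, M i u = c *+ (enum_val u == a)) ->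
  (M *m N) i j = c * N face_index j.
Proof.
move=> Mi; rewrite mxE (bigD1 face_index) //= big1 ?addr0 => [|u].
  by rewrite Mi face_indexK eqxx.
by rewrite eq_face_index Mi => /negPf->; rewrite mul0r.
Qed.

End Faces.

Section Extension.

Hypothesis charK : [pchar K] =i pred0.

Variables (T T' : finType) (f : T -> T').
Hypothesis f_inj : injective f.
Variables (gT gT' : finGroupType) (to : {action gT &-> T}) (to' : {action gT' &-> T'}).
Variables (C : {set {set T}}) (C' : {set {set T'}}).
Hypotheses (cC : is_complex C) (toC : [acts [set: gT], on C | to^*]).
Hypotheses (toC' : [acts [set: gT'], on C' | to'^*]).
Hypothesis fC : forall s, s \in C -> f @: s \in C'.

Implicit Types (s t : {set T}) (h : gT) (g : gT').

Definition extends_on s h g := [forall v in s, f (to v h) == to' (f v) g].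

Lemma extends_onP s h g : reflect {in s, forall v, f (to v h) = to' (f v) g} (extends_on s h g).
Proof. exact: 'forall_in_eqP. Qed.

Lemma extends_on_imset s h g : extends_on s h g -> f @: setact to s h = setact to' (f @: s) g.
Proof.
move/extends_onP => e; rewrite /setact -!imset_comp; apply: eq_in_imset => v vs /=.
exact: e.
Qed.

Lemma extends_on_sign s h g : extends_on s h g ->
  (-1) ^+ inversions to h s * (-1) ^+ map_inversions f (setact to s h)
    = (-1) ^+ map_inversions f s * (-1) ^+ inversions to' g (f @: s) :> K.
Proof.
move/extends_onP => e.
rewrite -(@map_inversions_comp _ _ _ (to^~ h) f s (act_inj to h) f_inj).
rewrite -(@map_inversions_comp _ _ _ f (to'^~ g) s f_inj (act_inj to' g)).
by congr (_ ^+ _); apply: eq_map_inversions.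
Qed.

Lemma faces_imset k s : s \in faces C k -> f @: s \in faces C' k.
Proof. by rewrite !inE card_imset // => /andP[/fC-> ->]. Qed.

Definition extension_mx k : 'M[K]_(#|faces C k|, #|faces C' k|) :=
  \matrix_(i, j) ((-1) ^+ map_inversions f (enum_val i) *+ (enum_val j == f @: enum_val i)).

Lemma mul_extension_mx k q (N : 'M_(#|faces C' k|, q)) i j :
  (extension_mx k *m N) i j = (-1) ^+ map_inversions f (enum_val i)
     * N (face_index (faces_imset (enum_valP i))) j.
Proof. by apply: mul_face_mx => u; rewrite mxE. Qed.

Let act_face k (i : 'I_#|faces C k|) h : setact to (enum_val i) h \in faces C k.
Proof. by rewrite faces_act ?enum_valP. Qed.

Lemma mul_chain_mx (U : finType) (hT : finGroupType) (ta : {action hT &-> U}) (D : {set {set U}})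
    k (h : hT) q (N : 'M[K]_(#|faces D k|, q)) (i : 'I_#|faces D k|) j
    (hi : setact ta (enum_val i) h \in faces D k) :
  (chain_mx K ta D k h *m N) i j = (-1) ^+ inversions ta h (enum_val i) * N (face_index hi) j.
Proof. by apply: mul_face_mx => u; rewrite mxE. Qed.

Lemma boundary_extension k l : boundary K C k l *m extension_mx l = extension_mx k *m boundary K C' k l.
Proof.
apply/matrixP => i j; rewrite mul_extension_mx !mxE face_indexK.
under eq_bigr do rewrite !mxE.
set s := enum_val i; set t' := enum_val j.
have [/existsP[u /eqP e]|] := boolP [exists u : 'I_#|faces C l|, t' == f @: enum_val u].
  rewrite (bigD1 u) //= e eqxx big1 ?addr0 ?mulr1n ?incidence_map // => w wu.
  rewrite (inj_eq (imset_inj f_inj)) (inj_eq enum_val_inj) eq_sym (negPf wu).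
  by rewrite mulr0.
rewrite negb_exists => /forallP nu; rewrite big1 => [|u _]; last by rewrite (negPf (nu u)) mulr0.
rewrite /incidence big_pred0 ?mulr0 // => v'; apply/negP => /andP[/imsetP[v vs ->] /eqP e].
have sC : s \in faces C k by apply: enum_valP.
have tC' : t' \in faces C' l by apply: enum_valP.
have tC : s :\ v \in faces C l.
  move: sC tC'; rewrite -e imset_setD1 // !inE card_imset // => /andP[sC _] /andP[_ ->].
  by rewrite (cC sC) // subsetDl.
have := nu (face_index tC); rewrite face_indexK -e imset_setD1 // eqxx.
by [].
Qed.

Lemma chain_extension k h g : (forall v, f (to v h) = to' (f v) g) ->
  chain_mx K to C k h *m extension_mx k = extension_mx k *m chain_mx K to' C' k g.
Proof.
move=> hg; apply/matrixP => i j; have hi := act_face i h.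
rewrite (mul_chain_mx _ _ hi) mul_extension_mx !mxE !face_indexK.
have e : extends_on (enum_val i) h g by apply/extends_onP => v _.
by rewrite !mulrnAr (extends_on_sign e) (extends_on_imset e).
Qed.

Variables (Y : {group gT}) (Y' : {group gT'}).
Hypothesis extend_up : forall h, h \in Y -> exists2 g, g \in Y' & forall v, f (to v h) = to' (f v) g.
Hypothesis extend_down : forall s t g, s \in C -> t \in C -> g \in Y' ->
  setact to' (f @: s) g = f @: t -> exists2 h, h \in Y & extends_on s h g.
Hypothesis extend_surj : forall s' : {set T'}, s' \in C' ->
  exists2 g, g \in Y' & exists2 s, s \in C & setact to' s' g = f @: s.

(** Up to the factor #|Y|, the projector onto the Y-invariant chains; its rank is their
    dimension. *)
Let A k : 'M[K]_#|faces C k| := \sum_(h in Y) chain_mx K to C k h.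
Let A' k : 'M[K]_#|faces C' k| := \sum_(g in Y') chain_mx K to' C' k g.

Let fixer t := [set h in Y | [forall v in t, to v h == v]].
Let fixer' t := [set g in Y' | [forall v in t, to' (f v) g == f v]].

Let fixer'_neq0 t : #|fixer' t|%:R != 0 :> K.
Proof.
rewrite natr_char0_eq0 // -lt0n; apply/card_gt0P; exists 1%g; rewrite inE group1.
by apply/forall_inP => v _; rewrite act1.
Qed.

(** These h form the coset of h0 by the pointwise stabilizer of the face h0 s. *)
Let card_extended s g h0 : h0 \in Y -> extends_on s h0 g ->
  #|[set h in Y | extends_on s h g]| = #|fixer (setact to s h0)|.
Proof.
move=> h0Y /extends_onP e0; rewrite -(card_imset _ (mulgI h0^-1%g)); apply: eq_card => h.
apply/imsetP/idP => [[h1] | ].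
  rewrite !inE => /andP[h1Y /extends_onP e1] ->; rewrite groupM ?groupV //=.
  apply/forall_inP => _ /imsetP[v vs ->]; rewrite -actM mulKVg.
  by apply/eqP/f_inj; rewrite e1 // e0.
rewrite !inE => /andP[hY /forall_inP fh]; exists (h0 * h)%g; rewrite ?mulKg //.
rewrite inE groupM //=; apply/extends_onP => v vs; rewrite actM.
by rewrite (eqP (fh _ (imset_f (to^~ h0) vs))) e0.
Qed.

Let card_extending s h g0 : g0 \in Y' -> extends_on s h g0 ->
  #|[set g in Y' | extends_on s h g]| = #|fixer' (setact to s h)|.
Proof.
move=> g0Y /extends_onP e0; rewrite -(card_imset _ (mulgI g0^-1%g)); apply: eq_card => g.
apply/imsetP/idP => [[g1] | ].
  rewrite !inE => /andP[g1Y /extends_onP e1] ->; rewrite groupM ?groupV //=.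
  apply/forall_inP => _ /imsetP[v vs ->].
  by rewrite e0 // -actM mulKVg -e1 // e0.
rewrite !inE => /andP[gY /forall_inP fg]; exists (g0 * g)%g; rewrite ?mulKg //.
rewrite inE groupM //=; apply/extends_onP => v vs; rewrite actM -e0 //.
by rewrite (eqP (fg _ (imset_f (to^~ h) vs))).
Qed.

Let D k := diag_mx (\row_(j < #|faces C k|) (#|fixer (enum_val j)|%:R : K)).
Let D' k := diag_mx (\row_(j < #|faces C k|) (#|fixer' (enum_val j)|%:R : K)).

Let diag_free n (d : 'rV[K]_n) : (forall j, d 0 j != 0) -> row_free (diag_mx d).
Proof.
move=> d0; apply/row_freeP; exists (diag_mx (\row_j (d 0 j)^-1)).
rewrite mulmx_diag; apply/matrixP => i j; rewrite !mxE.
by case: eqVneq => [->|_] //; rewrite mulr1n mulfV.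
Qed.

(* Both sides count, with signs, the pairs (h, g) in Y x Y' such that g extends
   h on the i-th face and h sends that face to the j-th one. *)
Let compress k : extension_mx k *m A' k *m (extension_mx k)^T *m D k = A k *m D' k.
Proof.
apply/matrixP => i j; rewrite !mul_mx_diag [LHS]mxE [RHS]mxE.
rewrite [X in _ * X = _]mxE [X in _ = _ * X]mxE.
set s := enum_val i; set t := enum_val j.
have sC : s \in C by have := enum_valP i; rewrite inE => /andP[].
have tC : t \in C by have := enum_valP j; rewrite inE => /andP[].
pose F h g : K := (-1) ^+ inversions to h s *+ (extends_on s h g && (t == setact to s h)).
transitivity (\sum_(g in Y') \sum_(h in Y) F h g).
  have -> : (extension_mx k *m A' k *m (extension_mx k)^T) i j
    = \sum_(g in Y') (-1) ^+ map_inversions f s * (-1) ^+ inversions to' g (f @: s)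
       * (-1) ^+ map_inversions f t *+ (f @: t == setact to' (f @: s) g).
    pose u := face_index (faces_imset (enum_valP j)).
    rewrite mxE (bigD1 u) //= big1 ?addr0 => [|w]; last first.
      by rewrite eq_face_index !mxE => /negPf->; rewrite mulr0.
    rewrite mul_extension_mx !mxE face_indexK eqxx mulr1n /A' summxE mulr_sumr mulr_suml.
    by apply: eq_bigr => g _; rewrite mxE !face_indexK mulrnAr mulrnAl.
  rewrite mulr_suml; apply: eq_bigr => g gY /=.
  case: (eqVneq (f @: t) (setact to' (f @: s) g)) => [e|ne]; last first.
    rewrite mulr0n mul0r big1 // => h _; rewrite /F.
    case: (boolP (extends_on s h g)) => //= /extends_on_imset e; case: eqP => // te.
    by case/eqP: ne; rewrite -e -te.
  have [h0 h0Y e0] := extend_down sC tC gY (esym e).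
  have th0 : t = setact to s h0.
    by apply: (imset_inj f_inj); rewrite e -(extends_on_imset e0).
  rewrite mulr1n th0 -(card_extended h0Y e0) mulr_natr -sumr_const.
  rewrite [RHS]big_mkcond [LHS]big_mkcond; apply: eq_bigr => h _; rewrite inE /F.
  case: (h \in Y) => //=; case: (boolP (extends_on s h g)) => //= eh.
  have th : setact to s h0 = setact to s h.
    by apply: (imset_inj f_inj); rewrite (extends_on_imset e0) -(extends_on_imset eh).
  by rewrite th0 th eqxx mulr1n -(extends_on_sign eh) -mulrA -expr2 sqrr_sign mulr1.
rewrite exchange_big summxE mulr_suml; apply: eq_bigr => h hY /=.
rewrite mxE -/s -/t; case: (eqVneq t (setact to s h)) => [e|ne]; last first.
  by rewrite mulr0n mul0r big1 // => g _; rewrite /F (negPf ne) andbF.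
have [g0 g0Y hg0] := extend_up hY.
have e0 : extends_on s h g0 by apply/extends_onP => v _.
rewrite mulr1n [in RHS]e -(card_extending g0Y e0) mulr_natr -sumr_const.
rewrite [RHS]big_mkcond [LHS]big_mkcond; apply: eq_bigr => g _; rewrite inE /F e eqxx andbT.
by case: (g \in Y'); case: extends_on.
Qed.

(** Write E for [extension_mx]. By [compress], with [D'] invertible, X A factors through X E A' up
    to rank; conversely, lifting Y into Y' gives #|Y| E A' = A E A'. *)
Lemma rank_orbit_sum_extension k n (X : 'M[K]_(n, #|faces C k|)) :
  \rank (X *m A k) = \rank (X *m extension_mx k *m A' k).
Proof.
apply/eqP; rewrite eqn_leq; apply/andP; split.
  have fD' : row_free (D' k) by apply: diag_free => j; rewrite mxE fixer'_neq0.
  rewrite -(mxrankMfree _ fD') -mulmxA -compress !mulmxA -[_ *m _ *m D k]mulmxA.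
  exact: mxrankM_maxl.
have Y0 : #|Y|%:R != 0 :> K by rewrite natr_char0_eq0 // -lt0n cardG_gt0.
rewrite -(mxrank_scale_nz _ Y0).
have -> : #|Y|%:R *: (X *m extension_mx k *m A' k) = X *m A k *m (extension_mx k *m A' k).
  rewrite -!mulmxA [LHS]scalemxAr; congr (X *m _).
  rewrite scaler_nat -sumr_const mulmx_suml; apply: eq_bigr => h hY.
  have [g gY hg] := extend_up hY; rewrite mulmxA (chain_extension _ hg) -mulmxA; congr (_ *m _).
  rewrite /A' mulmx_sumr (reindex_inj (mulgI g)) /=; apply: eq_big => [g'|g' _].
    by rewrite groupMl.
  by have [_ ->] := chain_mx_repr K toC' k; rewrite ?inE.
exact: mxrankM_maxl.
Qed.

(** Some element of Y' moves any given face of C' to one coming from C, and [A'] absorbs that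
    element; so each row of [A'] is, up to sign, a row of the left side. *)
Lemma extension_orbit_sum k : (extension_mx k *m A' k :=: A' k)%MS.
Proof.
apply/eqmxP; rewrite submxMl /=; apply/row_subP => i.
have i'C : enum_val i \in C' by have := enum_valP i; rewrite inE => /andP[].
have [g gY [s sC e]] := extend_surj i'C.
have hi : setact to' (enum_val i) g \in faces C' k by rewrite faces_act ?enum_valP.
have sF : s \in faces C k.
  by move: hi; rewrite e !inE sC card_imset // => /andP[_ ->].
have AE : A' k = chain_mx K to' C' k g *m A' k.
  rewrite {2}/A' mulmx_sumr /A' [LHS](reindex_inj (mulgI g)) /=; apply: eq_big => [g'|g' _].
    by rewrite groupMl.
  by have [_ ->] := chain_mx_repr K toC' k; rewrite ?inE.
pose c : K := (-1) ^+ inversions to' g (enum_val i) * (-1) ^+ map_inversions f s.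
suff -> : row i (A' k) = c *: row (face_index sF) (extension_mx k *m A' k).
  exact/scalemx_sub/row_sub.
apply/rowP => j; rewrite [in LHS]AE mxE (mul_chain_mx _ _ hi) mxE.
rewrite [X in _ = _ * X]mxE mul_extension_mx.
have : enum_val (face_index (faces_imset (enum_valP (face_index sF)))) = f @: s.
  by rewrite !face_indexK.
move: (face_index (faces_imset _)) => u ue; rewrite face_indexK /c.
rewrite mulrA -[(_ * _) * (-1) ^+ map_inversions f s]mulrA -expr2 sqrr_sign mulr1.
by congr (_ * A' k _ _); apply: enum_val_inj; rewrite face_indexK e ue.
Qed.

Lemma rank_orbit_sum k : \rank (A k) = \rank (A' k).
Proof. by rewrite -[A k]mul1mx rank_orbit_sum_extension mul1mx extension_orbit_sum. Qed.

Lemma rank_boundary_orbit_sum k l :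
  \rank (boundary K C k l *m A l) = \rank (boundary K C' k l *m A' l).
Proof.
rewrite rank_orbit_sum_extension boundary_extension -mulmxA.
have -> : boundary K C' k l *m A' l = A' k *m boundary K C' k l.
  rewrite /A' mulmx_sumr mulmx_suml; apply: eq_bigr => g _.
  exact/esym/(boundary_equivariant K toC').
by rewrite mulmxA (eqmxMr _ (extension_orbit_sum k)).
Qed.

End Extension.

End Oriented.

(** * Traces on the reduced homology *)

Section HomologyTrace.

Variables (K : fieldType) (charK : [pchar K] =i pred0).

Section OneComplex.

Variables (T : finType) (gT : finGroupType) (to : {action gT &-> T}) (C : {set {set T}}).
Hypothesis cC : is_complex C.
Variable toC : [acts [set: gT], on C | to^*].

Local Notation chain := (chain_repr K toC).
Local Notation B k l := (hom_image_module (boundary_equivariant K toC k l)).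

Lemma mxtrace_homology k g : \tr (reduced_homology K toC k g)
  = \tr (chain k g) - \tr (submod_repr (B k (k - 1)) g) - \tr (submod_repr (B (k + 1) k) g).
Proof.
have UV : (<<boundary K C (k + 1) k>> <= kermx (boundary K C k (k - 1)))%MS.
  by rewrite genmxE; apply/sub_kermxP; apply: boundary_boundary.
rewrite /reduced_homology /= (mxtrace_section charK _ _ _ UV); congr (_ - _).
have := mxtrace_ker_image charK (boundary_equivariant K toC k (k - 1))
  (cycles_module K toC k) (B k (k - 1)) g.
by move<-; rewrite addrK.
Qed.

Definition indicator (Y : {set gT}) (g : gT) : K := #|Y|%:R^-1 * (g \in Y)%:R.

Lemma op_indicator n (rG : mx_representation K [set: gT] n) (Y : {set gT}) :
  op rG (indicator Y) = #|Y|%:R^-1 *: \sum_(g in Y) rG g.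
Proof.
rewrite /op scaler_sumr [RHS]big_mkcond; apply: eq_bigr => g _ /=.
by rewrite /indicator; case: (g \in Y); rewrite ?mulr1 ?mulr0 ?scale0r.
Qed.

Lemma op_indicator_idem n (rG : mx_representation K [set: gT] n) (Y : {group gT}) :
  op rG (indicator Y) *m op rG (indicator Y) = op rG (indicator Y).
Proof.
have Y0 : #|Y|%:R != 0 :> K by rewrite natr_char0_eq0 // -lt0n cardG_gt0.
rewrite !op_indicator -scalemxAl -scalemxAr; congr (_ *: _).
rewrite mulmx_suml (eq_bigr (fun _ => \sum_(g in Y) rG g)) => [|h hY].
  by rewrite sumr_const -scaler_nat scalerA mulVf ?scale1r.
rewrite mulmx_sumr [RHS](reindex_inj (mulgI h)) /=.
by apply: eq_big => [g|g _]; rewrite ?groupMl ?repr_mulg.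
Qed.

(** Averaging over Y turns traces into dimensions: the invariant homology is counted by the
    invariant chains minus the invariants of the images of the two boundary maps. *)
Lemma trace_homology_indicator k (Y : {group gT}) :
  \sum_g indicator Y g * \tr (reduced_homology K toC k g)
  = (\rank (\sum_(g in Y) chain_mx K to C k g)%R)%:R
    - (\rank (boundary K C k (k - 1) *m \sum_(g in Y) chain_mx K to C (k - 1) g)%R)%:R
    - (\rank (boundary K C (k + 1) k *m \sum_(g in Y) chain_mx K to C k g)%R)%:R.
Proof.
have Y0 : #|Y|%:R^-1 != 0 :> K by rewrite invr_eq0 natr_char0_eq0 // -lt0n cardG_gt0.
under eq_bigr do rewrite mxtrace_homology !mulrBr.
rewrite !sumrB -!mxtrace_op !mxtrace_submod_op_idem ?op_indicator_idem //.
have := op_indicator_idem (chain k) Y; rewrite -{3}[op _ _]scale1r => /mxtrace_quasi_idem ->.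
rewrite mul1r !op_indicator.
rewrite -!scalemxAr !(mxrank_scale_nz _ Y0).
congr (_ - _%:R - _%:R).
  exact: (eqmxMr _ (genmxE (boundary K C k (k - 1)))).1.
exact: (eqmxMr _ (genmxE (boundary K C (k + 1) k))).1.
Qed.

Lemma trace_homology_op0 k phi :
  (forall l, op (chain l) phi = 0) -> \sum_g phi g * \tr (reduced_homology K toC k g) = 0.
Proof.
move=> op0; under eq_bigr do rewrite mxtrace_homology !mulrBr.
have sub0 l U (modU : mxmodule (chain l) U) : op (submod_repr modU) phi = 0.
  have bfree : row_free (val_submod (1%:M : 'M_(\rank U))) by rewrite /row_free val_submod1.
  by apply: (row_free_inj bfree); rewrite val_submod_op op0 mulmx0 mul0mx.
by rewrite !sumrB -!mxtrace_op !sub0 op0 !mxtrace0 !subr0.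
Qed.

End OneComplex.

Section Stable.

Variables (T T' : finType) (f : T -> T') (gT gT' : finGroupType).
Variables (to : {action gT &-> T}) (to' : {action gT' &-> T'}).
Variables (C : {set {set T}}) (C' : {set {set T'}}) (Y : {group gT}) (Y' : {group gT'}).

Lemma trace_homology_extension k
    (toC : [acts [set: gT], on C | to^*]) (toC' : [acts [set: gT'], on C' | to'^*]) :
    injective f -> is_complex C -> is_complex C' -> (forall s, s \in C -> f @: s \in C') ->
    (forall h, h \in Y -> exists2 g, g \in Y' & forall v, f (to v h) = to' (f v) g) ->
    (forall s t g, s \in C -> t \in C -> g \in Y' -> setact to' (f @: s) g = f @: t ->
       exists2 h, h \in Y & extends_on f to to' s h g) ->
    (forall s' : {set T'}, s' \in C' ->
       exists2 g, g \in Y' & exists2 s, s \in C & setact to' s' g = f @: s) ->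
  \sum_g indicator Y g * \tr (reduced_homology K toC k g)
    = \sum_g indicator Y' g * \tr (reduced_homology K toC' k g).
Proof.
move=> f_inj cC cC' fC up down surj; rewrite !trace_homology_indicator //.
rewrite (rank_orbit_sum charK f_inj toC toC' fC up down surj).
by rewrite !(rank_boundary_orbit_sum charK f_inj cC toC toC' fC up down surj).
Qed.

End Stable.

End HomologyTrace.

(** * Packing complexes *)

(** Induction on A: a permutation p that is right on A minus a is corrected at a by the
    transposition of p a and f a, which have the same colour c. *)
Lemma perm_extend (T : finType) (c : T -> nat) (A : {set T}) (f : T -> T) :
    {in A &, injective f} -> {in A, forall x, c (f x) = c x} ->
  exists2 p : {perm T}, {in A, p =1 f} & forall x, c (p x) = c x.
Proof.
have [m] := ubnP #|A|; elim: m => // m IHm in A *; rewrite ltnS => Am f_inj cf.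
have [->|/set0Pn[a aA]] := eqVneq A set0.
  by exists 1%g => x; rewrite ?inE ?perm1.
have sA : A :\ a \subset A by apply: subsetDl.
have [|||p pf cp] := IHm (A :\ a).
- by apply: leq_trans Am; rewrite [X in (_ < X)%N](cardsD1 a) aA.
- by move=> x y /(subsetP sA) xA /(subsetP sA) yA; apply: f_inj.
- by move=> x /(subsetP sA) xA; apply: cf.
exists (p * tperm (p a) (f a))%g => [x xA | x]; rewrite permM.
  have [->|xa] := eqVneq x a; first by rewrite tpermL.
  have xAa : x \in A :\ a by rewrite !inE xa.
  rewrite tpermD; first exact: pf.
    by rewrite (inj_eq (@perm_inj _ p)) eq_sym.
  by rewrite pf //; apply: contra xa => /eqP/f_inj->.
by rewrite -[RHS]cp; case: tpermP => // ->; rewrite cp cf.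
Qed.

(** Values are optional because U may be empty. *)
Lemma exists_injection (T U : finType) (A : {set T}) (B : {set U}) : (#|A| <= #|B|)%N ->
  exists f : T -> option U, forall x, x \in A ->
    exists y, [/\ f x = Some y, y \in B & forall x', x' \in A -> f x' = f x -> x' = x].
Proof.
move=> AB; pose f x := nth None (map Some (enum B)) (index x (enum A)).
exists f => x xA; have xi : (index x (enum A) < size (enum B))%N.
  by rewrite -cardE (leq_trans _ AB) // cardE index_mem mem_enum.
have /mapP[y] : f x \in map Some (enum B) by apply: mem_nth; rewrite size_map.
rewrite mem_enum => yB e; exists y; split=> // x' x'A /eqP.
have x'i : (index x' (enum A) < size (enum B))%N.
  by rewrite -cardE (leq_trans _ AB) // cardE index_mem mem_enum.
rewrite nth_uniq ?size_map ?map_inj_uniq ?enum_uniq //; last by move=> ? ? [].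
by move/eqP/(congr1 (nth x (enum A))); rewrite !nth_index ?mem_enum.
Qed.

Section ProductSets.

Variables (n : nat) (N : 'I_n -> nat).
Local Notation group := {dffun forall i : 'I_n, 'S_(N i)}.

Definition prod_set (P : forall i, {set 'S_(N i)}) : {set group} :=
  [set g : group | [forall i, g i \in P i]].

Lemma prod_setP (P : forall i, {set 'S_(N i)}) (g : group) : reflect (forall i, g i \in P i) (g \in prod_set P).
Proof. by rewrite inE; apply: forallP. Qed.

Lemma prod_group_set (P : forall i, {group 'S_(N i)}) : group_set (prod_set P).
Proof.
apply/group_setP; split=> [|g h /prod_setP gP /prod_setP hP].
  by apply/prod_setP => i; rewrite ffunE group1.
by apply/prod_setP => i; rewrite ffunE groupM ?gP ?hP.
Qed.
Canonical prod_group P := Group (prod_group_set P).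

End ProductSets.

(** * Embedding a packing complex into a larger one *)

Section PackingExtension.

Variables (n : nat) (N N' d : 'I_n -> nat).
Hypothesis leN : forall i, (N i <= N' i)%N.

Local Notation vertex N := {dffun forall i : 'I_n, {set 'I_(N i)}}.
Local Notation group N := {dffun forall i : 'I_n, 'S_(N i)}.

Fact shift_ord_proof i (x : 'I_(N i)) : (x + (N' i - N i) < N' i)%N.
Proof. by have := ltn_ord x; have := leN i; lia. Qed.

(** A shift rather than the inclusion of an initial segment: the added cells come in front of the
    first row, so that old cells keep their rows. *)
Definition shift_ord i x := Ordinal (@shift_ord_proof i x).

Lemma shift_ord_inj i : injective (@shift_ord i).
Proof. by move=> x y /(congr1 val) /= /addIn /val_inj. Qed.

Definition shift_vertex (v : vertex N) : vertex N' := [ffun i => @shift_ord i @: v i].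

Lemma shift_vertex_inj : injective shift_vertex.
Proof.
move=> v w e; apply/ffunP => i; apply: (imset_inj (@shift_ord_inj i)).
by have := congr1 (fun u : vertex N' => u i) e; rewrite !ffunE.
Qed.

Lemma packing_complex_shift (s : {set vertex N}) :
  (shift_vertex @: s \in packing_complex N' d) = (s \in packing_complex N d).
Proof.
rewrite !inE; congr (_ && _).
  apply/forall_inP/forall_inP => h v vs.
    have := h _ (imset_f _ vs); congr (is_true _); apply: eq_forallb => i.
    by rewrite ffunE card_imset //; apply: shift_ord_inj.
  case/imsetP: vs => w ws ->; have := h _ ws; congr (is_true _); apply: eq_forallb => i.
  by rewrite ffunE card_imset //; apply: shift_ord_inj.
have E a b : ((shift_vertex a != shift_vertex b) ==>
      [forall i, [disjoint (shift_vertex a : vertex N') i & (shift_vertex b : vertex N') i]])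
   = ((a != b) ==> [forall i, [disjoint (a : vertex N) i & (b : vertex N) i]]).
  rewrite (inj_eq shift_vertex_inj); congr (_ ==> _); apply: eq_forallb => i.
  by rewrite !ffunE imset_disjoint //; apply: shift_ord_inj.
apply/forall_inP/forall_inP => h v vs; apply/forall_inP => w ws.
  by have := forall_inP (h _ (imset_f _ vs)) _ (imset_f _ ws); rewrite E.
case/imsetP: vs => v' v's ->; case/imsetP: ws => w' w's ->; rewrite E.
exact: (forall_inP (h _ v's)).
Qed.

Variables (sh sh' : 'I_n -> seq nat).
Hypothesis row_shift : forall i (x : 'I_(N i)),
  reshape_index (sh' i) (shift_ord x) = reshape_index (sh i) x.
Hypothesis row_new : forall i (x' : 'I_(N' i)), (forall x, x' != @shift_ord i x) ->
  reshape_index (sh' i) x' = 0%N.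

Local Notation Y := (prod_group (fun i => row_stabilizer_group (N i) (sh i))).
Local Notation Y' := (prod_group (fun i => row_stabilizer_group (N' i) (sh' i))).

Lemma shift_extend_up (h : group N) : h \in Y ->
  exists2 g : group N', g \in Y' & forall v, shift_vertex (packing_act N v h) = packing_act N' (shift_vertex v) g.
Proof.
move=> /prod_setP hY.
have ext i : exists2 p : 'S_(N' i), p \in row_stabilizer (N' i) (sh' i)
    & forall x, p (shift_ord x) = @shift_ord i (h i x).
  pose f x' := if [pick x | shift_ord x == x'] is Some x then @shift_ord i (h i x) else x'.
  have fE x : f (shift_ord x) = @shift_ord i (h i x).
    rewrite /f; case: pickP => [y /eqP /shift_ord_inj -> //|/(_ x)].
    by rewrite eqxx.
  have [||p pf cp] := @perm_extend _ (fun x : 'I_(N' i) => reshape_index (sh' i) x) (@shift_ord i @: setT) f.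
  - move=> _ _ /imsetP[x _ ->] /imsetP[y _ ->]; rewrite !fE.
    by move=> /shift_ord_inj /perm_inj ->.
  - move=> _ /imsetP[x _ ->]; rewrite fE !row_shift.
    exact: (row_stabilizerP _ _ (hY i)).
  exists p => [|x]; first exact/row_stabilizerP.
  by rewrite pf ?fE // imset_f.
have [p pR pE] := fin_all_exists2 ext.
exists [ffun i => p i]; first by apply/prod_setP => i; rewrite ffunE.
move=> v; apply/ffunP => i; rewrite !ffunE -!imset_comp; apply: eq_imset => x /=.
by rewrite pE.
Qed.

(** On the points of s, g lands again in the image of the shift; this defines a row-preserving
    injection of these points, which [perm_extend] completes. *)
Lemma shift_extend_down (s t : {set vertex N}) (g : group N') :
    s \in packing_complex N d -> t \in packing_complex N d -> g \in Y' ->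
    setact (packing_act N') (shift_vertex @: s) g = shift_vertex @: t ->
  exists2 h : group N, h \in Y & extends_on shift_vertex (packing_act N) (packing_act N') s h g.
Proof.
move=> _ _ /prod_setP gY e.
have ext i : exists2 p : 'S_(N i), p \in row_stabilizer (N i) (sh i)
    & forall v x, v \in s -> x \in (v : vertex N) i -> @shift_ord i (p x) = g i (shift_ord x).
  pose A := [set x | [exists v in s, x \in (v : vertex N) i]].
  pose f x := if [pick y | @shift_ord i y == g i (shift_ord x)] is Some y then y else x.
  have fE : {in A, forall x, @shift_ord i (f x) = g i (shift_ord x)}.
    move=> x; rewrite inE => /exists_inP[v vs xv]; rewrite /f.
    case: pickP => [y /eqP //|no].
    have : packing_act N' (shift_vertex v) g \in setact (packing_act N') (shift_vertex @: s) g.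
      by apply: (imset_f (packing_act N' ^~ g)); apply: imset_f.
    rewrite e => /imsetP[w wt] /(congr1 (fun u : vertex N' => u i)); rewrite !ffunE => vw.
    have : g i (shift_ord x) \in @shift_ord i @: w i by rewrite -vw; apply: (imset_f (g i)); apply: imset_f.
    by case/imsetP => y _ gy; have := no y; rewrite gy eqxx.
  have [||p pf cp] := @perm_extend _ (fun x : 'I_(N i) => reshape_index (sh i) x) A f.
  - move=> x y xA yA /(congr1 (@shift_ord i)); rewrite !fE // => /perm_inj.
    exact: shift_ord_inj.
  - move=> x xA; rewrite -!row_shift fE //.
    exact: (row_stabilizerP _ _ (gY i)).
  exists p => [|v x vs xv]; first exact/row_stabilizerP.
  have xA : x \in A by rewrite inE; apply/exists_inP; exists v.
  by rewrite pf ?fE.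
have [p pR pE] := fin_all_exists2 ext.
exists [ffun i => p i]; first by apply/prod_setP => i; rewrite ffunE.
apply/extends_onP => v vs; apply/ffunP => i; rewrite !ffunE -!imset_comp.
by apply: eq_in_imset => x xv /=; apply: pE vs xv.
Qed.

Definition face_points N (s : {set vertex N}) i := [set x | [exists v in s, x \in (v : vertex N) i]].

(** Points outside the image of the shift lie in the first row by [row_new], so it suffices to move
    the first-row points of the face into the shifted first row of the small tableau. The case N i =
    N' i serves the factors whose parameter is fixed. *)
Lemma shift_extend_surj (s' : {set vertex N'}) : s' \in packing_complex N' d ->
    (forall i, N i = N' i \/
       (#|face_points s' i| <= #|[set x : 'I_(N i) | reshape_index (sh i) x == 0%N]|)%N) ->
  exists2 g : group N', g \in Y'
    & exists2 s, s \in packing_complex N d & setact (packing_act N') s' g = shift_vertex @: s.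
Proof.
move=> s'C room.
have mv i : exists2 p : 'S_(N' i), p \in row_stabilizer (N' i) (sh' i)
    & forall x', x' \in face_points s' i -> exists x, p x' = @shift_ord i x.
  have [eN|small] := room i.
    exists 1%g => [|x' _]; first exact: group1.
    have xN : (x' < N i)%N by rewrite eN.
    by exists (Ordinal xN); rewrite perm1; apply: val_inj; rewrite /= eN subnn addn0.
  set R0 := [set x | _] in small.
  (* All first-row points are moved, even those already in the image: the targets then need not
     avoid points kept in place. *)
  pose Z := [set x' in face_points s' i | reshape_index (sh' i) x' == 0%N].
  have ZE x' : (x' \in Z) = (x' \in face_points s' i) && (reshape_index (sh' i) x' == 0%N).
    by rewrite [LHS]inE.
  have ZR : (#|Z| <= #|R0|)%N.
    by apply: leq_trans small; apply: subset_leq_card; apply/subsetP => x'; rewrite inE => /andP[].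
  have [j jP] := exists_injection ZR.
  pose f x' := if x' \in Z then odflt x' (omap (@shift_ord i) (j x')) else x'.
  have fZ x' : x' \in Z -> exists x, [/\ j x' = Some x, f x' = @shift_ord i x & x \in R0].
    by move=> x'Z; have [x [jx xR _]] := jP x' x'Z; exists x; rewrite /f x'Z jx.
  have fN x' : x' \notin Z -> f x' = x' by rewrite /f => /negPf->.
  have cf : {in face_points s' i, forall x', reshape_index (sh' i) (f x') = reshape_index (sh' i) x'}.
    move=> x' x's; case: (boolP (x' \in Z)) => [x'Z|/fN-> //].
    have [x [_ -> xR]] := fZ x' x'Z; rewrite row_shift.
    by move: xR x'Z; rewrite !inE => /eqP -> /andP[_ /eqP ->].
  have [||p pf cp] := @perm_extend _ (fun x : 'I_(N' i) => reshape_index (sh' i) x) (face_points s' i) f.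
  - move=> x' y' x's y's e; have := cf x' x's; rewrite e cf // => cxy.
    have ZZ : (x' \in Z) = (y' \in Z) by rewrite !ZE x's y's cxy.
    case: (boolP (x' \in Z)) => x'Z; last by move: e; rewrite !fN // -ZZ.
    have y'Z : y' \in Z by rewrite -ZZ.
    have [x [_ _ uniq_x]] := jP x' x'Z; apply/esym/uniq_x => //.
    have [a [ja fa _]] := fZ x' x'Z; have [b [jb fb _]] := fZ y' y'Z.
    by rewrite ja jb; congr Some; apply: (@shift_ord_inj i); rewrite -fa -fb.
  - exact: cf.
  exists p => [|x' x's]; first exact/row_stabilizerP.
  rewrite pf //; case: (boolP (x' \in Z)) => x'Z.
    by have [x [_ -> _]] := fZ x' x'Z; exists x.
  rewrite fN //; case: (pickP (fun x => @shift_ord i x == x')) => [x /eqP <-|no]; first by exists x.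
  by move: x'Z; rewrite ZE x's row_new // => x; rewrite eq_sym no.
have [p pR pE] := fin_all_exists2 mv; pose g : group N' := [ffun i => p i].
have gY : g \in Y' by apply/prod_setP => i; rewrite ffunE.
exists g => //; pose s := shift_vertex @^-1: (setact (packing_act N') s' g).
have sE : setact (packing_act N') s' g = shift_vertex @: s.
  apply/setP => v'; apply/idP/imsetP => [v's|[v]]; last by rewrite inE => vs ->.
  case/imsetP: (v's) => w ws v'E.
  pose v : vertex N := [ffun i => @shift_ord i @^-1: (v' i)].
  have vE : v' = shift_vertex v.
    apply/ffunP => i; rewrite ffunE; apply/setP => x'; apply/idP/imsetP => [x'v|[x]].
      have : x' \in p i @: w i by move: x'v; rewrite v'E /= !ffunE.
      case/imsetP => y yw x'y; have ys : y \in face_points s' i.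
        by rewrite inE; apply/exists_inP; exists w.
      have [x px] := pE i y ys; exists x; last by rewrite x'y px.
      by rewrite ffunE inE -px -x'y.
    by rewrite ffunE inE => xv ->.
  by exists v; rewrite // inE -vE.
exists s => //; rewrite -packing_complex_shift -sE.
exact: packing_complex_act.
Qed.

End PackingExtension.

Section PackingFaces.

Variables (n : nat) (N d : 'I_n -> nat).
Local Notation vertex := {dffun forall i : 'I_n, {set 'I_(N i)}}.
Local Notation group := {dffun forall i : 'I_n, 'S_(N i)}.
Implicit Types s : {set vertex}.

Lemma packing_sum_card s i : s \in packing_complex N d ->
  (\sum_(v in s) #|(v : vertex) i| = #|s| * d i)%N.
Proof.
rewrite inE => /andP[/forall_inP sd _]; rewrite -sum_nat_const.
by apply: eq_bigr => v vs; apply/eqP; apply: (forallP (sd v vs)).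
Qed.

Let sum_card_points s i :
  (\sum_(v in s) #|(v : vertex) i| = \sum_(x < N i) \sum_(v in s) (x \in (v : vertex) i))%N.
Proof.
rewrite exchange_big; apply: eq_bigr => v _ /=.
by rewrite -sum1_card big_mkcond; apply: eq_bigr => x _; case: (_ \in _).
Qed.

Lemma card_face_points s i : s \in packing_complex N d -> (#|face_points s i| <= #|s| * d i)%N.
Proof.
move=> sC; rewrite -(packing_sum_card i sC) sum_card_points -sum1_card big_mkcond /=.
apply: leq_sum => x _; case: ifP => //; rewrite inE => /exists_inP[v vs xv].
by rewrite (bigD1 v) //= xv.
Qed.

Lemma packing_card_leq s i : s \in packing_complex N d -> (#|s| * d i <= N i)%N.
Proof.
move=> sC; rewrite -(packing_sum_card i sC) sum_card_points.
rewrite -[leqRHS]card_ord -sum1_card; apply: leq_sum => x _.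
case: (pickP (fun v => (v \in s) && (x \in (v : vertex) i))) => [v /andP[vs xv]|no]; last first.
  by rewrite big1 // => v vs; have := no v; rewrite vs /= => ->.
rewrite (bigD1 v) //= xv big1 // => w /andP[ws wv]; apply/eqP; rewrite eqb0.
move: sC; rewrite inE => /andP[_ /forall_inP/(_ v vs)/forall_inP/(_ w ws)].
rewrite eq_sym wv => /forallP/(_ i); rewrite disjoint_subset => /subsetP/(_ x xv).
by rewrite inE.
Qed.

Lemma packing_bound_card (hd : forall i, (0 < d i)%N) r (hr : (r < n)%N) s :
  s \in packing_complex N d -> (#|s| <= packing_bound N d hr)%N.
Proof.
move=> sC; have le j : (#|s| <= N j %/ d j)%N by rewrite leq_divRL // packing_card_leq.
by rewrite /packing_bound; elim/big_ind: _ => // a b; rewrite leq_min => -> ->.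
Qed.

Variables (K : fieldType) (charK : [pchar K] =i pred0).

(* If the complement of the points of s in the i-th factor is larger than the
   number of columns, it contains two points x, y of a same column; the
   transposition (x y) fixes s and changes the sign of the symmetrizer. *)
Lemma chain_ysym_eq0 (sh : 'I_n -> seq nat) k i : is_shape (N i) (sh i) ->
    (forall s, s \in packing_complex N d -> (#|face_points s i| + nth 0 (sh i) 0 < N i)%N) ->
  op (chain_repr K (packing_acts N d) k) (fun g => \prod_j ysym K (sh j) (g j)) = 0.
Proof.
move=> shi small; apply/matrixP => a b; rewrite mxE.
set s := enum_val a; have sC : s \in packing_complex N d.
  by have := enum_valP a; rewrite inE => /andP[].
have [x [y [xy xs ys cxy]]] : exists x y : 'I_(N i), [/\ x != y, x \notin face_points s i,
    y \notin face_points s i & reshape_offset (sh i) x = reshape_offset (sh i) y].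
  have [/existsP[x /existsP[y /and4P[xy xs ys /eqP cxy]]]|no] := boolP [exists x : 'I_(N i), exists y : 'I_(N i),
    [&& x != y, x \notin face_points s i, y \notin face_points s i & reshape_offset (sh i) x == reshape_offset (sh i) y]].
    by exists x, y.
  have := small s sC; rewrite -[X in (_ < X)%N]card_ord -(cardsC (face_points s i)) ltn_add2l ltnNge.
  case/negP; rewrite cardE -(size_map (reshape_offset (sh i) \o val)) -[leqRHS](size_iota 0).
  apply: uniq_leq_size => [|c /mapP[x _ ->]].
    rewrite map_inj_in_uniq ?enum_uniq // => x y; rewrite !mem_enum !inE /= => xs ys cxy.
    apply/eqP; apply: contraR no => xy; apply/existsP; exists x; apply/existsP; exists y.
    by rewrite xy !inE xs ys cxy eqxx.
  rewrite mem_iota /= add0n; apply: leq_trans (tableau_col_lt shi x) _.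
  by case/andP: shi => sl _; apply: nth_sorted_geq.
pose t : group := finfun (dfwith (fun j => 1%g : 'S_(N j)) (tperm x y)).
have ti : t i = tperm x y by rewrite ffunE dfwith_in.
have tj j : j != i -> t j = 1%g by move=> ji; rewrite ffunE dfwith_out // eq_sym.
have ct g : \prod_j ysym K (sh j) ((t * g)%g j) = - \prod_j ysym K (sh j) (g j).
  rewrite (bigD1 i) //= [in RHS](bigD1 i) //= ffunE ti ysym_antisym; last first.
    by apply/col_stabilizerP => z; case: tpermP => // ->.
  rewrite odd_tperm xy mulN1r mulNr; congr (- (_ * _)).
  by apply: eq_bigr => j ji; rewrite ffunE tj // mul1g.
have tv v : v \in s -> packing_act N v t = v.
  move=> vs; apply/ffunP => j; rewrite ffunE; have [->|ji] := eqVneq j i; last first.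
    by rewrite tj // (eq_imset _ (perm1 (T := _))) imset_id.
  rewrite ti -[RHS]imset_id; apply: eq_in_imset => z zv.
  have zs : z \in face_points s i by rewrite inE; apply/exists_inP; exists v.
  by rewrite tpermD //; [apply: contra xs | apply: contra ys] => /eqP ->.
have st : setact (packing_act N) s t = s.
  by rewrite -[RHS]imset_id; apply: eq_in_imset => v; apply: tv.
have invt : inversions (packing_act N) t s = 0%N.
  apply/eqP; rewrite cards_eq0; apply/eqP/setP => -[u w]; rewrite !inE /=.
  apply/negP => /andP[/andP[us ws]]; rewrite !tv // => /andP[uw wu].
  by move: uw wu; rewrite /before => /ltn_trans h /h; rewrite ltnn.
have chain_t g : chain_repr K (packing_acts N d) k (t * g)%g a b = chain_repr K (packing_acts N d) k g a b.
  have tF : setact (packing_act N) (enum_val a) t \in faces (packing_complex N d) k.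
    by rewrite -/s st; apply: enum_valP.
  rewrite repr_mulg (mul_chain_mx _ _ tF) -/s invt mul1r; congr (chain_mx _ _ _ _ _ _ _).
  by apply: enum_val_inj; rewrite face_indexK.
set S := (X in X = _); have S2 : S = - S.
  rewrite {1}/S /op summxE (reindex_inj (mulgI t)) /S /op summxE -sumrN; apply: eq_bigr => g _.
  by rewrite [LHS]mxE [X in - X]mxE ct chain_t mulNr.
have : S *+ 2 == 0 by rewrite mulr2n {1}S2 addNr.
by rewrite -mulr_natr mulf_eq0 natr_char0_eq0 // orbF => /eqP.
Qed.

End PackingFaces.

(** * Products of symmetric groups *)

Lemma prod_sum_family (K : fieldType) (I : finType) (T_ : I -> finType) (F : forall i, T_ i -> K) :
  \prod_i \sum_(x : T_ i) F i x = \sum_(f : {dffun forall i, T_ i}) \prod_i F i (f i).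
Proof.
pose P_ i : {ffun T_ i -> K} := [ffun c => F i c].
transitivity (\prod_i \sum_(c : T_ i) P_ i c).
  by apply: eq_bigr => i _; apply: eq_bigr => c _; rewrite ffunE.
under eq_bigr do rewrite (big_tag (fun i c => P_ i c)).
rewrite bigA_distr_big_dep; transitivity (\sum_(t : fprod T_) \prod_(i in I) P_ i (t i)).
  by rewrite (big_fprod _ _ P_).
rewrite (reindex (@fprod_of_dffun I T_)) /=; last first.
  by apply: onW_bij; exists (@dffun_of_fprod I T_);
     [exact: fprod_of_dffunK | exact: dffun_of_fprodK].
by apply: eq_bigr => c _; apply: eq_bigr => i _; rewrite ffunE fprodE.
Qed.

Section ProductGroup.

Variables (K : fieldType) (charK : [pchar K] =i pred0) (n r : nat) (N : 'I_n -> nat).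

Local Notation group := {dffun forall i : 'I_n, 'S_(N i)}.
Local Notation sh lam i := (stable_shape N r lam i).
Implicit Types (lam mu : {ffun 'I_n -> seq nat}) (g h : group).

Definition valid_family lam := [forall i : 'I_n, valid_index (i < r)%N (N i) (lam i)].

Definition families : seq {ffun 'I_n -> seq nat} :=
  undup [seq lam <- [seq [ffun i => ssval (t i)]
           | t : {ffun 'I_n -> seq_sub (partitions_upto (\max_i N i))}] | valid_family lam].

Lemma mem_families lam : (lam \in families) = valid_family lam.
Proof.
rewrite mem_undup mem_filter andb_idr // => /forallP v.
have vM i : lam i \in partitions_upto (\max_i N i).
  have := v i; rewrite -mem_indices mem_filter => /andP[_].
  rewrite !mem_partitions_upto => /andP[-> /leq_trans] ->//.
  exact: (leq_bigmax i).
apply/imageP; exists [ffun i => SeqSub (vM i)] => //.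
by apply/ffunP => i; rewrite !ffunE.
Qed.

Lemma char_stable_irr lam g :
  \tr (stable_irr N K r lam g) = \prod_i char_specht K (sh lam i) (g i).
Proof.
pose S i := specht K (N i) (sh lam i).
transitivity (\sum_(c : {dffun forall i, 'I_(rdegree (S i))}) \prod_i S i (g i) (c i) (c i)).
  rewrite /mxtrace /=; under eq_bigr do rewrite mxE.
  rewrite -(big_enum_val (fun c : {dffun forall i, 'I_(rdegree (S i))} => \prod_i S i (g i) (c i) (c i))) /=.
  by apply: eq_bigl => c.
by rewrite -(prod_sum_dffun (rG := S) (fun i c => S i (g i) c c)).
Qed.

Definition prod_ysym lam g : K := \prod_i ysym K (sh lam i) (g i).

Definition prod_kappa lam : K := \prod_i kappa K (N i) (sh lam i).

Lemma valid_shape lam i : valid_family lam -> is_shape (N i) (sh lam i).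
Proof. by move/forallP/(_ i)/index_shape_is_shape. Qed.

Lemma prod_kappa_neq0 lam : valid_family lam -> prod_kappa lam != 0.
Proof. by move=> v; apply/prodf_neq0 => i _; apply/kappa_neq0/valid_shape. Qed.

Lemma prod_ysym_conv lam : valid_family lam ->
  conv (prod_ysym lam) (prod_ysym lam) =1 (fun g => prod_kappa lam * prod_ysym lam g).
Proof.
move=> v g; rewrite /prod_kappa /prod_ysym -big_split /=.
under [RHS]eq_bigr => i _ do rewrite -(conv_ysym charK (valid_shape i v)).
rewrite prod_sum_family; apply: eq_bigr => h _; rewrite -big_split /=.
by apply: eq_bigr => i _; rewrite !ffunE.
Qed.

Lemma prod_ysym_char lam mu : valid_family lam -> valid_family mu ->
  \sum_g prod_ysym mu g * \tr (stable_irr N K r lam g) = prod_kappa lam *+ (lam == mu).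
Proof.
move=> vl vm; under eq_bigr do rewrite char_stable_irr -big_split /=.
rewrite -(prod_sum_family (fun i x => ysym K (sh mu i) x * char_specht K (sh lam i) x)).
under eq_bigr => i _ do rewrite (char_specht_ysym charK (forallP vl i) (forallP vm i)).
have [->|ne] := eqVneq lam mu; first by apply: eq_bigr => i _; rewrite eqxx.
have /existsP[i li] : [exists i, lam i != mu i].
  by apply: contraR ne; rewrite negb_exists => /forallP h; apply/eqP/ffunP => i; apply/eqP/negPn/h.
by rewrite (bigD1 i) //= (negPf li) mul0r.
Qed.

Definition family_type g : {ffun 'I_n -> seq nat} := [ffun i : 'I_n => cycle_index (i < r)%N (g i)].

Lemma family_type_conj g h : family_type g = family_type h -> exists x, h = (g ^ x)%g.
Proof.
move/ffunP => e; have c i : exists x, h i = (g i ^ x)%g.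
  by apply/cycle_type_conj/(cycle_index_type (b := (i < r)%N)); have := e i; rewrite !ffunE.
have [x xE] := fin_all_exists c; exists (finfun x : group).
by apply/ffunP => i; rewrite /conjg !ffunE xE.
Qed.

Variables (m : nat) (V : mx_representation K [set: group] m).

(** The symmetrizer acts with rank 1 on its own product of Specht modules and with rank 0 on the
    others, by [prod_ysym_char] and [mxtrace_prod_ysym]. *)
Definition multiplicity lam := \rank (op V (prod_ysym lam)).

Lemma mxtrace_prod_ysym lam : valid_family lam ->
  \sum_g prod_ysym lam g * \tr (V g) = prod_kappa lam * (multiplicity lam)%:R.
Proof.
move=> v; rewrite -mxtrace_op; apply: mxtrace_quasi_idem.
by rewrite -op_conv (op_ext _ (prod_ysym_conv v)) op_scale.
Qed.

Lemma mxtrace_families g :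
  \tr (V g) = \sum_(lam <- families) (multiplicity lam)%:R * \tr (stable_irr N K r lam g).
Proof.
have class (p : nat) (W : mx_representation K [set: group] p) x y :
    family_type x = family_type y -> \tr (W x) = \tr (W y).
  by case/family_type_conj => z ->; rewrite mxtrace_conj.
rewrite (@class_expansion K _ _ families prod_ysym (fun l g => \tr (stable_irr N K r l g))
  prod_kappa family_type _ _ _ _ (fun g => \tr (V g))).
- rewrite [LHS]big_seq [RHS]big_seq; apply: eq_bigr => l; rewrite mem_families => vl.
  by rewrite mxtrace_prod_ysym // mulKf // prod_kappa_neq0.
- exact: undup_uniq.
- by move=> h; rewrite mem_families; apply/forallP => i; rewrite ffunE cycle_index_valid.
- by move=> l; rewrite mem_families; apply: prod_kappa_neq0.
- by move=> l l'; rewrite !mem_families; apply: prod_ysym_char.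
- by move=> l _ x y; apply: class.
- by move=> x y; apply: class.
Qed.

Local Notation Y mu := (prod_group (fun i => row_stabilizer_group (N i) (sh mu i))).

Definition prod_kostka lam mu : K := \prod_(i < n) kostka K (i < r)%N (N i) (lam i) (mu i).

Lemma trace_stable_irr_indicator lam mu :
  \sum_g indicator K (Y mu) g * \tr (stable_irr N K r lam g) = prod_kostka lam mu.
Proof.
have mem_Y (g : group) : (g \in Y mu)%:R = \prod_i rsym K (sh mu i) (g i) :> K.
  case: (boolP (g \in Y mu)) => [/prod_setP gY|].
    by rewrite big1 // => i _; rewrite /rsym gY.
  rewrite inE negb_forall => /existsP[i /negPf gi].
  by rewrite (bigD1 i) //= /rsym gi mul0r.
have card_Y : #|Y mu|%:R = \prod_i #|row_stabilizer (N i) (sh mu i)|%:R :> K.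
  transitivity (\sum_(g : group) (g \in Y mu)%:R : K).
    by rewrite -sum1_card natr_sum big_mkcond; apply: eq_bigr => g _; case: (_ \in _).
  rewrite (eq_bigr _ (fun g _ => mem_Y g)).
  rewrite -(prod_sum_family (fun i x => rsym K (sh mu i) x)); apply: eq_bigr => i _.
  by rewrite -sum1_card natr_sum [RHS]big_mkcond; apply: eq_bigr => x _; rewrite /rsym; case: (_ \in _).
transitivity (\sum_(g : group) (\prod_i #|row_stabilizer (N i) (sh mu i)|%:R)^-1
    * \prod_i (rsym K (sh mu i) (g i) * char_specht K (sh lam i) (g i))).
  by apply: eq_bigr => g _; rewrite /indicator card_Y mem_Y char_stable_irr -mulrA -big_split.
rewrite -mulr_sumr -(prod_sum_family (fun i x => rsym K (sh mu i) x * char_specht K (sh lam i) x)).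
by rewrite -prodfV -big_split.
Qed.

End ProductGroup.

(** * The stable range *)

Lemma mxtrace_big_dadd (K : fieldType) (gT : finGroupType) (I : Type) (s : seq I)
    (R : I -> representation K [set: gT]) g :
  \tr ((\big[dadd_grepr/grepr0]_(i <- s) R i) g) = \sum_(i <- s) \tr (R i g).
Proof.
elim: s => [|i s IHs]; first by rewrite !big_nil mxtrace1.
by rewrite !big_cons -IHs /= mxtrace_block.
Qed.

Lemma mxtrace_muln (K : fieldType) (gT : finGroupType) (R : representation K [set: gT]) p g :
  \tr (muln_grepr R p g) = p%:R * \tr (R g).
Proof. by rewrite mxtrace_big_dadd sumr_const card_ord mulr_natl. Qed.

Lemma padded_row_shift l M M' (x : nat) : (sumn l <= M)%N -> (M <= M')%N ->
  reshape_index (padded l M') (x + (M' - M)) = reshape_index (padded l M) x.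
Proof.
move=> lM MM'; rewrite /reshape_index /padded /=.
by have -> : ((x + (M' - M)).+1 - (M' - sumn l) = x.+1 - (M - sumn l))%N by lia.
Qed.

Section StableRange.

Variables (K : fieldType) (charK : [pchar K] =i pred0) (n r : nat) (hr : (r < n)%N).
Variables (d : 'I_n -> nat) (hd : forall i, (0 < d i)%N) (k : int) (N0 : 'I_n -> nat).

Local Notation m := (packing_bound N0 d hr).
Implicit Types (N : 'I_n -> nat) (lam mu : {ffun 'I_n -> seq nat}).

Definition in_range N := (forall i : 'I_n, (r <= i)%N -> N i = N0 i) /\
  (forall i : 'I_n, (i < r)%N -> (2 * m * d i <= N i)%N).

(** Every admissible N is compared with this smallest one. *)
Definition least_range (i : 'I_n) := if (i < r)%N then (2 * m * d i)%N else N0 i.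

Lemma in_range_least : in_range least_range.
Proof. by split=> i h; rewrite /least_range; [rewrite ltnNge h | rewrite h]. Qed.

Lemma least_range_leq N i : in_range N -> (least_range i <= N i)%N.
Proof. by move=> [h1 h2]; rewrite /least_range; case: ltnP => h; [apply: h2 | rewrite h1]. Qed.

Lemma least_range_fixed N (i : 'I_n) : in_range N -> (r <= i)%N -> least_range i = N i.
Proof. by move=> [h1 _] h; rewrite /least_range ltnNge h h1. Qed.

Lemma packing_bound_range N : in_range N -> packing_bound N d hr = m.
Proof.
move=> [h _]; rewrite /packing_bound h //; apply: eq_bigr => i /h ->.
by [].
Qed.

Lemma range_card_face_points N s (i : 'I_n) : in_range N -> s \in packing_complex N d ->
  (#|face_points s i| <= m * d i)%N.
Proof.
move=> hN sC; apply: leq_trans (card_face_points i sC) _; rewrite leq_mul2r.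
by rewrite -(packing_bound_range hN) packing_bound_card // orbT.
Qed.

Local Notation H N := (packing_homology N d K k).
Local Notation mult N := (multiplicity r (H N)).

Definition small lam := [forall i : 'I_n, (i < r)%N ==> (sumn (lam i) <= m * d i)%N].

Lemma multiplicity_small N lam : in_range N -> valid_family r N lam -> (0 < mult N lam)%N -> small lam.
Proof.
move=> hN v; rewrite lt0n; apply: contraR => /forallPn[i]; rewrite negb_imply -ltnNge => /andP[ir li].
rewrite -(natr_char0_eq0 charK) -(mulrI_eq0 _ (mulfI (prod_kappa_neq0 charK v))) -(mxtrace_prod_ysym charK _ v).
apply/eqP/(trace_homology_op0 charK (packing_complexP (d := d))) => l.
apply: (chain_ysym_eq0 charK l (i := i)); first exact: valid_shape v.
(* The number of columns is the length N_i - |lam^i| of the first row, less than N_i - m d_i, while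
   a face uses at most m d_i points. *)
move=> s sC; have := range_card_face_points i hN sC; rewrite /stable_shape ir /=.
have /andP[_] := forallP v i; rewrite ir /padded_defined.
by move=> h1 h2; lia.
Qed.

Lemma small_valid N N' lam : in_range N -> in_range N' -> small lam ->
  valid_family r N lam -> valid_family r N' lam.
Proof.
move=> [hN _] [hN' hN2] /forallP sm /forallP v; apply/forallP => i.
have /andP[pl] := v i; rewrite /valid_index pl /=; case: ltnP => ir; last by rewrite hN // hN'.
move=> _; have := sm i; rewrite ir /= /padded_defined => h; have := hN2 i ir.
have : (head 0 (lam i) <= sumn (lam i))%N by case: (lam i) => //= a t; apply: leq_addr.
lia.
Qed.

Definition small_families := [seq lam <- families r least_range | small lam].

Lemma uniq_small_families : uniq small_families.
Proof. exact/filter_uniq/undup_uniq. Qed.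

Lemma mem_small_families N lam : in_range N ->
  (lam \in small_families) = small lam && valid_family r N lam.
Proof.
move=> hN; rewrite mem_filter mem_families; case: (boolP (small lam)) => //= sm.
by apply/idP/idP; apply: small_valid => //; apply: in_range_least.
Qed.

Lemma mxtrace_small_families N g : in_range N ->
  \tr (H N g) = \sum_(lam <- small_families) (mult N lam)%:R * \tr (stable_irr N K r lam g).
Proof.
move=> hN; rewrite (mxtrace_families charK r (H N)).
rewrite (bigID small) /= [X in _ + X]big_seq_cond [X in _ + X]big1 ?addr0 => [|lam]; last first.
  rewrite mem_families => /andP[v ns]; have [->|] := posnP (mult N lam); first by rewrite mul0r.
  by move/(multiplicity_small hN v); rewrite (negPf ns).
rewrite -big_filter; apply: perm_big; apply: uniq_perm.
- exact/filter_uniq/undup_uniq.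
- exact/filter_uniq/undup_uniq.
by move=> lam; rewrite (mem_small_families _ hN) mem_filter mem_families.
Qed.

Lemma prod_kostka_range N lam mu : in_range N -> lam \in small_families -> mu \in small_families ->
  prod_kostka K r N lam mu = prod_kostka K r least_range lam mu.
Proof.
move=> hN lS mS; apply: eq_bigr => i _; case: (ltnP i r) => ir; last by rewrite (least_range_fixed hN ir).
have up l : l \in small_families -> l i \in partitions_upto (m * d i).
  rewrite (mem_small_families _ hN) => /andP[/forallP/(_ i)]; rewrite ir /= => li /forallP/(_ i)/andP[pl _].
  by rewrite mem_partitions_upto pl.
rewrite (kostka_stable charK _ (up _ lS) (up _ mS)); last by rewrite mulnA; apply: (proj2 hN).
by rewrite (kostka_stable charK _ (up _ lS) (up _ mS)) // mulnA; apply: (proj2 in_range_least).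
Qed.

Definition family_weight lam := (\sum_i tail_weight (lam i))%N.

(** A nonzero entry off the diagonal has weakly increasing weight in every factor, and strictly
    increasing weight in a factor where the families differ. *)
Lemma prod_kostka_unitriangular :
  unitriangular small_families family_weight (prod_kostka K r least_range).
Proof.
have vS l (i : 'I_n) : l \in small_families -> valid_index (i < r)%N (least_range i) (l i).
  by rewrite (mem_small_families _ in_range_least) => /andP[_ /forallP].
split=> [l lS|l l' lS l'S k0 ne]; first by apply: big1 => i _; apply/kostka_diag/vS.
have kn (i : 'I_n) : kostka K (i < r)%N (least_range i) (l i) (l' i) != 0.
  by move: k0 => /prodf_neq0; apply.
have w (i : 'I_n) := tail_weight_leq (proj1 (andP (vS l i lS))) (proj1 (andP (vS l' i l'S)))
  (dominates_tail (vS l i lS) (vS l' i l'S) (kostka_dominates charK (vS l i lS) (vS l' i l'S) (kn i))).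
have /existsP[i li] : [exists i, l i != l' i].
  by apply: contraR ne; rewrite negb_exists => /forallP h; apply/eqP/ffunP => i; apply/eqP/negPn/h.
rewrite /family_weight (bigD1 i) //= [X in (_ < X)%N](bigD1 i) //= -addSn leq_add //.
  by rewrite ltn_neqAle (proj1 (w i)) andbT; apply: contra li => /eqP /(proj2 (w i)) ->.
by apply: leq_sum => j _; apply: (proj1 (w j)).
Qed.

Local Notation Y N mu := (prod_group (fun i => row_stabilizer_group (N i) (stable_shape N r mu i))).

Lemma trace_indicator_range N mu : in_range N -> mu \in small_families ->
  \sum_g indicator K (Y least_range mu) g * \tr (H least_range g)
   = \sum_g indicator K (Y N mu) g * \tr (H N g).
Proof.
move=> hN mS; have le i : (least_range i <= N i)%N by apply: least_range_leq.
have [vb vN] : valid_family r least_range mu /\ valid_family r N mu.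
  have := mS; rewrite (mem_small_families _ in_range_least) => /andP[_ ->].
  by move: mS; rewrite (mem_small_families _ hN) => /andP[_ ->].
have row_shift i (x : 'I_(least_range i)) :
    reshape_index (stable_shape N r mu i) (shift_ord le x) = reshape_index (stable_shape least_range r mu i) x.
  rewrite /stable_shape /=; case: ltnP => ir; last first.
    by have -> : (N i - least_range i = 0)%N; rewrite ?addn0 // -(least_range_fixed hN ir) subnn.
  apply: padded_row_shift => //; have /andP[_] := forallP vb i; rewrite ir /padded_defined; lia.
have row_new i (x' : 'I_(N i)) : (forall x, x' != shift_ord le x) ->
    reshape_index (stable_shape N r mu i) x' = 0%N.
  move=> no; have x'lt : (x' < N i - least_range i)%N.
    rewrite ltnNge; apply/negP => h; have xlt : (x' - (N i - least_range i) < least_range i)%N.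
      by have := ltn_ord x'; have := le i; lia.
    have /negP[] := no (Ordinal xlt); apply/eqP/val_inj => /=.
    by rewrite subnK.
  rewrite /stable_shape; case: ltnP => ir; last by move: x'lt; rewrite (least_range_fixed hN ir) subnn.
  rewrite /reshape_index /padded /=; have /andP[_] := forallP vb i; rewrite ir /padded_defined => h.
  by have -> : (x'.+1 - (N i - sumn (mu i)) = 0)%N by lia.
apply: (trace_homology_extension charK k _ _ (@shift_vertex_inj _ _ _ le)) => [||s sC|h|s t g|s' s'C].
- exact: packing_complexP.
- exact: packing_complexP.
- by rewrite packing_complex_shift.
- exact: shift_extend_up.
- exact: shift_extend_down.
apply: shift_extend_surj => // i; case: (ltnP i r) => ir; last by left; apply: least_range_fixed hN ir.
(* The first row of mu^i[2 m d_i] has 2 m d_i - |mu^i| cells, at least m d_i. *)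
right; apply: leq_trans (range_card_face_points i hN s'C) _.
have := card_rows_lt (valid_shape i vb) 1; rewrite /stable_shape ir /= take0 addn0 => e.
have -> : [set x : 'I_(least_range i) | reshape_index (padded (mu i) (least_range i)) x == 0%N]
   = [set x : 'I_(least_range i) | (reshape_index (padded (mu i) (least_range i)) x < 1)%N].
  by apply/setP => x; rewrite !inE ltnS leqn0.
rewrite e; move: mS; rewrite mem_filter => /andP[/forallP/(_ i)]; rewrite ir /= => h _.
by rewrite /least_range ir; lia.
Qed.

(** Through the same unitriangular Kostka matrix, both vectors of multiplicities yield the
    dimensions of invariants compared in [trace_indicator_range]. *)
Lemma multiplicity_range N lam : in_range N -> lam \in small_families ->
  mult N lam = mult least_range lam.
Proof.
move=> hN lS; apply: (natr_char0_inj charK).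
apply: (unitriangular_inj uniq_small_families prod_kostka_unitriangular
  (f := fun l => (mult N l)%:R) (g := fun l => (mult least_range l)%:R)) => // mu mS.
have tr N' : in_range N' -> \sum_(l <- small_families) (mult N' l)%:R * prod_kostka K r least_range l mu
    = \sum_g indicator K (Y N' mu) g * \tr (H N' g).
  move=> hN'; under [RHS]eq_bigr do rewrite (mxtrace_small_families _ hN') mulr_sumr.
  rewrite exchange_big [LHS]big_seq [RHS]big_seq; apply: eq_bigr => l lS' /=.
  rewrite -(prod_kostka_range hN') // -trace_stable_irr_indicator mulr_sumr.
  by apply: eq_bigr => g _; rewrite mulrCA.
rewrite (tr N hN) (tr least_range in_range_least).
by rewrite (trace_indicator_range hN).
Qed.

End StableRange.

Theorem corollary5p2 (K : fieldType) (charK : [pchar K] =i pred0)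
    (n r : nat) (hr : (r < n)%N)
    (d : 'I_n -> nat) (hd : forall i : 'I_n, (0 < d i)%N)
    (k : int) (hk : -1 <= k)
    (N0 : 'I_n -> nat) :
  let m := packing_bound N0 d hr in
  exists (Lam : seq {ffun 'I_n -> seq nat})
         (mult : {ffun 'I_n -> seq nat} -> nat),
    [/\ uniq Lam,
        (forall lam, lam \in Lam -> (0 < mult lam)%N),
        (forall lam, lam \in Lam -> forall i : 'I_n, is_partition (lam i)),
        (forall lam, lam \in Lam ->
           forall i : 'I_n, (r <= i)%N -> sumn (lam i) = N0 i)
      & forall N : 'I_n -> nat,
          (forall i : 'I_n, (r <= i)%N -> N i = N0 i) ->
          (forall i : 'I_n, (i < r)%N -> (2 * m * d i <= N i)%N) ->
          (forall lam, lam \in Lam ->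
             forall i : 'I_n, (i < r)%N -> padded_defined (lam i) (N i))
          /\ mx_rsim (packing_homology N d K k)
               (\big[dadd_grepr/grepr0]_(lam <- Lam)
                  muln_grepr (stable_irr N K r lam) (mult lam))].
Proof.
(* The families and multiplicities are read off at the least admissible parameters, then transported
   to every N. *)
move=> m; pose b := least_range hr d N0.
pose mult := multiplicity r (packing_homology b d K k).
exists [seq lam <- small_families hr d N0 | (0 < mult lam)%N], mult.
have valid N lam : in_range hr d N0 N ->
    lam \in [seq lam <- small_families hr d N0 | (0 < mult lam)%N] -> valid_family r N lam.
  by move=> hN; rewrite mem_filter (mem_small_families _ hN) => /andP[_ /andP[]].
have hb : in_range hr d N0 b by apply: in_range_least.
split=> [|lam|lam lamL i|lam lamL i ir|N hN1 hN2].
- by apply: filter_uniq; apply: uniq_small_families.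
- by rewrite mem_filter => /andP[].
- by have /forallP/(_ i)/andP[] := valid b lam hb lamL.
- have /forallP/(_ i)/andP[_] := valid b lam hb lamL.
  by rewrite ltnNge ir /= => /eqP->; apply: (proj1 hb).
have hN : in_range hr d N0 N by split.
split=> [lam lamL i ir|].
  by have /forallP/(_ i)/andP[_] := valid N lam hN lamL; rewrite ir.
have multE lam : lam \in small_families hr d N0 ->
    multiplicity r (packing_homology N d K k) lam = mult lam.
  exact: multiplicity_range.
apply: (mx_rsim_trace charK) => g; rewrite mxtrace_big_dadd (mxtrace_small_families charK hd k _ hN).
rewrite [RHS]big_filter [LHS](bigID (fun lam => (0 < mult lam)%N)) /=.
rewrite [X in _ + X]big_seq_cond [X in _ + X]big1 ?addr0 => [|lam /andP[lS]]; last first.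
  by rewrite (multE _ lS) -eqn0Ngt => /eqP ->; rewrite mul0r.
rewrite big_seq_cond [RHS]big_seq_cond; apply: eq_bigr => lam /andP[lS _].
by rewrite mxtrace_muln (multE _ lS).
Qed.
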